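(* Let $n\in\mathbb N_+$, let $t\geq 2$ be an integer, and let $Y$ be a $\lfloor t/2\rfloor$-design set on $\mathbb{CP}^n$. Let $W_Y$ and $M_Y$ be the constants associated to $Y$ defined in the context, so that $$W_Y\in\left(0,\ 2(|Y|-1)\sup_{y_1,y_2\in Y}d_{\mathbb{CP}^n}(y_1,y_2)\right],\qquad M_Y>0.$$ For any $\delta\in(0,M_Y)$, there exists a simple $\left(\frac{W_Y+\delta}{2\pi|Y|},\frac{1}{2\pi|Y|}\right)$-approximate $t$-design curve $\gamma_Y$ on $S^{2n+1}$ of length $\ell(\gamma_Y)=2\pi|Y|+W_Y-\delta$. Moreover, $\gamma_Y$ may be taken to be a geodesic cycle, and it may alternatively be taken to be smooth.
   Context: Approximate design curves. $P_t(S^d)$ is the space of restrictions to the unit sphere $S^d\subset\mathbb R^{d+1}$ of real-valued polynomials on $\mathbb R^{d+1}$ of degree at most $t$. $\sigma$ is the uniform measure on $S^d$ with $\sigma(S^d)=1$. For a curve $\gamma:[0,1]\to S^d$, write $\int_\gamma f:=\int_0^1 f(\gamma(s))|\gamma'(s)|\,ds$ and $\ell(\gamma):=\int_\gamma 1$. For $\varepsilon\ge0$ and $c>0$, a continuous, piecewise smooth, closed curve $\gamma:[0,1]\to S^d$ with finitely many self-intersections is an $(\varepsilon,c)$-approximate $t$-design curve if $\left|c\int_\gamma f-\int_{S^d}f\,d\sigma\right|\le\varepsilon\sup_{S^d}|f|$ for all $f\in P_t(S^d)$. A geodesic cycle is a closed curve which connects finitely many points along geodesics. Complex projective design sets. $\mathbb{CP}^n$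 is the quotient of $S^{2n+1}\subset\mathbb C^{n+1}$ by the multiplicative action of $S^1\subset\mathbb C$, with its uniform measure $\rho$, $\rho(\mathbb{CP}^n)=1$, and $\Pi:S^{2n+1}\to\mathbb{CP}^n$, $\omega\mapsto[\omega]=\{\omega z\mid z\in S^1\}$, is the projection. $P_k(\mathbb{CP}^n)$ is the set of $g:\mathbb{CP}^n\to\mathbb R$ with $g\circ\Pi\in P_{2k}(S^{2n+1})$. A finite subset $Y\subset\mathbb{CP}^n$ is a $k$-design set on $\mathbb{CP}^n$ if $\frac{1}{|Y|}\sum_{y\in Y}g(y)=\int_{\mathbb{CP}^n}g\,d\rho$ for all $g\in P_k(\mathbb{CP}^n)$. Constants. $\mathbb{CP}^n$ carries the metric $d_{\mathbb{CP}^n}([\omega_1],[\omega_2]):=\inf_{z\in S^1}\arccos\langle\omega_1,z\omega_2\rangle_{\mathbb R}$, where $\langle\cdot,\cdot\rangle_{\mathbb R}$ is the standard inner product on $\mathbb R^{2n+2}$. For a finite $Y\subset\mathbb{CP}^n$, consider the weighted graph with vertex set $Y$ and one edge for each pair $y_1,y_2\in Y$ for which there is a minimal geodesic between $y_1$ and $y_2$ whose interior is disjoint from $Y$; this edge has weight equal to the length of that geodesic. Fix a minimum spanning tree $\mathcal T_Y$ of this graph. Then $W_Y$ is twice the sum of the weights of the edges of $\mathcal T_Y$, $N_Y$ is the maximal number of edges of $\mathcal T_Y$ connected to any one vertex, and $M_Y:=2\pi(|Y|-1)/N_Y$. *)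

(* Defs.v *)
From HB Require Import structures.
From mathcomp Require Import -(notations) mpoly.
From mathcomp Require Import all_boot all_order all_algebra.
From mathcomp Require Import finmap complex.
From mathcomp Require Import all_classical all_reals all_analysis.

Set Implicit Arguments.
Unset Strict Implicit.
Unset Printing Implicit Defensive.

Import Order.TTheory GRing.Theory Num.Theory.
Import numFieldNormedType.Exports.

Local Open Scope classical_set_scope.
Local Open Scope ring_scope.

(* The library norm on 'rV[R]_m is the sup norm; the Euclidean structure is
   therefore introduced separately. *)
Definition dot (R : realType) (m : nat) (x y : 'rV[R]_m) : R :=
  \sum_i x 0 i * y 0 i.

Definition enorm (R : realType) (m : nat) (x : 'rV[R]_m) : R :=
  Num.sqrt (dot x x).

Definition unit_sphere (R : realType) (d : nat) : set 'rV[R]_d.+1 :=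
  [set x | enorm x = 1].

Lemma unit_sphere_base (R : realType) (d : nat) :
  (delta_mx 0 0 : 'rV[R]_d.+1) \in @unit_sphere R d.
Proof.
rewrite inE /unit_sphere /enorm /dot /= (bigD1 ord0) //= big1 ?addr0.
  by rewrite mxE eqxx mulr1 sqrtr1.
by move=> i i0; rewrite mxE (negbTE i0) andbF mulr0.
Qed.

(* S^d with the subspace topology *)
Definition sphere (R : realType) (d : nat) : Type :=
  set_type (@unit_sphere R d).
HB.instance Definition _ (R : realType) (d : nat) :=
  Topological.on (sphere R d).
HB.instance Definition _ (R : realType) (d : nat) :=
  isPointed.Build (sphere R d) (SigSub (unit_sphere_base R d)).

Definition emb (R : realType) (d : nat) (x : sphere R d) : 'rV[R]_d.+1 :=
  \val x.
Arguments emb {R d} x.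

Definition borel (T : ptopologicalType) := g_sigma_algebraType (@open T).

(* The uniform measure on S^d is the unique Borel probability measure that is
   invariant under the orthogonal group; Q acts on row vectors from the right
   and phi is the map that it induces on the sphere. *)
Definition uniform_measure (R : realType) (d : nat)
    (sigma : probability (borel (sphere R d)) R) : Prop :=
  forall (Q : 'M[R]_d.+1) (phi : sphere R d -> sphere R d),
    Q *m Q^T = 1%:M -> (forall x, emb (phi x) = emb x *m Q) ->
    forall A : set (borel (sphere R d)), measurable A ->
      sigma (phi @^-1` A) = sigma A.

(* P_t(S^d); mpoly.msize is 1 + the total degree, and 0 on the zero
   polynomial. *)
Definition sphere_poly (R : realType) (d t : nat) (f : sphere R d -> R) : Prop :=
  exists p : mpoly.mpoly d.+1 R, (mpoly.msize p <= t.+1)%N /\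
    forall x, f x = mpoly.meval (fun i => emb x 0 i) p.

(* A curve [0,1] -> S^d is a total function on R of which only the values on
   [0,1] matter. *)
Section curves.
Variables (R : realType) (d : nat).
Implicit Types gamma : R -> sphere R d.

Definition curve_integral gamma (f : sphere R d -> R) : R :=
  \int[lebesgue_measure]_(s in `[0, 1])
    (f (gamma s) * enorm (derive1 (emb \o gamma) s)).

Definition curve_length gamma : R := curve_integral gamma (fun=> 1).

Definition smooth_fun (g : R -> 'rV[R]_d.+1) : Prop :=
  forall k s, derivable (derive1n k g) s 1.

(* gamma is smooth on the closed interval [a,b], i.e., it has a smooth
   extension. Smooth curves are regular: otherwise every corner could be
   smoothed by stopping at it. *)
Definition smooth_arc gamma (a b : R) : Prop :=
  exists g : R -> 'rV[R]_d.+1, smooth_fun g /\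
    forall s, a <= s <= b -> g s = emb (gamma s) /\ derive1 g s != 0.

(* Great-circle arcs, traversed at constant speed and of arbitrary length *)
Definition geodesic_arc gamma (a b : R) : Prop :=
  exists (u v : 'rV[R]_d.+1) (k : R),
    [/\ dot u u = 1, dot v v = 1, dot u v = 0, 0 < k &
      forall s, a <= s <= b ->
        emb (gamma s) = cos (k * (s - a)) *: u + sin (k * (s - a)) *: v].

Definition piecewise (P : R -> R -> Prop) : Prop :=
  exists p : seq R, itv_partition 0 1 p /\
    forall i, (i < size p)%N -> P (nth 0 (0 :: p) i) (nth 0 p i).

Definition closed_curve gamma : Prop :=
  {within `[0, 1], continuous gamma} /\ gamma 0 = gamma 1.

(* The parameters 0 and 1 are identified, so only [0,1) is considered. *)
Definition self_intersections gamma : set (R * R) :=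
  [set st | [/\ 0 <= st.1, st.1 < st.2, st.2 < 1 & gamma st.1 = gamma st.2]].

Definition simple_curve gamma : Prop := self_intersections gamma = set0.

Definition geodesic_cycle gamma : Prop :=
  closed_curve gamma /\ piecewise (geodesic_arc gamma).

(* Smoothness as a closed curve, i.e., also at the base point gamma 0 *)
Definition smooth_closed_curve gamma : Prop :=
  exists g : R -> 'rV[R]_d.+1,
    [/\ smooth_fun g, forall s, g (s + 1) = g s, forall s, derive1 g s != 0 &
      forall s, 0 <= s <= 1 -> g s = emb (gamma s)].

Definition approx_design_curve (sigma : probability (borel (sphere R d)) R)
    (eps c : R) (t : nat) gamma : Prop :=
  [/\ 0 <= eps /\ 0 < c,
      closed_curve gamma,
      piecewise (smooth_arc gamma),
      finite_set (self_intersections gamma) &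
      forall f : sphere R d -> R, sphere_poly t f ->
        `|c * curve_integral gamma f - \int[sigma]_x f x|
          <= eps * sup (range (fun x => `|f x|))].

End curves.

(* R^(2n+2) and C^(n+1) are identified through
   (a_0, .., a_n, b_0, .., b_n) <-> (a_0 + i b_0, .., a_n + i b_n);
   the unit sphere S^(2n+1) of R^(2n+2) is sphere R (n + n.+1). *)
Definition to_complex (R : realType) (n : nat) (x : 'rV[R]_(n.+1 + n.+1)) :
    'rV[R[i]]_n.+1 :=
  \row_j Complex (x 0 (lshift n.+1 j)) (x 0 (rshift n.+1 j)).

Definition of_complex (R : realType) (n : nat) (w : 'rV[R[i]]_n.+1) :
    'rV[R]_(n.+1 + n.+1) :=
  row_mx (map_mx (@complex.Re R) w) (map_mx (@complex.Im R) w).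

Notation hopf_sphere R n := (sphere R (n + n.+1)).

Section projective_space.
Variables (R : realType) (n : nat).

Definition cembed (x : hopf_sphere R n) : 'rV[R[i]]_n.+1 :=
  to_complex (emb x).

Definition same_fiber (x y : hopf_sphere R n) : bool :=
  `[< exists z : R[i], `|z| = 1 /\ cembed y = z *: cembed x >].

Lemma same_fiber_refl : reflexive same_fiber.
Proof. by move=> x; apply/asboolP; exists 1; rewrite normr1 scale1r. Qed.

Lemma same_fiber_sym : symmetric same_fiber.
Proof.
have sym x y : same_fiber x y -> same_fiber y x.
  move=> /asboolP[z [z1 e]]; apply/asboolP; exists z^-1.
  rewrite normfV z1 invr1 e scalerA mulVf ?scale1r//.
  by rewrite -normr_eq0 z1 oner_neq0.
by move=> x y; apply/idP/idP; apply: sym.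
Qed.

Lemma same_fiber_trans : transitive same_fiber.
Proof.
move=> y x w /asboolP[z [z1 e]] /asboolP[z' [z1' e']]; apply/asboolP.
by exists (z' * z); rewrite normrM z1 z1' mulr1 e' e scalerA.
Qed.

Canonical same_fiber_equiv :=
  EquivRel same_fiber same_fiber_refl same_fiber_sym same_fiber_trans.

(* CP^n = S^(2n+1) / S^1 with the quotient topology *)
Definition CP : Type := quotient_topology {eq_quot same_fiber}%qT.
HB.instance Definition _ := Quotient.on CP.
HB.instance Definition _ := PointedTopological.on CP.
HB.instance Definition _ := Choice.on CP.

Definition Pi (x : hopf_sphere R n) : CP := (\pi_CP x)%qT.

(* The uniform measure on the quotient: the image of that of the sphere *)
Definition CP_measure (sigma : probability (borel (hopf_sphere R n)) R) :
    set (borel CP) -> \bar R :=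
  pushforward sigma (Pi : borel (hopf_sphere R n) -> borel CP).

Definition CP_poly (k : nat) (g : CP -> R) : Prop :=
  sphere_poly k.*2 (g \o Pi).

Definition design_set (sigma : probability (borel (hopf_sphere R n)) R)
    (k : nat) (Y : {fset CP}) : Prop :=
  forall g : CP -> R, CP_poly k g ->
    (((#|` Y|)%:R^-1 * \sum_(y <- Y) g y)%:E
      = \int[CP_measure sigma]_y (g y)%:E)%E.

Definition CP_dist (y1 y2 : CP) : R :=
  inf [set acos (dot (emb (repr y1)) (of_complex (z *: cembed (repr y2))))
      | z in [set z : R[i] | `|z| = 1]].

(* c, restricted to [0, CP_dist y1 y2], is a minimal geodesic from y1 to y2
   parametrized by arc length. *)
Definition minimal_geodesic (c : R -> CP) (y1 y2 : CP) : Prop :=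
  [/\ c 0 = y1, c (CP_dist y1 y2) = y2 &
    forall s s', 0 <= s <= CP_dist y1 y2 -> 0 <= s' <= CP_dist y1 y2 ->
      CP_dist (c s) (c s') = `|s - s'|].

Definition geodesic_graph (Y : {fset CP}) : rel Y := fun y1 y2 =>
  `[< y1 != y2 /\ exists c : R -> CP,
        minimal_geodesic c (val y1) (val y2) /\
        forall s, 0 < s < CP_dist (val y1) (val y2) -> c s \notin Y >].

End projective_space.

(* A simple graph on V is a symmetric irreflexive relation. *)
Section spanning_trees.
Variables (R : realType) (V : finType).
Implicit Types G T : rel V.

Definition spanning_tree G T : Prop :=
  [/\ symmetric T, subrel T G, forall x y, connect T x y &
      forall p : seq V, (2 < size p)%N -> ~~ ucycleb T p].

(* Each edge contributes two ordered pairs. *)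
Definition graph_weight (w : V -> V -> R) T : R :=
  (\sum_x \sum_(y | T x y) w x y) / 2.

Definition minimum_spanning_tree (w : V -> V -> R) G T : Prop :=
  spanning_tree G T /\
  forall T', spanning_tree G T' -> graph_weight w T <= graph_weight w T'.

Definition max_degree T : nat := \max_x #|[pred y | T x y]|.

End spanning_trees.

Section constants.
Variables (R : realType) (n : nat) (Y : {fset CP R n}).

Definition edge_weight (y1 y2 : Y) : R := CP_dist (val y1) (val y2).

Definition W_ (T : rel Y) : R := 2 * graph_weight edge_weight T.

Definition M_ (T : rel Y) : R :=
  2 * pi * ((#|` Y|)%:R - 1) / (max_degree T)%:R.

End constants.

(* Main.v *)
(* Over each point of Y lies a great circle of S^(2n+1). The average of a
   function f in P_t over these circles is an even polynomial of degree at most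
   t that is constant on the fibres, so the |Y| circles together integrate f
   exactly. They are joined into one closed curve by growing the spanning tree
   leaf by leaf. A minimal geodesic of length d between two points of Y has a
   horizontal lift, and the rotations of this lift by S^1 fill a strip
   rot th (cos s p + sin s v), 0 <= s <= d, between the two circles, on which
   (th, s) are isometric coordinates. An arc of length alpha = alpha0 + k of the
   old circle is replaced by an excursion that crosses the strip along one edge,
   runs through the new circle except for an arc of length alpha, and comes back
   along the other edge; k is the length that is added to each crossing by
   rounding its corners (k = 0 for geodesics). With
   alpha0 = delta / (2 (|Y| - 1)), the edge adds 2d - 2 alpha0 to the length of
   the circles. It adds at most (2d + 2 alpha0) sup |f| to the error, because
   elements of P_t hardly vary along arcs of a small length r >= 4 k, uniformly
   in f. Two strips overlap only for one relative phase (mod 2 pi), so if the arcs to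
   be avoided on a circle have total length alpha (2 N_Y - 1) < 2 pi, up to an
   arbitrarily small amount, then a phase can be chosen for which the curve stays
   simple; this is the condition delta < M_Y. *)

Require Import Defs.
From mathcomp Require Import -(notations) mpoly.
From mathcomp Require Import all_boot all_order all_algebra.
From mathcomp Require Import finmap complex qpoly.
From mathcomp Require Import all_classical all_reals all_analysis.
From mathcomp Require Import measurable_realfun.
From mathcomp Require Import zify ring lra.

Set Implicit Arguments.
Unset Strict Implicit.
Unset Printing Implicit Defensive.

Import Order.TTheory GRing.Theory Num.Theory.
Import numFieldNormedType.Exports.

Local Open Scope classical_set_scope.
Local Open Scope ring_scope.

(** A boolean [s] carries both conclusions: [true] stands for smooth curves, [false] for broken
    geodesics, and excursions and tours are treated for both at once. The obstacle is that edges
    attached early must leave room for later ones, whose phases are not yet chosen. The invariant of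
    a tour therefore promises that on each visited circle every arc of length alpha that avoids the
    base point and the arcs already removed is still traversed in one piece. When an edge is
    attached at a vertex, at most N_Y - 1 edges are present there; each blocks phases of total
    length 2 alpha and the base point blocks alpha, whence the factor 2 N_Y - 1. The crossings
    occupy bands of width a along the edges of a strip, and every older strip blocks phases of total
    length 6 a; this is the arbitrarily small amount. The constants are fixed in the order alpha0,
    r, eta, and only then k and a, both at most eta. The condition r >= 4 k expresses that the
    rounding of the corners is paid for by comparing the excursion with the removed arc during a
    time r. *)

(** * Antiderivatives of continuous functions on the line *)

Section antiderivative.
Variable R : realType.
Implicit Types (h F : R -> R) (a b x : R).

Lemma is_derive1_continuous h F x : is_derive x 1 F (h x) -> {for x, continuous F}.
Proof. by move=> [d _]; exact/differentiable_continuous/derivable1_diffP. Qed.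

Lemma eq_derive_const h F G : (forall x, is_derive x 1 F (h x)) ->
  (forall x, is_derive x 1 G (h x)) -> forall a b, F b - F a = G b - G a.
Proof.
move=> dF dG.
suff H a b : a <= b -> F b - F a = G b - G a.
  move=> a b; have [/H//|/ltW/H] := leP a b; lra.
move=> ab.
have [||c _] := @MVT_segment _ (F - G) (fun=> 0) a b ab.
- by move=> x _; rewrite -(subrr (h x)); exact: is_deriveB.
- apply: continuous_subspaceT => x.
  by apply: (@is_derive1_continuous (fun x => h x - h x)); apply: is_deriveB.
rewrite mul0r !fctE; lra.
Qed.

Lemma continuous_integrable h a b : continuous h ->
  lebesgue_measure.-integrable `[a, b] (EFin \o h).
Proof.
move=> hc; apply: continuous_compact_integrable; first exact: segment_compact.
exact: continuous_subspaceT.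
Qed.

(** An integral from a fixed left end point is differentiable only to the right of it. The base
    point is therefore an integer below [x]; subtracting the value at 0 makes the result independent
    of this integer, so that near each point [F] is a single such integral up to a constant. *)
Lemma ex_antiderivative h : continuous h ->
  exists F, forall x, is_derive x 1 F (h x).
Proof.
move=> hc.
pose A a x := \int[lebesgue_measure]_(t in `[a, x]) h t.
have int a b : lebesgue_measure.-integrable `[a, b] (EFin \o h).
  exact: continuous_integrable.
have dA a x : a < x -> is_derive x 1 (A a) (h x).
  move=> ax; have xx1 : x < x + 1 by rewrite ltrDl.
  have [d1 d2] := @continuous_FTC1_closed _ h a x (x + 1) xx1 (int _ _) ax (hc x).
  by apply: DeriveDef; [exact: d1|rewrite -derive1E].
have split a b x : a <= b -> b <= x -> A a x = A a b + A b x.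
  move=> ab bx; rewrite /A.
  have := @Rintegral_itvB _ h (BLeft a) (BRight x) b (int a x).
  rewrite !bnd_simp => /(_ ab bx).
  rewrite Rintegral_itv_obnd_cbnd; first by move=> <-; rewrite addrC subrK.
  by apply: integrableS (int b x) => //; exact: subset_itv_oc_cc.
have splitN (n m : nat) x : (m <= n)%N -> - m%:R <= x ->
    A (- n%:R) x = A (- n%:R) (- m%:R) + A (- m%:R) x.
  by move=> mn mx; apply: split => //; rewrite lerN2 ler_nat.
pose N x := (Num.truncn `|x|).+1.
have Nx x : `|x| < (N x)%:R by exact: truncnS_gt.
pose F x := A (- (N x)%:R) x - A (- (N x)%:R) 0.
have FE x n : (N x <= n)%N -> F x = A (- n%:R) x - A (- n%:R) 0.
  move=> Nn; rewrite /F [in RHS](splitN _ _ x Nn); last first.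
    by rewrite lerNl (le_trans _ (ltW (Nx x)))// -normrN ler_norm.
  rewrite (splitN _ _ 0 Nn); last by rewrite oppr_le0.
  lra.
exists F => x; pose n := (N x).+1.
apply: (@near_eq_is_derive _ _ _ (A (- n%:R) - cst (A (- n%:R) 0))).
  near=> y; rewrite !fctE (FE y n)//.
  have : `|x - y| < 1 by near: y; apply: cvgr_dist_lt.
  move=> xy; rewrite /n /N -(ltr_nat R).
  rewrite (@le_lt_trans _ _ `|y|) ?truncn_le//.
  have := ler_distD x y 0; have := Nx x; rewrite /N !subr0 distrC.
  rewrite -[in X in _ -> _ -> is_true X]natr1; lra.
rewrite -[h x]subr0; apply: is_deriveB; apply: dA.
rewrite ltrNl (@le_lt_trans _ _ `|x|) //; first by rewrite -normrN ler_norm.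
by rewrite (lt_trans (Nx x))// /n ltr_nat.
Unshelve. all: by end_near. Qed.

End antiderivative.

(** * Smooth functions and the mean value theorem *)

Section smooth_functions.
Variable R : realType.

Definition smooth (V : normedModType R) (g : R -> V) : Prop :=
  forall k s, derivable (derive1n k g) s 1.

Lemma derive1nSr (V : normedModType R) (g : R -> V) k :
  derive1n k.+1 g = derive1n k (derive1 g).
Proof. by rewrite /derive1n iterSr. Qed.

Lemma smooth_derivable (V : normedModType R) (g : R -> V) s :
  smooth g -> derivable g s 1.
Proof. by move=> /(_ 0%N s). Qed.

Lemma derivable_continuous (V : normedModType R) (g : R -> V) s :
  derivable g s 1 -> {for s, continuous g}.
Proof. by move=> ?; exact/differentiable_continuous/derivable1_diffP. Qed.

Lemma smooth_continuous (V : normedModType R) (g : R -> V) :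
  smooth g -> continuous g.
Proof. by move=> sg s; exact/derivable_continuous/smooth_derivable. Qed.

Lemma smooth_derive1 (V : normedModType R) (g : R -> V) :
  smooth g -> smooth (derive1 g).
Proof. by move=> sg k s; rewrite -derive1nSr; apply: sg. Qed.

Lemma smooth_is_derive (V : normedModType R) (g : R -> V) (s : R) :
  smooth g -> is_derive s 1 g (derive1 g s).
Proof.
by move=> sg; rewrite derive1E; apply: DeriveDef => //; exact: smooth_derivable.
Qed.

Lemma is_derive_derive1 (V : normedModType R) (g dg : R -> V) :
  (forall s : R, is_derive s 1 g (dg s)) -> derive1 g = dg.
Proof. by move=> d; apply/funext => s; rewrite derive1E; case: (d s). Qed.

Lemma near_derive1n (V : normedModType R) (g h : R -> V) k (s : R) :
  (\near s, g s = h s) -> \near s, derive1n k g s = derive1n k h s.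
Proof.
elim: k => [//|k IH gh]; have /near_join H := IH gh; near=> t.
rewrite !derive1nS !derive1E; apply: near_eq_derive.
by near: t; exact: H.
Unshelve. all: by end_near. Qed.

Lemma smooth_local (V : normedModType R) (g : R -> V) :
  (forall s : R, exists2 h, smooth h & \near s, g s = h s) -> smooth g.
Proof.
move=> H k s; have [h sh gh] := H s.
apply: (@ex_derive _ _ _ _ _ _ (derive1n k.+1 h s)).
apply: (@near_eq_is_derive _ _ _ (derive1n k h)).
  by near=> t; apply/esym; near: t; exact: near_derive1n.
by rewrite derive1nS derive1E; exact/DeriveDef.
Unshelve. all: by end_near. Qed.

Lemma smooth_row d (g : R -> 'rV[R]_d.+1) :
  (forall i, smooth (fun s => g s 0 i)) -> smooth_fun g.
Proof.
move=> sg k.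
suff H s i : derive1n k g s 0 i = derive1n k (fun s => g s 0 i) s.
  move=> s; apply/derivable_mxP => i j; rewrite ord1.
  by under eq_fun do rewrite H; exact: sg.
elim: k s i => [//|k IH] s i; rewrite !derive1nS !derive1E.
have d1 : derivable (derive1n k g) s 1.
  apply/derivable_mxP => i' j; rewrite ord1.
  by under eq_fun do rewrite IH; exact: sg.
by rewrite derive_mx// mxE; congr ('D_1 _ s); apply/funext => u; exact: IH.
Qed.

Lemma derive_row d (g : R -> 'rV[R]_d.+1) (s : R) i : derivable g s 1 ->
  derive1 g s 0 i = derive1 (fun s => g s 0 i) s.
Proof. by move=> dg; rewrite !derive1E derive_mx// mxE. Qed.

End smooth_functions.

Lemma mean_value_le (R : realType) (h F : R -> R) (a b : R) : a <= b ->
  (forall x : R, is_derive x 1 F (h x)) ->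
  exists2 c, a <= c <= b & F b - F a = h c * (b - a).
Proof.
move=> ab dF; have [|c] := @MVT_segment _ F h a b ab (fun x _ => dF x).
  by apply: continuous_subspaceT => x; exact: is_derive1_continuous.
by rewrite in_itv/= => ? ?; exists c.
Qed.

Lemma mean_value_lt (R : realType) (h F : R -> R) (a b : R) : a < b ->
  (forall x : R, is_derive x 1 F (h x)) ->
  exists2 c, a < c < b & F b - F a = h c * (b - a).
Proof.
move=> ab dF; have [|c] := @MVT _ F h a b ab (fun x _ => dF x).
  by apply: continuous_subspaceT => x; exact: is_derive1_continuous.
by rewrite in_itv/= => ? ?; exists c.
Qed.

Section smooth_functions.
Variable R : realType.
(* A family of functions that is closed under differentiation consists of
   smooth functions. *)
Inductive alg (B : (R -> R) -> Prop) : (R -> R) -> Prop :=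
| alg_base f : B f -> alg B f
| alg_cst c : alg B (fun=> c)
| alg_add f g : alg B f -> alg B g -> alg B (fun x => f x + g x)
| alg_mul f g : alg B f -> alg B g -> alg B (fun x => f x * g x).

Lemma alg_smooth (B : (R -> R) -> Prop) :
  (forall f, B f -> exists2 df, alg B df & forall x : R, is_derive x 1 f (df x)) ->
  forall f, alg B f -> smooth f.
Proof.
move=> HB.
have Hd f : alg B f -> exists2 df, alg B df & forall x : R, is_derive x 1 f (df x).
  elim=> [g /HB//|c|g h Ag [dg Adg dgE] Ah [dh Adh dhE]
    |g h Ag [dg Adg dgE] Ah [dh Adh dhE]].
  - by exists (fun=> 0) => [|x]; [exact: alg_cst|exact: is_derive_cst].
  - exists (fun x => dg x + dh x); first exact: alg_add.
    by move=> x; exact: is_deriveD.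
  - exists (fun x => g x * dh x + h x * dg x).
      by apply: alg_add; apply: alg_mul.
    by move=> x; exact: is_deriveM.
move=> f Af k; suff [g Ag ->] : exists2 g, alg B g & derive1n k f = g.
  by move=> s; have [dg _ dgE] := Hd _ Ag.
elim: k => [|k [g Ag gE]]; first by exists f.
have [dg Adg dgE] := Hd _ Ag.
by exists dg => //; rewrite derive1nS gE; exact: is_derive_derive1.
Qed.

(** A family whose derivatives stay in the algebra that it generates: the chain rule only produces
    [derive1 g] after the same affine map, the constant [c], and a swap of cosine and sine. The
    closure properties below all follow from it. *)
Let B (f : R -> R) := exists2 g : R -> R, smooth g & exists c e : R,
  [\/ f = (fun x => g (c * x + e)), f = (fun x => cos (g (c * x + e))) |
      f = (fun x => sin (g (c * x + e)))].

Let B_aff g c e : smooth g -> B (fun x => g (c * x + e)).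
Proof. by move=> sg; exists g => //; exists c, e; constructor. Qed.

Let B_smooth f : alg B f -> smooth f.
Proof.
apply: alg_smooth => {}f [g sg [c [e H]]].
have dgc (x : R) : is_derive x 1 (fun x => g (c * x + e)) (derive1 g (c * x + e) * c).
  rewrite (_ : (fun x => _) = g \o (fun x => c * x + e))//.
  apply: is_derive1_comp; first exact: smooth_is_derive.
  rewrite -[c in is_derive _ _ _ c]addr0; apply: is_deriveD.
  rewrite -[c in is_derive _ _ _ c]mulr1.
  exact: (@is_deriveZ _ _ _ id).
have Adg : alg B (fun x => derive1 g (c * x + e) * c).
  apply: alg_mul; last exact: alg_cst.
  by apply: alg_base; apply: B_aff; exact: smooth_derive1.
case: H => ->.
- by exists (fun x => derive1 g (c * x + e) * c).
- exists (fun x => (-1 * sin (g (c * x + e))) * (derive1 g (c * x + e) * c)).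
    apply: alg_mul => //; apply: alg_mul; first exact: alg_cst.
    by apply: alg_base; exists g => //; exists c, e; constructor.
  move=> x; rewrite mulN1r.
  rewrite (_ : (fun x => _) = cos \o (fun x => g (c * x + e)))//.
  exact: is_derive1_comp.
- exists (fun x => cos (g (c * x + e)) * (derive1 g (c * x + e) * c)).
    apply: alg_mul => //.
    by apply: alg_base; exists g => //; exists c, e; constructor.
  move=> x.
  rewrite (_ : (fun x => _) = sin \o (fun x => g (c * x + e)))//.
  exact: is_derive1_comp.
Qed.

Let B_id g : smooth g -> B g.
Proof.
move=> /(B_aff 1 0); congr B.
by apply/funext => x; rewrite mul1r addr0.
Qed.

Lemma smooth_affine (g : R -> R) c e : smooth g -> smooth (fun x => g (c * x + e)).
Proof. by move=> sg; apply/B_smooth/alg_base/B_aff. Qed.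

Lemma smooth_cst (c : R) : smooth (fun=> c : R).
Proof. exact/B_smooth/alg_cst. Qed.

Lemma smoothD (f g : R -> R) : smooth f -> smooth g -> smooth (fun x => f x + g x).
Proof. by move=> sf sg; apply/B_smooth/alg_add; apply/alg_base/B_id. Qed.

Lemma smoothM (f g : R -> R) : smooth f -> smooth g -> smooth (fun x => f x * g x).
Proof. by move=> sf sg; apply/B_smooth/alg_mul; apply/alg_base/B_id. Qed.

Lemma smooth_cos (g : R -> R) : smooth g -> smooth (fun x => cos (g x)).
Proof.
move=> sg; apply/B_smooth/alg_base; exists g => //; exists 1, 0; constructor 2.
by apply/funext => x; rewrite mul1r addr0.
Qed.

Lemma smooth_sin (g : R -> R) : smooth g -> smooth (fun x => sin (g x)).
Proof.
move=> sg; apply/B_smooth/alg_base; exists g => //; exists 1, 0; constructor 3.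
by apply/funext => x; rewrite mul1r addr0.
Qed.

Lemma smooth_antiderivative (f F : R -> R) :
  smooth f -> (forall x : R, is_derive x 1 F (f x)) -> smooth F.
Proof.
move=> sf dF [|k] s; first by case: (dF s).
by rewrite derive1nSr (is_derive_derive1 dF).
Qed.

Lemma smooth_id : smooth (@id R).
Proof. by apply: (@smooth_antiderivative (fun=> 1)); first exact: smooth_cst. Qed.

End smooth_functions.

(** * A smooth step function *)

Section bump.
Variable R : realType.

(** The flat function exp(-1/x), multiplied by powers of 1/x so that the family is closed under
    differentiation. *)
Let b (k : nat) (x : R) : R := if 0 < x then x^-1 ^+ k * expR (- x^-1) else 0.

Let b_ge0 k x : 0 <= b k x.
Proof.
rewrite /b; case: ifP => // x0.
by rewrite mulr_ge0 ?expR_ge0// exprn_ge0// invr_ge0 ltW.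
Qed.

(** The term of order k + 2 in the series of exp(1/x) absorbs the factor x^(-k) and leaves x^2, so
    the difference quotient at 0 tends to 0. *)
Let b_le k x : b k x <= (k.+2)`!%:R * x ^+ 2.
Proof.
rewrite /b; case: ifP => x0; last by rewrite mulr_ge0// sqr_ge0.
rewrite expRN ler_pdivrMr ?expR_gt0//.
have H : x^-1 ^+ k.+2 / (k.+2)`!%:R <= expR x^-1.
  apply: (le_trans _ (expR_ge1Dxn k.+1 _)); first by rewrite lerDr.
  by rewrite invr_ge0 ltW.
have f0 : 0 < (k.+2)`!%:R :> R by rewrite ltr0n fact_gt0.
apply: (le_trans _ (ler_wpM2l _ H)); last by rewrite mulr_ge0 ?sqr_ge0// ltW.
have : x != 0 by rewrite gt_eqF.
have : (k.+2)`!%:R != 0 :> R by rewrite gt_eqF.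
have -> : x^-1 ^+ k.+2 = x^-1 ^+ k * x^-1 ^+ 2 by rewrite -exprD addn2.
move: ((k.+2)`!%:R) (x^-1 ^+ k) => c w c0 xn0.
by rewrite le_eqVlt; apply/orP; left; apply/eqP; field; rewrite c0 xn0.
Qed.

Let b0 k x : x <= 0 -> b k x = 0.
Proof. by rewrite /b leNgt; case: ifP. Qed.

Let b_der k : h^-1 *: (b k (h *: 1 + 0) - b k 0) @[h --> 0^'] --> (0 : R).
Proof.
apply/cvgrPdist_le => /= e e0; near=> h.
have h0 : h != 0 by near: h; exact: nbhs_dnbhs_neq.
rewrite sub0r normrN (b0 _ (lexx _)) subr0 addr0 /GRing.scale /= mulr1.
rewrite normrM normfV ler_pdivrMl ?normr_gt0// ger0_norm//.
apply: (le_trans (b_le _ _)); rewrite mulrC -[h ^+ 2]real_normK ?num_real//.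
rewrite expr2 -mulrA ler_wpM2l// -ler_pdivlMr ?ltr0n ?fact_gt0//.
near: h; apply: dnbhs0_le; rewrite divr_gt0 ?ltr0n ?fact_gt0//.
Unshelve. all: by end_near. Qed.

Let is_derive_b k (x : R) :
  is_derive x 1 (b k) (- k%:R * b k.+1 x + b k.+2 x).
Proof.
have [x0|x0|->] := ltgtP x 0.
- rewrite !b0 ?ltW// mulr0 addr0.
  apply: (@near_eq_is_derive _ _ _ (fun=> 0)).
    by near=> y; rewrite b0//; near: y; exact: lt_le_nbhsl.
- pose g (y : R) : R := (y^-1) ^+ k * expR (- y^-1).
  suff : is_derive x 1 g (- k%:R * b k.+1 x + b k.+2 x).
    apply: near_eq_is_derive; near=> y; rewrite /b ifT//.
    by near: y; exact: lt_nbhsr.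
  have dV : is_derive x 1 (fun y : R => y^-1) (- x ^- 2 *: 1).
    by apply: (@is_deriveV _ id); rewrite gt_eqF.
  have dX := is_deriveX k dV.
  have dE : is_derive x 1 (expR \o (fun y : R => - y^-1))
      (expR (- x^-1) * (- (- x ^- 2 *: 1))).
    by apply: is_derive1_comp; exact: is_deriveN.
  have D := is_deriveM dX dE.
  have -> : g = (fun y : R => y^-1) ^+ k * (expR \o (fun y : R => - y^-1)).
    by apply/funext => y; rewrite /g !fctE.
  apply: (is_derive_eq D).
  rewrite /b x0 !fctE /GRing.scale /= -exprVn mulr1.
  move: x^-1 => u.
  case: k {dX D g} => [|k]; rewrite ?expr0 ?exprS /=; ring.
rewrite !b0// mulr0 addr0; apply: DeriveDef.
  apply/cvg_ex; exists 0; exact: b_der.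
by apply: cvg_lim => //; exact: b_der.
Unshelve. all: by end_near. Qed.

Lemma ex_smooth_step : exists psi : R -> R,
  [/\ smooth psi, forall x, x <= 0 -> psi x = 0, forall x, 1 <= x -> psi x = 1 &
      forall x, 0 < x < 1 -> 0 < psi x < 1].
Proof.
have sb k : smooth (b k).
  apply: (@alg_smooth _ (fun f => exists k, f = b k)); last first.
    by apply: alg_base; exists k.
  move=> _ [{}k ->]; exists (fun x => - k%:R * b k.+1 x + b k.+2 x) => //.
  by apply: alg_add; [apply: alg_mul; first exact: alg_cst|];
    apply: alg_base; eexists.
(* A bump that is positive exactly on the open interval from 0 to 1; its normalized antiderivative
   is the step. *)
pose g x := b 0 x * b 0 (-1 * x + 1).
have sg : smooth g by apply: smoothM => //; apply: smooth_affine.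
have [G dG] := ex_antiderivative (smooth_continuous sg).
have g0 x : x <= 0 -> g x = 0 by move=> x0; rewrite /g b0// mul0r.
have g1 x : 1 <= x -> g x = 0.
  by move=> x1; rewrite /g [X in _ * X]b0 ?mulr0//; lra.
have gp x : 0 < x < 1 -> 0 < g x.
  move=> x1; rewrite /g /b !ifT; [|lra..].
  by rewrite !expr0 !mul1r mulr_gt0// expR_gt0.
have mvt a c (ac : a <= c) := mean_value_le ac dG.
have mvtp a c : 0 <= a -> a < c -> c <= 1 -> G a < G c.
  move=> a0 ac c1; have [x /andP[ax xc] E] := mean_value_lt ac dG.
  rewrite -subr_gt0 E mulr_gt0//; last lra.
  apply: gp; lra.
pose c := G 1 - G 0.
have c0 : 0 < c by rewrite subr_gt0; apply: mvtp.
exists (fun x => c^-1 * (G x + (- G 0))); split.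
- apply: smoothM; first exact: smooth_cst.
  by apply: smoothD; [exact: smooth_antiderivative dG|exact: smooth_cst].
- move=> x x0; have [y y0] := mvt x 0 x0; rewrite g0; last lra.
  move=> E; rewrite (_ : G x = G 0) ?subrr ?mulr0//; lra.
- move=> x x1; have [y y0] := mvt 1 x x1; rewrite g1; last lra.
  move=> E; rewrite (_ : G x = G 1) ?mulVf//; [by rewrite gt_eqF|lra].
- move=> x /andP[x0 x1]; rewrite mulrC divr_gt0 ?ltr_pdivrMr ?mul1r//=.
    by rewrite /c; have := mvtp x 1 (ltW x0) x1 (lexx _); lra.
  by rewrite subr_gt0 mvtp// ltW.
Qed.

End bump.

(** * Euclidean geometry and angles modulo 2 pi *)

Section dot_product.
Variables (R : realType) (m : nat).
Implicit Types (x y z : 'rV[R]_m) (a b : R).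

Lemma dotC x y : dot x y = dot y x.
Proof. by apply: eq_bigr => i _; rewrite mulrC. Qed.

Lemma dotDl x y z : dot (x + y) z = dot x z + dot y z.
Proof. by rewrite -big_split; apply: eq_bigr => i _; rewrite mxE mulrDl. Qed.

Lemma dotZl a x y : dot (a *: x) y = a * dot x y.
Proof. by rewrite /dot mulr_sumr; apply: eq_bigr => i _; rewrite mxE mulrA. Qed.

Lemma dotDr x y z : dot z (x + y) = dot z x + dot z y.
Proof. by rewrite dotC dotDl !(dotC z). Qed.

Lemma dotZr a x y : dot x (a *: y) = a * dot x y.
Proof. by rewrite dotC dotZl dotC. Qed.

Lemma dotNl x y : dot (- x) y = - dot x y.
Proof. by rewrite -scaleN1r dotZl mulN1r. Qed.

Lemma dotNr x y : dot x (- y) = - dot x y.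
Proof. by rewrite dotC dotNl dotC. Qed.

Lemma dot_ge0 x : 0 <= dot x x.
Proof. by apply: sumr_ge0 => i _; rewrite -expr2 sqr_ge0. Qed.

Lemma dot_eq0 x : dot x x = 0 -> x = 0.
Proof.
move=> /eqP; rewrite psumr_eq0; last by move=> i _; rewrite -expr2 sqr_ge0.
move=> /allP H; apply/rowP => i; rewrite mxE; apply/eqP.
by have := H i (mem_index_enum i); rewrite -expr2 sqrf_eq0.
Qed.

Lemma enormE x : enorm x ^+ 2 = dot x x.
Proof. by rewrite sqr_sqrtr ?dot_ge0. Qed.

Lemma enorm1P x : enorm x = 1 <-> dot x x = 1.
Proof.
split=> [e|e]; first by rewrite -enormE e expr1n.
by rewrite /enorm e sqrtr1.
Qed.

Lemma enormZ a x : enorm (a *: x) = `|a| * enorm x.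
Proof.
by rewrite /enorm dotZl dotZr mulrA -expr2 sqrtrM ?sqr_ge0// sqrtr_sqr.
Qed.

Lemma unit_dot_le1 x y : dot x x = 1 -> dot y y = 1 -> dot x y <= 1.
Proof.
move=> x1 y1; have := dot_ge0 (x - y).
rewrite dotDl !dotDr !dotNl !dotNr x1 y1 (dotC y x); lra.
Qed.

Lemma unit_dot_eq1 x y : dot x x = 1 -> dot y y = 1 -> dot x y = 1 -> x = y.
Proof.
move=> x1 y1 xy; apply/eqP; rewrite -subr_eq0; apply/eqP/dot_eq0.
rewrite dotDl !dotDr !dotNl !dotNr x1 y1 (dotC y x) xy; lra.
Qed.

Lemma unit_dot_abs_le1 x y : dot x x = 1 -> dot y y = 1 -> `|dot x y| <= 1.
Proof.
move=> x1 y1; rewrite ler_norml unit_dot_le1// andbT lerNl -dotNl.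
by rewrite unit_dot_le1// dotNl dotNr opprK.
Qed.

Definition circ (u w : 'rV[R]_m) (s : R) := cos s *: u + sin s *: w.

Lemma dot_circ u w s s' : dot u u = 1 -> dot w w = 1 -> dot u w = 0 ->
  dot (circ u w s) (circ u w s') = cos (s - s').
Proof.
move=> u1 w1 uw.
by rewrite !dotDl !dotDr !dotZl !dotZr u1 w1 (dotC w) uw cosB; ring.
Qed.

End dot_product.

Section angles.
Variable R : realType.
Implicit Types (x a b c : R).

Lemma cos_half x : cos x = 1 - 2 * sin (x / 2) ^+ 2.
Proof.
rewrite {1}[x]splitr cosD -!expr2 cos2sin2; ring.
Qed.

Lemma cosDint x (n : int) : cos (x + 2 * pi * n%:~R) = cos x.
Proof.
suff H (k : nat) (y : R) : cos (y + 2 * pi * k%:R) = cos y.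
  case: n => k; first exact: H.
  by rewrite NegzE mulrNz mulrN -(H k.+1) subrK.
have -> : 2 * pi * k%:R = (pi *+ 2) *+ k :> R by rewrite mulr_natr mulr_natl.
exact/periodicn/cosD2pi.
Qed.

Lemma sinDint x (n : int) : sin (x + 2 * pi * n%:~R) = sin x.
Proof. by rewrite -!cosBpihalf addrAC cosDint. Qed.

Lemma ex_angle_mod x : exists n : int, 0 <= x - 2 * pi * n%:~R < 2 * pi.
Proof.
have p0 : 0 < 2 * pi :> R by rewrite mulr_gt0// pi_gt0.
exists (Num.floor (x / (2 * pi))).
rewrite subr_ge0 ltrBlDr -ler_pdivlMl// mulrC floor_le_tmp /=.
have := floorD1_gt (x / (2 * pi)).
rewrite ltr_pdivrMr// intrD mulrDl mul1r addrC.
by rewrite [_%:~R * _]mulrC [_^-1 * x]mulrC.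
Qed.

(** Equality of angles modulo 2 pi is expressed throughout as [cos (x - y) = 1], without an integer
    witness. The integer is recovered here from 1 - cos x = 2 sin^2(x/2), after reduction to one
    period. *)
Lemma cos_eq1 x : cos x = 1 -> exists n : int, x = 2 * pi * n%:~R.
Proof.
move=> x1; have [n /andP[y0 y2]] := ex_angle_mod x; exists n.
have := cosDint (x - 2 * pi * n%:~R) n; rewrite subrK x1.
have xE := subrK (2 * pi * n%:~R) x.
move: (x - 2 * pi * n%:~R) y0 y2 xE => y y0 y2 xE /esym.
rewrite cos_half => /eqP; rewrite -subr_eq0 addrAC subrr add0r oppr_eq0.
rewrite mulf_eq0 sqrf_eq0 pnatr_eq0 /= => /eqP s0.
have [y00|/eqP yn0] := eqVneq y 0; first by move: xE; rewrite y00 add0r.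
have : 0 < sin (y / 2).
  by move/eqP in yn0; apply: sin_gt0_pi; have : 0 < y; rewrite ?lt_def ?yn0//; lra.
by rewrite s0 ltxx.
Qed.

End angles.

(** * The circle action and horizontal arcs *)

Section unit_complex_action.
Variables (R : realType) (m : nat) (J : {linear 'rV[R]_m -> 'rV[R]_m}).
Hypothesis JJ : forall x, J (J x) = - x.
Hypothesis dotJJ : forall x y, dot (J x) (J y) = dot x y.
Implicit Types (x y p v : 'rV[R]_m) (a b s : R).

Let JD x y : J (x + y) = J x + J y. Proof. exact: linearD. Qed.

Let JZ a x : J (a *: x) = a *: J x. Proof. exact: linearZ. Qed.

Lemma dotJl x y : dot (J x) y = - dot x (J y).
Proof. by rewrite -[in RHS]dotJJ JJ dotNr opprK. Qed.

Lemma dotJ0 x : dot x (J x) = 0.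
Proof. by have := dotJl x x; rewrite dotC; lra. Qed.

Lemma dot0J x : dot (J x) x = 0.
Proof. by rewrite dotC dotJ0. Qed.

(** Multiplication by the complex number exp(i a), with [J] as multiplication by i; for a fixed unit
    vector [x] this is the great circle that forms the fibre of [x]. *)
Definition rot a x := cos a *: x + sin a *: J x.

Lemma rotE a x : rot a x = circ x (J x) a. Proof. by []. Qed.

Lemma rot0 x : rot 0 x = x.
Proof. by rewrite /rot cos0 sin0 scale1r scale0r addr0. Qed.

Lemma rot_rot a b x : rot a (rot b x) = rot (a + b) x.
Proof.
rewrite /rot JD !JZ JJ !scalerDr !scalerA scalerN cosD sinD.
rewrite !scalerDl scaleNr; apply/rowP => i; rewrite !mxE; ring.
Qed.

Lemma rotD a x y : rot a (x + y) = rot a x + rot a y.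
Proof. by rewrite /rot JD !scalerDr addrACA. Qed.

Lemma rotZ a b x : rot a (b *: x) = b *: rot a x.
Proof. by rewrite /rot JZ scalerDr !scalerA ![b * _]mulrC. Qed.

Lemma dot_rotl a x y : dot (rot a x) y = cos a * dot x y + sin a * dot (J x) y.
Proof. by rewrite dotDl !dotZl. Qed.

Lemma dot_rot a x y : dot (rot a x) (rot a y) = dot x y.
Proof.
rewrite !dotDl !dotDr !dotZl !dotZr dotJJ dotJl.
rewrite -[RHS]mul1r -[1 in RHS](cos2Dsin2 a); ring.
Qed.

Lemma J_rot a x : J (rot a x) = rot a (J x).
Proof. by rewrite /rot JD !JZ. Qed.

Lemma rot_int x (n : int) : rot (2 * pi * n%:~R) x = x.
Proof.
by rewrite /rot -[_ * _%:~R]add0r cosDint sinDint cos0 sin0 scale1r scale0r addr0.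
Qed.

Lemma rot_inj a b x : dot x x = 1 -> rot a x = rot b x -> cos (a - b) = 1.
Proof.
move=> x1 e; have : rot (a - b) x = x.
  by rewrite addrC -rot_rot e rot_rot addNr rot0.
by move=> /(congr1 (fun y => dot y x)); rewrite dot_rotl x1 dot0J; lra.
Qed.

(** [v] is a unit tangent vector at the point [p] of the sphere, orthogonal to the fibre direction
    [J p]. *)
Definition horizontal p v :=
  [/\ dot p p = 1, dot v v = 1, dot p v = 0 & dot (J p) v = 0].

Lemma horizontal_rot a p v : horizontal p v -> horizontal (rot a p) (rot a v).
Proof. by case=> ? ? ? ?; rewrite /horizontal J_rot !dot_rot. Qed.

Lemma rot_circ a p v s : rot a (circ p v s) = circ (rot a p) (rot a v) s.
Proof. by rewrite /circ rotD !rotZ. Qed.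

(** [dot x y] and [dot (J x) y] are, up to sign, the real and the imaginary part of the Hermitian
    product. On a horizontal great circle these products are real, which is why phases can be read
    off from them. *)
Lemma horizontal_dotJ p v s s' : horizontal p v ->
  dot (J (circ p v s)) (circ p v s') = 0.
Proof.
case=> p1 v1 pv Jpv; rewrite /circ JD !JZ !dotDl !dotDr !dotZl !dotZr.
by rewrite Jpv !dot0J dotJl (dotC v) Jpv; ring.
Qed.

Lemma horizontal_dot p v s s' : horizontal p v ->
  dot (circ p v s) (circ p v s') = cos (s - s').
Proof. by case=> ? ? ? _; exact: dot_circ. Qed.

Lemma dot_strip p v a b s s' : horizontal p v ->
  dot (rot a (circ p v s)) (rot b (circ p v s')) = cos (a - b) * cos (s - s').
Proof.
move=> h; rewrite -[LHS](dot_rot (- b)) !rot_rot addNr rot0 addrC dot_rotl.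
by rewrite horizontal_dot// horizontal_dotJ// mulr0 addr0.
Qed.

Lemma dotJ_strip p v a b s s' : horizontal p v ->
  dot (J (rot a (circ p v s))) (rot b (circ p v s')) = - sin (a - b) * cos (s - s').
Proof.
move=> h; rewrite J_rot -[LHS](dot_rot (- b)) !rot_rot addNr rot0 addrC dot_rotl.
by rewrite JJ dotNl horizontal_dot// horizontal_dotJ// mulr0 add0r; ring.
Qed.

(* Two horizontal arcs of length at most pi / 2 meet the same fibres with at
   most one phase difference. *)
Lemma strip_phase p v p' v' a1 a2 s1 s2 s1' s2' :
  horizontal p v -> horizontal p' v' ->
  0 < s1 < pi / 2 -> 0 < s2 < pi / 2 -> 0 < s1' < pi / 2 -> 0 < s2' < pi / 2 ->
  rot a1 (circ p v s1) = circ p' v' s1' -> rot a2 (circ p v s2) = circ p' v' s2' ->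
  cos (a1 - a2) = 1.
Proof.
move=> h h' i1 i2 i1' i2' e1 e2.
have c0 : 0 < cos (s1 - s2) by apply: cos_gt0_pihalf; lra.
have c0' : 0 < cos (s1' - s2') by apply: cos_gt0_pihalf; lra.
have := dotJ_strip a1 a2 s1 s2 h; rewrite e1 e2 horizontal_dotJ// => /esym/eqP.
rewrite mulf_eq0 (gt_eqF c0) orbF oppr_eq0 => /eqP /sin0cos1.
have := dot_strip a1 a2 s1 s2 h; rewrite e1 e2 horizontal_dot// => E.
have : 0 < cos (a1 - a2) by rewrite -(pmulr_lgt0 _ c0) -E.
by move=> ca; rewrite gtr0_norm.
Qed.

(** Equality of the points gives cos(a - a') cos(s - s') = 1. Heights between 0 and pi/2 make the
    second factor nonnegative, which excludes that both factors are -1. *)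
Lemma strip_inj p v a a' s s' : horizontal p v ->
  0 <= s <= pi / 2 -> 0 <= s' <= pi / 2 ->
  rot a (circ p v s) = rot a' (circ p v s') -> s = s' /\ cos (a - a') = 1.
Proof.
move=> h i i' e.
have ss' : cos (a - a') * cos (s - s') = 1.
  rewrite -(dot_strip a a' s s' h) e.
  by rewrite (dot_strip _ _ _ _ h) !subrr cos0 mulr1.
have s0 : cos (s - s') <= 1 by exact: cos_le1.
have a0 : cos (a - a') <= 1 by exact: cos_le1.
have c0 : 0 <= cos (s - s') by apply: cos_ge0_pihalf; lra.
have s1 : cos (s - s') = 1 by apply/eqP; rewrite eq_le s0/=; nra.
split; last by move: ss'; rewrite s1 mulr1.
have [n sn] := cos_eq1 s1.
have := pi_gt0 R => p0.
have n0 : n = 0.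
  have : (n%:~R : R) < 1 by nra.
  have : (-1 : R) < n%:~R by nra.
  rewrite -[-1]/((-1)%:~R) -[1]/(1%:~R) !ltr_int; lia.
by move: sn; rewrite n0 mulr0 => /eqP; rewrite subr_eq0 => /eqP.
Qed.

End unit_complex_action.

(** * Avoiding finitely many arcs of a circle *)

Section avoiding_arcs.
Variable R : realType.
Implicit Types (s : seq (R * R)) (L c r x : R).

Let U s := [set x : R | exists2 k, k \in s & `|x - k.1| <= k.2].

Let Ucons k s : U (k :: s) = `[k.1 - k.2, k.1 + k.2] `|` U s.
Proof.
apply/seteqP; split=> x /=; rewrite in_itv/= -ler_distl.
  by case=> k'; rewrite inE => /predU1P[->|ks]; [left|right; exists k'].
by case=> [|[k' ks]] ?; [exists k|exists k'] => //; rewrite inE ?eqxx ?ks ?orbT.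
Qed.

Let mU s : measurable (U s).
Proof.
elim: s => [|k s IH]; last by rewrite Ucons; exact: measurableU.
by rewrite (_ : U [::] = set0)//; apply/seteqP; split=> x []// k; rewrite inE.
Qed.

Let U_le s : (forall k, k \in s -> 0 <= k.2) ->
  (lebesgue_measure (U s) <= (\sum_(k <- s) 2 * k.2)%:E)%E.
Proof.
elim: s => [_|k s IH r0].
  rewrite (_ : U [::] = set0) ?measure0 ?big_nil//.
  by apply/seteqP; split=> x []// k; rewrite inE.
rewrite Ucons big_cons EFinD (le_trans (measureU2 _ _ _))//; first exact: mU.
apply: leeD; last by apply: IH => k' ks; apply: r0; rewrite inE ks orbT.
have k0 : 0 <= k.2 by apply: r0; rewrite inE eqxx.
apply: (@le_trans _ _ (lebesgue_measure (`[k.1 - k.2, k.1 + k.2] : set R))) => //.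
rewrite lebesgue_measure_itv/= lte_fin; case: ifPn => _.
  by rewrite -EFinB lee_fin; lra.
by rewrite lee_fin; lra.
Qed.

(** By subadditivity of Lebesgue measure, intervals of total length less than [L] cannot cover
    [0, L]. *)
Lemma avoid_intervals s L : (forall k, k \in s -> 0 <= k.2) ->
  0 <= L -> \sum_(k <- s) 2 * k.2 < L ->
  exists2 c, 0 <= c <= L & forall k, k \in s -> k.2 < `|c - k.1|.
Proof.
move=> r0 L0 sL; apply: contrapT => H.
have sub : `[0, L] `<=` U s.
  move=> x; rewrite /= in_itv/= => x0; apply: contrapT => xU; apply: H.
  exists x => // k ks; rewrite ltNge; apply/negP => xk.
  by apply: xU; exists k.
have : (lebesgue_measure (`[0%R, L]%classic : set R) <= lebesgue_measure (U s))%E.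
  by apply: le_measure; rewrite ?inE//; exact: mU.
move=> /le_trans /(_ (U_le r0)); rewrite lebesgue_measure_itv/=.
rewrite lte_fin (le_lt_trans _ sL); last first.
  by rewrite big_seq; apply: sumr_ge0 => k /r0; exact: mulr_ge0.
by rewrite oppr0 adde0 lee_fin leNgt sL.
Qed.

Let p0 : 0 < 2 * pi :> R. Proof. by rewrite mulr_gt0// pi_gt0. Qed.

Let int_ltN1 (N : int) : N < -1 -> N <= -2. Proof. lia. Qed.

Let int_gtS (M : nat) (N : int) : M%:Z < N -> M.+1%:Z <= N. Proof. lia. Qed.

Let int_shift (M : nat) (N : int) : -1 <= N -> N <= M%:Z ->
  exists2 j : nat, j%:Z = (N + 1)%R & j \in iota 0 M.+2.
Proof.
move=> N1 NM; exists (absz (N + 1)); first by rewrite gez0_abs//; lia.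
by rewrite mem_iota; lia.
Qed.

(* Unrolling the circle [M] times, for a large [M], bounds the error that is
   due to the arcs that meet the end points. *)
Lemma avoid_arcs s : (forall k, k \in s -> 0 <= k.2) ->
  \sum_(k <- s) 2 * k.2 < 2 * pi ->
  exists c, forall k x, k \in s -> `|x| <= k.2 -> cos (c - k.1 - x) <> 1.
Proof.
move=> r0 sp; set S := (\sum_(k <- s) _) in sp.
have S0 : 0 <= S by rewrite /S big_seq; apply: sumr_ge0 => k /r0; exact: mulr_ge0.
have rpi k : k \in s -> k.2 < pi.
  move=> ks; have : 2 * k.2 <= S; last by move: sp; lra.
  rewrite /S (big_rem k)//= lerDl big_seq; apply: sumr_ge0 => k' /mem_rem /r0.
  exact: mulr_ge0.
pose md x := x - 2 * pi * (sval (cid (ex_angle_mod x)))%:~R.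
have mdP x : 0 <= md x < 2 * pi by rewrite /md; case: cid.
(* The lifts of an arc that can meet [0, 2 pi M] are numbered from -1 to [M], hence [M + 2] copies;
   since S < 2 pi, a large [M] pays for the two extra ones. *)
have [M SM] : exists M : nat, S * (M%:R + 2) < 2 * pi * M%:R.
  exists (Num.truncn (2 * S / (2 * pi - S))).+1.
  have : 2 * S / (2 * pi - S) < (Num.truncn (2 * S / (2 * pi - S))).+1%:R.
    exact: truncnS_gt.
  by rewrite ltr_pdivrMr ?subr_gt0//; lra.
pose ss := [seq (md k.1 + 2 * pi * j%:R - 2 * pi, k.2) | k <- s, j <- iota 0 M.+2].
have [|||c cL cA] := @avoid_intervals ss (2 * pi * M%:R).
- by move=> k /allpairsP[[k' j] /= [/r0 ? _ ->]].
- by rewrite mulr_ge0// ltW.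
- apply: le_lt_trans SM; rewrite big_allpairs_dep mulr_suml.
  apply: ler_sum => k _; under eq_bigr do rewrite [snd _]/=.
  rewrite big_const_seq count_predT size_iota.
  by rewrite iter_addr addr0 -[X in X <= _]mulr_natr -!natr1; lra.
exists c => k x ks xk /cos_eq1[n cE].
have kE : md k.1 = k.1 - 2 * pi * (sval (cid (ex_angle_mod k.1)))%:~R by [].
move: (sval _) kE (mdP k.1) => q kE kP.
have pp := pi_gt0 R; have kpi := rpi _ ks.
have xb : - pi < x < pi by rewrite -ltr_norml (le_lt_trans xk).
pose N : int := (n + q)%R.
have NE : c = md k.1 + x + 2 * pi * N%:~R by rewrite /N intrD kE; lra.
have N1 : -1 <= N.
  rewrite leNgt; apply/negP => N1.
  have : (N%:~R : R) <= (-2)%:~R by rewrite ler_int int_ltN1.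
  have -> : (-2)%:~R = -2 :> R by [].
  by move: NE; nra.
have NM : N <= M%:Z.
  rewrite leNgt; apply/negP => NM.
  have : ((M.+1%:Z)%:~R : R) <= N%:~R by rewrite ler_int int_gtS.
  have -> : (M.+1%:Z)%:~R = M%:R + 1 :> R by rewrite natr1.
  by move: NE; nra.
have [j jE ji] := int_shift N1 NM.
have := cA (md k.1 + 2 * pi * j%:R - 2 * pi, k.2).
rewrite /= NE ltNge => /(_ _)/negP; apply.
  by apply/allpairsP; exists (k, j).
have -> : N%:~R = j%:R - 1 :> R by rewrite -[j%:R]/((j%:Z)%:~R) jE intrD; ring.
by rewrite (_ : _ - _ = x)//; ring.
Qed.

End avoiding_arcs.

(** * Unit speed U-turns in the plane *)

Section turning_profiles.
Variable R : realType.
Implicit Types (a b d : R) (u w : R -> R).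

(* A unit speed U-turn (u, w) in the plane: it comes from the left along the
   horizontal axis, leaves it at time 0, reaches height [d] at time [b] and
   then goes back to the left. *)
Definition profile a b d u w : Prop :=
  [/\ forall x, x <= 0 -> u x = x /\ w x = 0,
      forall x, b <= x -> u x = b - x /\ w x = d,
      forall x, 0 <= x <= b -> 0 <= u x <= a /\ w x <= x &
      forall x y, 0 <= x -> x < y -> y <= b -> w x < w y].

Definition smooth_profile u w : Prop :=
  [/\ smooth u, smooth w & forall x : R, exists t : R,
    is_derive x 1 u (cos t) /\ is_derive x 1 w (sin t)].

(** The direction angle [f] is prescribed and integrated: it turns from 0 to pi/2 within time r =
    eta / 2, stays there, and turns on to pi symmetrically. Each turn climbs only [h <= r], so the
    height [d] takes the time d + 2 (r - h); this is the origin of [k]. It is chosen before [d], so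
    that all edges of the tree share the same alpha0 + k. *)
Lemma ex_smooth_profile (eta : R) : 0 < eta ->
  exists k, 0 <= k <= eta /\ forall d, eta < d ->
    exists u w, profile eta (d + k) d u w /\ smooth_profile u w.
Proof.
move=> eta0; have [psi [spsi psi0 psi1 psi01]] := ex_smooth_step R.
have psiP x : 0 <= psi x <= 1.
  have [/psi0->|x0] := leP x 0; first by rewrite lexx ler01.
  have [/psi1->|x1] := leP 1 x; first by rewrite lexx ler01.
  by have /andP[/ltW-> /ltW->] := psi01 x ltac:(by rewrite x0 x1).
have psi_gt0 x : 0 < x -> 0 < psi x.
  move=> x0; have [/psi1->//|x1] := leP 1 x.
  by have /andP[] := psi01 x ltac:(by rewrite x0 x1).
pose r := eta / 2; have r0 : 0 < r by rewrite divr_gt0.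
have rE : eta = 2 * r by rewrite /r; lra.
have p0 := pi_gt0 R.
pose f1 x := pi / 2 * psi (r^-1 * x + 0).
have sf1 : smooth f1.
  by apply: smoothM; [exact: smooth_cst|exact: smooth_affine].
have [S1 dS1] := ex_antiderivative (smooth_continuous (smooth_sin sf1)).
have f1E x : r <= x -> f1 x = pi / 2.
  move=> rx; rewrite /f1 addr0 psi1 ?mulr1// mulrC ler_pdivlMr//; lra.
pose h := S1 r - S1 0.
have f1P x : 0 <= f1 x <= pi / 2.
  by rewrite /f1; have := psiP (r^-1 * x + 0); nra.
have hP : 0 <= h <= r.
  rewrite /h; have [c _ ->] := mean_value_le (ltW r0) dS1; have := f1P c; have := sin_le1 (f1 c).
  have : 0 <= sin (f1 c) by apply: sin_ge0_pi; have := f1P c; lra.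
  by rewrite subr0; nra.
exists (2 * (r - h)); split; first by lra.
move=> d; rewrite rE => rd.
pose b := d + 2 * (r - h); have rb : 2 * r < b by rewrite /b; lra.
rewrite -/b.
(* The second quarter turn is the first one reversed in time, so that [f (b - x) = pi - f x]; this
   gives the symmetries [u_sym] and [w_sym]. *)
pose f x := f1 x + pi / 2 * (1 + -1 * psi (- r^-1 * x + r^-1 * b)).
have f2E x : f x = f1 x + (pi / 2 - f1 (b - x)).
  rewrite /f /f1 addr0; congr (_ + _); rewrite mulrDr mulr1 mulN1r mulrN.
  by congr (_ - _ * psi _); ring.
have sf : smooth f.
  have sg : smooth (fun x => psi (- r^-1 * x + r^-1 * b)) by exact: smooth_affine.
  have sg1 := smoothM (@smooth_cst R (-1)) sg.
  have sg2 := smoothD (@smooth_cst R 1) sg1.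
  exact: smoothD sf1 (smoothM (@smooth_cst R (pi / 2)) sg2).
have fE x : x <= b - r -> f x = f1 x.
  by move=> xb; rewrite f2E (f1E (b - x)) ?subrr ?addr0//; lra.
have f_sym x : f (b - x) = pi - f x by rewrite !f2E subKr; lra.
have f_mid x : r <= x -> x <= b - r -> f x = pi / 2.
  by move=> rx xb; rewrite fE// f1E.
have f0 x : x <= 0 -> f x = 0.
  move=> x0; rewrite fE; last by lra.
  by rewrite /f1 addr0 psi0 ?mulr0// pmulr_rle0// invr_gt0.
have fb x : b <= x -> f x = pi.
  by move=> xb; rewrite -[x](subKr b) f_sym f0 ?subr0//; lra.
have f_gt0 x : 0 < x -> 0 < f x.
  move=> x0; rewrite f2E; have := f1P (b - x).
  suff : 0 < f1 x by lra.
  by rewrite /f1 mulr_gt0 ?divr_gt0// addr0 psi_gt0// mulr_gt0// invr_gt0.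
have f_ltpi x : x < b -> f x < pi.
  by move=> xb; have := f_gt0 (b - x); rewrite f_sym subr_gt0 => /(_ xb); lra.
have [u0 du0] := ex_antiderivative (smooth_continuous (smooth_cos sf)).
have [w0 dw0] := ex_antiderivative (smooth_continuous (smooth_sin sf)).
pose u x := u0 x + (- u0 0); pose w x := w0 x + (- w0 0).
have du (x : R) : is_derive x 1 u (cos (f x)).
  by rewrite -[cos _]addr0; apply: is_deriveD.
have dw (x : R) : is_derive x 1 w (sin (f x)).
  by rewrite -[sin _]addr0; apply: is_deriveD.
have u00 : u 0 = 0 by rewrite /u subrr.
have w00 : w 0 = 0 by rewrite /w subrr.
have dbx (g : R -> R) (dg : R -> R) : (forall x : R, is_derive x 1 g (dg x)) ->
    forall x : R, is_derive x 1 (fun y => g (b - y)) (- dg (b - x)).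
  move=> H x; rewrite (_ : (fun y => _) = g \o (fun y => b - y))// -mulrN1.
  apply: is_derive1_comp; rewrite -[-1]add0r.
  exact: is_deriveB.
have u_sym x : u (b - x) = u x.
  have H y z := eq_derive_const du (G := fun y => u (b - y)) _ y z.
  have {}H y z : u z - u y = u (b - z) - u (b - y).
    apply: H => {}x; have := dbx _ _ du x.
    by rewrite f_sym cosB cospi sinpi mul0r mulN1r addr0 opprK.
  have := H 0 b; have := H 0 x; rewrite !subrr !subr0 u00; lra.
have w_sym x : w b - w (b - x) = w x.
  have H y z := eq_derive_const dw (G := fun y => - w (b - y)) _ y z.
  have {}H y z : w z - w y = - w (b - z) - - w (b - y).
    apply: H => {}x; rewrite -[sin _]opprK; apply: is_deriveN.
    have := dbx _ _ dw x.
    by rewrite f_sym sinB cospi sinpi mul0r mulN1r add0r opprK.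
  have := H 0 x; rewrite !subr0 w00; lra.
have wr : w r = h.
  have dwS (x : R) : is_derive x 1 (w - S1) (sin (f x) - sin (f1 x)).
    exact: is_deriveB.
  have [x /andP[x0 xr]] := mean_value_le (ltW r0) dwS.
  by rewrite fE ?subrr ?mul0r ?fctE ?w00 /h; lra.
have wbr : w (b - r) - w r = b - 2 * r.
  have [|x /andP[x0 xr] ->] := @mean_value_le _ _ _ r (b - r) _ dw; first lra.
  by rewrite f_mid// sin_pihalf; ring.
have wb : w b = d by have := w_sym r; rewrite /b in wbr *; lra.
have incr x y : 0 <= x -> x < y -> y <= b -> w x < w y.
  move=> x0 xy yb; rewrite -subr_gt0.
  have [c /andP[xc cy] ->] := mean_value_lt xy dw.
  rewrite mulr_gt0 ?subr_gt0// sin_gt0_pi// f_gt0 ?f_ltpi//; lra.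
have u_half x : 0 <= x -> x <= b - r -> 0 <= u x <= eta.
  move=> x0 xb.
  have [c /andP[c0 cx]] := mean_value_le x0 du; rewrite u00 !subr0 => ux.
  have cc : 0 <= cos (f c).
    by apply: cos_ge0_pihalf; rewrite fE; have := f1P c; lra.
  have [xr|xr] := leP x r.
    by have := cos_le1 (f c); rewrite ux; nra.
  have [c' /andP[c'0 c'x]] := mean_value_le (ltW xr) du.
  rewrite f_mid ?cos_pihalf; [|lra..] => uxr.
  have [c2 /andP[c20 c2x]] := mean_value_le (ltW r0) du; rewrite u00 !subr0 => ur.
  have := cos_le1 (f c2); rewrite ux => ?; apply/andP; split; nra.
exists u, w; split; last split.
- split.
  + move=> x x0.
    have [c /andP[_ c0]] := mean_value_le x0 du.
    have [c' /andP[_ c'0]] := mean_value_le x0 dw.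
    by rewrite !f0// cos0 sin0 u00 w00; split; lra.
  + move=> x bx; have ub : u b = 0 by rewrite -u_sym subrr.
    have [c /andP[c0 _]] := mean_value_le bx du.
    have [c' /andP[c'0 _]] := mean_value_le bx dw.
    by rewrite !fb// cospi sinpi ub wb; split; lra.
  + move=> x /andP[x0 xb]; split.
      have [xr|xr] := leP x (b - r); first by rewrite -rE; apply: u_half.
      rewrite -rE -u_sym; apply: u_half; lra.
    have [c _] := mean_value_le x0 dw; have := sin_le1 (f c).
    by rewrite w00 !subr0; nra.
  + by [].
- exact: smooth_antiderivative (smooth_cos sf) du.
- exact: smooth_antiderivative (smooth_sin sf) dw.
- by move=> x; exists (f x).
Qed.

End turning_profiles.

(** * Integrals as increments of antiderivatives *)

Section integrals.
Variable R : realType.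
Implicit Types (f g : R -> R) (a b c M : R).

(* The integral of a continuous function; junk if [f] is not continuous. *)
Definition oint f a b : R :=
  let F := xget f [set F | forall x : R, is_derive x 1 F (f x)] in F b - F a.

Lemma ointE f F a b : (forall x : R, is_derive x 1 F (f x)) ->
  oint f a b = F b - F a.
Proof.
move=> dF; rewrite /oint; case: xgetP => [G _ /= dG|/(_ F)//].
exact: eq_derive_const dG dF a b.
Qed.

(** All three terms are increments of one chosen function, so the end points may come in any order
    and no integrability has to be checked. *)
Lemma oint_add f a b c : oint f a b + oint f b c = oint f a c.
Proof. rewrite /oint; lra. Qed.

Lemma oint_subst f g a b (s : bool) c : a <= b -> continuous f -> continuous g ->
  (forall x, a <= x <= b -> f x = g ((-1) ^+ s * x + c)) ->
  oint f a b = (-1) ^+ s * oint g ((-1) ^+ s * a + c) ((-1) ^+ s * b + c).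
Proof.
move=> ab /ex_antiderivative[F dF] /ex_antiderivative[G dG] fg.
rewrite (ointE _ _ dF) (ointE _ _ dG).
have dGs (x : R) : is_derive x 1 (fun x => (-1) ^+ s * G ((-1) ^+ s * x + c))
    (g ((-1) ^+ s * x + c)).
  have d1 : is_derive x 1 (fun x : R => (-1) ^+ s * x + c) ((-1) ^+ s).
    rewrite -[X in is_derive _ _ _ X]addr0; apply: is_deriveD.
    by rewrite -[X in is_derive _ _ _ X]mulr1; exact: (@is_deriveZ _ _ _ id).
  have d2 : is_derive x 1 (G \o (fun x : R => (-1) ^+ s * x + c))
      (g ((-1) ^+ s * x + c) * (-1) ^+ s) by exact: is_derive1_comp.
  have := @is_deriveZ _ _ _ _ ((-1) ^+ s : R) _ _ _ d2.
  by rewrite /GRing.scale/= mulrCA -expr2 sqrr_sign mulr1.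
have [x xab] := mean_value_le ab (fun x => is_deriveB (dF x) (dGs x)).
rewrite fg// subrr mul0r !fctE => H; lra.
Qed.

Lemma oint_shift f g a b c : a <= b -> continuous f -> continuous g ->
  (forall x, a <= x <= b -> f x = g (x + c)) ->
  oint f a b = oint g (a + c) (b + c).
Proof.
move=> ab cf cg fg; rewrite (@oint_subst f g a b false c)//= ?expr0 ?mul1r//.
by move=> x /fg ->; rewrite mul1r.
Qed.

Lemma oint_refl f g a b c : a <= b -> continuous f -> continuous g ->
  (forall x, a <= x <= b -> f x = g (c - x)) ->
  oint f a b = oint g (c - b) (c - a).
Proof.
move=> ab cf cg fg; rewrite (@oint_subst f g a b true c)//=; last first.
  by move=> x /fg ->; rewrite expr1 mulN1r addrC.
by rewrite expr1 !mulN1r /oint !(addrC c); ring.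
Qed.

Lemma eq_oint f g a b : a <= b -> continuous f -> continuous g ->
  (forall x, a <= x <= b -> f x = g x) -> oint f a b = oint g a b.
Proof.
move=> ab cf cg fg; rewrite (@oint_shift f g a b 0) ?addr0// => x /fg.
by rewrite addr0.
Qed.

Lemma ointB f g a b : continuous f -> continuous g ->
  oint f a b - oint g a b = oint (fun x => f x - g x) a b.
Proof.
move=> /ex_antiderivative[F dF] /ex_antiderivative[G dG].
rewrite (ointE _ _ dF) (ointE _ _ dG) (ointE _ _ (fun x => is_deriveB (dF x) (dG x))).
by rewrite !fctE; ring.
Qed.

Lemma oint_bound f a b M : a <= b -> continuous f ->
  (forall x, a <= x <= b -> `|f x| <= M) -> `|oint f a b| <= (b - a) * M.
Proof.
move=> ab /ex_antiderivative[F dF] fM; rewrite (ointE _ _ dF).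
have [c /fM cM ->] := mean_value_le ab dF.
by rewrite normrM mulrC [X in X * _]ger0_norm ?subr_ge0// ler_wpM2l// subr_ge0.
Qed.

Lemma oint_Rintegral f a b : a < b -> continuous f ->
  \int[lebesgue_measure]_(x in `[a, b]) f x = oint f a b.
Proof.
move=> ab cf; have [F dF] := ex_antiderivative cf.
rewrite (ointE _ _ dF) /Rintegral (@continuous_FTC2 _ f F)//.
- exact: continuous_subspaceT.
- split.
  + by move=> x _; case: (dF x).
  + by apply: cvg_at_right_filter; exact: is_derive1_continuous.
  + by apply: cvg_at_left_filter; exact: is_derive1_continuous.
- by move=> x _; rewrite derive1E; case: (dF x).
Qed.

End integrals.

(** * Unit speed curves on the sphere, smooth or piecewise geodesic *)

Section regular_curves.
Variables (R : realType) (d : nat).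
Local Notation V := 'rV[R]_d.+1.
Implicit Types (g h G : R -> V) (s : bool).

Definition orthonormal (u w : V) := [/\ dot u u = 1, dot w w = 1 & dot u w = 0].

Definition unit_smooth g : Prop :=
  (forall i, smooth (fun x => g x 0 i)) /\
  forall x, dot (g x) (g x) = 1 /\ enorm (derive1 g x) = 1.

Definition great_circle g : Prop :=
  exists u w, orthonormal u w /\ g = circ u w.

Lemma smooth_circ (u w : V) (f : R -> R) i :
  smooth f -> smooth (fun x => circ u w (f x) 0 i).
Proof.
move=> sf; rewrite /circ; under eq_fun do rewrite !mxE.
apply: smoothD; (apply: smoothM; last exact: smooth_cst).
  exact: smooth_cos.
exact: smooth_sin.
Qed.

Lemma smooth_row_derivable g (x : R) :
  (forall i, smooth (fun x => g x 0 i)) -> derivable g x 1.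
Proof. by move=> /smooth_row /(_ 0%N x). Qed.

Lemma unit_smooth_derivable g (x : R) : unit_smooth g -> derivable g x 1.
Proof. by case=> sg _; exact: smooth_row_derivable. Qed.

Lemma is_derive_row g (x : R) (dg : V) : derivable g x 1 ->
  (forall i, is_derive x 1 (fun x => g x 0 i) (dg 0 i)) -> derive1 g x = dg.
Proof.
move=> d1 H; apply/rowP => i; rewrite derive_row// derive1E.
by case: (H i).
Qed.

Lemma circ_unit_smooth u w : orthonormal u w -> unit_smooth (circ u w).
Proof.
case=> u1 w1 uw; split=> [i|x]; first by apply: smooth_circ; exact: smooth_id.
rewrite dot_circ// subrr cos0; split => //.
have -> : derive1 (circ u w) x = circ w (- u) x.
  apply: is_derive_row => [|i].
    by apply: smooth_row_derivable => i; apply: smooth_circ; exact: smooth_id.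
  rewrite /circ !mxE; under eq_fun do rewrite !mxE.
  have d1 := @is_deriveM _ _ _ _ _ _ _ _ (is_derive_cos x) (is_derive_cst (u 0 i) x 1).
  have d2 := @is_deriveM _ _ _ _ _ _ _ _ (is_derive_sin x) (is_derive_cst (w 0 i) x 1).
  apply: (is_derive_eq (is_deriveD d1 d2)).
  by rewrite !scaler0 !add0r /GRing.scale/=; ring.
apply/enorm1P; rewrite dot_circ ?subrr ?cos0// ?dotNl ?dotNr ?opprK//.
by rewrite dotC uw oppr0.
Qed.

Definition nice s g := if s then unit_smooth g else great_circle g.

Lemma nice_unit_smooth s g : nice s g -> unit_smooth g.
Proof.
by case: s => //= -[u [w [uw ->]]]; exact: circ_unit_smooth.
Qed.

Lemma nice_circ s u w : orthonormal u w -> nice s (circ u w).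
Proof.
move=> uw; case: s; first exact: circ_unit_smooth.
by exists u, w.
Qed.

Lemma derive1_affine g (k c x : R) : (forall y, derivable g y 1) ->
  derive1 (fun x => g (k * x + c)) x = k *: derive1 g (k * x + c).
Proof.
move=> dg.
have di i : is_derive x 1 (fun x => g (k * x + c) 0 i)
    ((k *: derive1 g (k * x + c)) 0 i).
  rewrite mxE derive_row// mulrC.
  have d1 : is_derive x 1 (fun x : R => k * x + c) k.
    rewrite -[X in is_derive _ _ _ X]addr0; apply: is_deriveD.
    by rewrite -[X in is_derive _ _ _ X]mulr1; exact: (@is_deriveZ _ _ _ id).
  rewrite (_ : (fun x => _) = (fun x => g x 0 i) \o (fun x : R => k * x + c))//.
  apply: is_derive1_comp; rewrite derive1E; apply: DeriveDef => //.
  exact: (derivable_mxP _ _ _).1.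
apply: is_derive_row => //.
by apply/derivable_mxP => i j; rewrite ord1; case: (di j).
Qed.

Lemma circ_shift (u w : V) x c : circ u w (x + c) = circ (circ u w c) (circ w (- u) c) x.
Proof.
rewrite /circ cosD sinD; apply/rowP => i; rewrite !mxE; ring.
Qed.

Lemma circN (u w : V) x : circ u w (- x) = circ u (- w) x.
Proof. by rewrite /circ cosN sinN scaleNr scalerN. Qed.

Lemma orthonormal_circ (u w : V) c :
  orthonormal u w -> orthonormal (circ u w c) (circ w (- u) c).
Proof.
case=> u1 w1 uw; rewrite /orthonormal /circ !dotDl !dotDr !dotZl !dotZr.
rewrite !dotNl !dotNr (dotC w) u1 w1 uw.
by have := cos2Dsin2 c => e; split; rewrite -?[RHS]e; ring.
Qed.

Lemma orthonormalN (u w : V) : orthonormal u w -> orthonormal u (- w).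
Proof. by case=> *; rewrite /orthonormal !dotNl !dotNr opprK; split => //; lra. Qed.

Lemma nice_affine s g (e : bool) (c : R) :
  nice s g -> nice s (fun x => g ((-1) ^+ e * x + c)).
Proof.
case: s => /= [[sg g1]|[u [w [uw ->]]]].
  split=> [i|x]; first exact: (@smooth_affine _ _ _ _ (sg i)).
  split; first exact: (g1 _).1.
  rewrite derive1_affine; last by move=> y; exact: unit_smooth_derivable.
  by rewrite enormZ (g1 _).2 normrX normrN normr1 expr1n mul1r.
case: e; rewrite ?expr1 ?expr0.
  exists (circ u w c), (- circ w (- u) c); split.
    exact/orthonormalN/orthonormal_circ.
  by apply/funext => x; rewrite circ_shift mulN1r circN.
exists (circ u w c), (circ w (- u) c); split; first exact: orthonormal_circ.
by apply/funext => x; rewrite circ_shift mul1r.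
Qed.

(* Curves that are locally, on each side of each point, arcs of nice curves;
   for [s = true] this is smoothness, for [s = false] it gives broken
   geodesics. *)
Definition regular s G : Prop := forall t : R, exists h h' (e : R),
  [/\ 0 < e, nice s h, nice s h', forall x, t - e <= x <= t -> G x = h x &
      forall x, t <= x <= t + e -> G x = h' x] /\ (s -> h = h').

Lemma regular_nice s g : nice s g -> regular s g.
Proof. by move=> ng t; exists g, g, 1; split. Qed.

Lemma regular_local s G : (forall t : R, exists g (e : R),
  [/\ 0 < e, regular s g & forall x, t - e <= x <= t + e -> G x = g x]) ->
  regular s G.
Proof.
move=> H t; have [g [e [e0 /(_ t)[h [h' [e' [[e'0 nh nh' gh gh'] hh']]]] Gg]]] := H t.
exists h, h', (Order.min e e'); split => //.
have m1 : Order.min e e' <= e by rewrite ge_min lexx.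
have m2 : Order.min e e' <= e' by rewrite ge_min lexx orbT.
split => //; first by rewrite lt_min e0.
  by move=> x xt; rewrite Gg ?gh//; lra.
by move=> x xt; rewrite Gg ?gh'//; lra.
Qed.

Lemma regular_shift s G c : regular s G -> regular s (fun x => G (x + c)).
Proof.
move=> rG t; have [h [h' [e [[e0 nh nh' Gh Gh'] hh']]]] := rG (t + c).
have sh k : nice s k -> nice s (fun x => k (x + c)).
  by move=> /(nice_affine false c) /=; under eq_fun do rewrite expr0 mul1r.
exists (fun x => h (x + c)), (fun x => h' (x + c)), e; split; last by move=> /hh' ->.
split; [by []|exact: sh|exact: sh|move=> x xt; apply: Gh; lra|].
by move=> x xt; apply: Gh'; lra.
Qed.

Lemma regular_reverse s G c : regular s G -> regular s (fun x => G (c - x)).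
Proof.
move=> rG t; have [h [h' [e [[e0 nh nh' Gh Gh'] hh']]]] := rG (c - t).
have sh k : nice s k -> nice s (fun x => k (c - x)).
  by move=> /(nice_affine true c) /=; under eq_fun do rewrite expr1 mulN1r addrC.
exists (fun x => h' (c - x)), (fun x => h (c - x)), e; split; last by move=> /hh' ->.
split; [by []|exact: sh|exact: sh|move=> x xt; apply: Gh'; lra|].
by move=> x xt; apply: Gh; lra.
Qed.

Definition glue G1 G2 (c x : R) : V := if x <= c then G1 x else G2 x.

(** Agreement on a whole neighbourhood of [c] lets the glued curve inherit both one-sided arcs of
    [G1] at [c], so no derivatives have to be matched. *)
Lemma regular_glue s G1 G2 c e : 0 < e -> regular s G1 -> regular s G2 ->
  (forall x, c - e <= x <= c + e -> G1 x = G2 x) -> regular s (glue G1 G2 c).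
Proof.
move=> e0 r1 r2 E; apply: regular_local => t; rewrite /glue.
have [tc|ct|->] := ltgtP t c.
- exists G1, ((c - t) / 2); split => //; first lra.
  by move=> x xt; rewrite ifT//; lra.
- exists G2, ((t - c) / 2); split => //; first lra.
  by move=> x xt; rewrite ifF//; apply/negbTE; rewrite -ltNge; lra.
- by exists G1, e; split => // x xt; case: ifP => // _; rewrite E.
Qed.

Lemma regular_unit s G x : regular s G -> dot (G x) (G x) = 1.
Proof.
move=> /(_ x)[h [h' [e [[e0 /nice_unit_smooth[_ h1] _ Gh _] _]]]].
by rewrite Gh; [exact: (h1 _).1|lra].
Qed.

Lemma regular_continuous s G : regular s G -> continuous G.
Proof.
move=> /[swap] t /(_ t)[h [h' [e [[e0 nh nh' Gh Gh'] _]]]].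
have ch k : nice s k -> {for t, continuous k}.
  move=> /nice_unit_smooth nk; apply: derivable_continuous.
  exact: unit_smooth_derivable.
have tt : G t = h t by apply: Gh; lra.
have tt' : G t = h' t by apply: Gh'; lra.
apply/cvgrPdist_lt => /= r r0.
near=> x.
have xe : `|t - x| < e by near: x; apply: cvgr_dist_lt.
have [xt|/ltW tx] := leP x t.
  rewrite (Gh x) ?tt; last by move: xe; rewrite ltr_norml; lra.
  by near: x; move/cvgrPdist_lt: (ch _ nh); apply.
rewrite (Gh' x) ?tt'; last by move: xe; rewrite ltr_norml; lra.
by near: x; move/cvgrPdist_lt: (ch _ nh'); apply.
Unshelve. all: by end_near. Qed.

End regular_curves.

(** * Excursions along a strip *)

Section excursions.
Variables (R : realType) (d : nat).
Local Notation V := 'rV[R]_d.+1.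
Variable J : {linear V -> V}.
Hypothesis JJ : forall x, J (J x) = - x.
Hypothesis dotJJ : forall x y, dot (J x) (J y) = dot x y.
Implicit Types (p v : V) (u w : R -> R) (s e : bool).

Let JD x y : J (x + y) = J x + J y. Proof. exact: linearD. Qed.

Let JZ (a : R) x : J (a *: x) = a *: J x. Proof. exact: linearZ. Qed.

Definition strip p v (t x : R) : V := rot J t (circ p v x).

Lemma stripE p v t x : strip p v t x =
  (cos t * cos x) *: p + (cos t * sin x) *: v +
  (sin t * cos x) *: J p + (sin t * sin x) *: J v.
Proof.
rewrite /strip /rot /circ JD !JZ !scalerDr !scalerA.
by rewrite !addrA.
Qed.

Lemma horizontal_orthonormal p v : horizontal J p v -> orthonormal p v.
Proof. by case. Qed.

Lemma orthonormal_J p : dot p p = 1 -> orthonormal p (J p).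
Proof. by move=> p1; split=> //; rewrite ?dotJJ// dotJ0. Qed.

(** Differentiation in the phase is multiplication by [J]; differentiation in the height is a shift
    by a quarter period, because it turns cos, sin into cos, sin at x + pi/2. *)
Lemma is_derive_strip p v (f g df dg : R -> R) (x : R) i :
  is_derive x 1 f (df x) -> is_derive x 1 g (dg x) ->
  is_derive x 1 (fun x => strip p v (f x) (g x) 0 i)
   ((df x *: J (strip p v (f x) (g x)) + dg x *: strip p v (f x) (g x + pi / 2)) 0 i).
Proof.
move=> dfx dgx.
have cc (h dh : R -> R) : is_derive x 1 h (dh x) ->
    is_derive x 1 (cos \o h) (- sin (h x) * dh x).
  by move=> ?; exact: is_derive1_comp.
have ss (h dh : R -> R) : is_derive x 1 h (dh x) ->
    is_derive x 1 (sin \o h) (cos (h x) * dh x).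
  by move=> ?; exact: is_derive1_comp.
have Z (h : R -> R) (a k : R) : is_derive x 1 h a -> is_derive x 1 (fun x => h x * k) (a * k).
  move=> dh; apply: (is_derive_eq (is_deriveM dh (is_derive_cst k x 1))).
  by rewrite scaler0 add0r /GRing.scale/= mulrC.
have M (h1 h2 : R -> R) (a b : R) : is_derive x 1 h1 a -> is_derive x 1 h2 b ->
    is_derive x 1 (h1 * h2) (h1 x * b + h2 x * a).
  by move=> d1 d2; exact: is_deriveM.
under eq_fun do rewrite stripE !mxE.
have d1 := Z _ _ (p 0 i) (M _ _ _ _ (cc _ _ dfx) (cc _ _ dgx)).
have d2 := Z _ _ (v 0 i) (M _ _ _ _ (cc _ _ dfx) (ss _ _ dgx)).
have d3 := Z _ _ (J p 0 i) (M _ _ _ _ (ss _ _ dfx) (cc _ _ dgx)).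
have d4 := Z _ _ (J v 0 i) (M _ _ _ _ (ss _ _ dfx) (ss _ _ dgx)).
apply: (is_derive_eq (is_deriveD (is_deriveD (is_deriveD d1 d2) d3) d4)).
rewrite !stripE !JD !JZ !JJ cosDpihalf sinDpihalf !mxE /=; ring.
Qed.

(** At a point z of the strip, [J z] and the point a quarter period further are orthonormal, the
    second being horizontal; a unit speed profile therefore becomes a unit speed curve. *)
Lemma strip_unit_smooth p v u w (e : bool) (c : R) : horizontal J p v ->
  smooth_profile u w ->
  unit_smooth (fun x => strip p v ((-1) ^+ e * (u x - c)) (w x)).
Proof.
move=> pv [su sw duw].
have sc i : smooth (fun x => strip p v ((-1) ^+ e * (u x - c)) (w x) 0 i).
  have sm (a b : R -> R) k : smooth a -> smooth b -> smooth (fun x => a x * b x * k).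
    by move=> sa sb; apply: smoothM; [exact: smoothM|exact: smooth_cst].
  have sf : smooth (fun x => (-1) ^+ e * (u x - c)).
    by apply: smoothM; [exact: smooth_cst|apply: smoothD; [|exact: smooth_cst]].
  under eq_fun do rewrite stripE !mxE.
  by apply: smoothD; [apply: smoothD; [apply: smoothD|]|]; apply: sm;
    [exact: smooth_cos|exact: smooth_cos|exact: smooth_cos|exact: smooth_sin
    |exact: smooth_sin|exact: smooth_cos|exact: smooth_sin|exact: smooth_sin].
split=> // x; split; first by rewrite dot_rot// (horizontal_dot _ _ pv) subrr cos0.
have [t [du dw]] := duw x.
pose f x := (-1) ^+ e * (u x - c).
have df : is_derive x 1 f ((-1) ^+ e * cos t).
  apply: (is_derive_eq (@is_deriveZ _ _ _ _ ((-1) ^+ e : R) _ _ _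
    (is_deriveB du (is_derive_cst c x 1)))).
  by rewrite subr0.
have -> : derive1 (fun x => strip p v (f x) (w x)) x =
   ((-1) ^+ e * cos t) *: J (strip p v (f x) (w x)) +
     sin t *: strip p v (f x) (w x + pi / 2).
  apply: is_derive_row => [|i]; first exact: smooth_row_derivable.
  exact: (is_derive_strip p v i (df := fun=> (-1) ^+ e * cos t) (dg := fun=> sin t)).
apply/enorm1P; rewrite dotDl !dotDr !dotZl !dotZr dotJJ /strip.
rewrite (dotC (rot J (f x) (circ p v (w x + pi / 2)))) J_rot// !dot_rot//.
rewrite (horizontal_dotJ JJ dotJJ _ _ pv) !(horizontal_dot _ _ pv) !subrr cos0.
by rewrite !mulr0 !mulr1 addr0 add0r mulrACA -!expr2 sqrr_sign mul1r cos2Dsin2.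
Qed.

(** The sign [e] is quantified because one profile serves for both crossings of the strip, which are
    mirror images. *)
Definition regular_profile s u w : Prop := forall p v e c, horizontal J p v ->
  regular s (fun x => strip p v ((-1) ^+ e * (u x - c)) (w x)).

Lemma regular_smooth_profile u w : smooth_profile u w -> regular_profile true u w.
Proof. by move=> uw p v e c pv; apply: regular_nice; exact: strip_unit_smooth. Qed.

Lemma horizontal_end p v x : horizontal J p v ->
  dot (circ p v x) (circ p v x) = 1.
Proof. by move=> h; rewrite (horizontal_dot _ _ h) subrr cos0. Qed.

(** The right-angled turn: along the first fibre, up the horizontal arc, back along the second
    fibre. The crossing has width 0 and gains no length, so [a = k = 0]. *)
Lemma ex_geodesic_profile (l : R) : 0 < l ->
  exists u w, profile 0 l l u w /\ regular_profile false u w.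
Proof.
move=> l0.
pose u (x : R) := if x <= 0 then x else if x <= l then 0 else l - x.
pose w (x : R) := if x <= 0 then 0 else if x <= l then x else l.
exists u, w; split.
  split.
  - by move=> x x0; rewrite /u /w x0.
  - move=> x; rewrite /u /w le_eqVlt => /predU1P[<-|lx].
      by rewrite lexx subrr leNgt l0.
    by rewrite !leNgt lx (lt_trans l0 lx).
  - move=> x /andP[x0 xl]; rewrite /u /w xl; case: ifPn => [xx|_]; last by rewrite lexx.
    by rewrite x0 xx.
  - move=> x y x0 xy yl; rewrite /w yl (le_trans (ltW xy) yl).
    rewrite [y <= 0]leNgt (le_lt_trans x0 xy)/=; case: ifPn => [xx|//].
    by rewrite (le_lt_trans x0 xy).
move=> p v e c pv.
pose A x := strip p v ((-1) ^+ e * (x - c)) 0.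
pose B x := strip p v ((-1) ^+ e * (0 - c)) x.
pose C x := strip p v ((-1) ^+ e * (l - x - c)) l.
have nrot q e' c' : dot q q = 1 -> nice false (fun x => rot J ((-1) ^+ e' * x + c') q).
  by move=> q1; apply: (nice_affine e' c' (nice_circ false (orthonormal_J q1))).
have nA : nice false A.
  rewrite (_ : A = (fun x => rot J ((-1) ^+ e * x + (-1) ^+ e * - c) (circ p v 0))).
    exact/nrot/horizontal_end.
  by apply/funext => x; rewrite /A /strip mulrDr.
have nC : nice false C.
  rewrite (_ : C = (fun x => rot J ((-1) ^+ (~~ e) * x + (-1) ^+ e * (l - c)) (circ p v l))).
    exact/nrot/horizontal_end.
  apply/funext => x; rewrite /C /strip; congr (rot _ _ _).
  by case: (e); rewrite ?expr0 ?expr1; ring.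
have nB : nice false B.
  rewrite (_ : B = circ (rot J ((-1) ^+ e * (0 - c)) p)
      (rot J ((-1) ^+ e * (0 - c)) v)).
    exact/nice_circ/horizontal_orthonormal/horizontal_rot.
  by apply/funext => x; rewrite /B /strip rot_circ.
set F := (fun x => _).
have FA x : x <= 0 -> F x = A x by move=> x0; rewrite /F /u /w x0.
have FB x : 0 <= x <= l -> F x = B x.
  move=> /andP[x0 xl]; rewrite /F /u /w xl; case: ifPn => // xx.
  by have -> : x = 0 by apply/eqP; rewrite eq_le xx.
have FC x : l <= x -> F x = C x.
  move=> lx; rewrite /F /u /w [x <= 0]leNgt (lt_le_trans l0 lx)/=.
  case: ifPn => [xl|//]; have -> : x = l by apply/eqP; rewrite eq_le xl.
  by rewrite /C subrr.
move=> t; have [t0|t0|->] := ltgtP t 0.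
- exists A, A, (- t); split=> //; split => //; first lra.
    by move=> x xt; apply: FA; lra.
  by move=> x xt; apply: FA; lra.
- have [tl|lt|->] := ltgtP t l.
  + exists B, B, (Order.min t (l - t)); split=> //.
    have m1 : Order.min t (l - t) <= t by rewrite ge_min lexx.
    have m2 : Order.min t (l - t) <= l - t by rewrite ge_min lexx orbT.
    split => //; first by rewrite lt_min t0 subr_gt0.
      by move=> x xt; apply: FB; lra.
    by move=> x xt; apply: FB; lra.
  + exists C, C, (t - l); split=> //; split => //; first lra.
      by move=> x xt; apply: FC; lra.
    by move=> x xt; apply: FC; lra.
  + exists B, C, l; split=> //; split => //.
      by move=> x xt; apply: FB; lra.
    by move=> x xt; apply: FC; lra.
- exists A, B, l; split=> //; split => //.
    by move=> x xt; apply: FA; lra.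
  by move=> x xt; apply: FB; lra.
Qed.

End excursions.

Lemma cos_neq1 (R : realType) (x : R) : 0 < `|x| < 2 * pi -> cos x <> 1.
Proof.
move=> x0 /cos_eq1[n xE].
have p0 := pi_gt0 R.
have [n0|n0] := eqVneq n 0; first by move: x0; rewrite xE n0 mulr0 normr0 ltxx.
have : 1 <= `|n%:~R : R| by rewrite -intr_norm (ler_int _ 1) -gtz0_ge1 normr_gt0.
have p20 : 0 < 2 * pi :> R by rewrite mulr_gt0.
move=> n1; move: x0 => /andP[_]; rewrite xE normrM (gtr0_norm p20).
by rewrite -[X in _ < X]mulr1 ltr_pM2l// ltNge n1.
Qed.

Section excursion_curve.
Variables (R : realType) (d : nat).
Local Notation V := 'rV[R]_d.+1.
Variable J : {linear V -> V}.
Hypothesis JJ : forall x, J (J x) = - x.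
Hypothesis dotJJ : forall x y, dot (J x) (J y) = dot x y.
Variables (s : bool) (alpha0 k a r : R).
Hypotheses (alpha0_gt0 : 0 < alpha0) (k_ge0 : 0 <= k) (a_ge0 : 0 <= a).
Let alpha := alpha0 + k.
Hypotheses (alpha_lt : alpha < 2 * pi) (a_lt : 2 * a < alpha).
Hypotheses (r_gt0 : 0 < r) (a_le : a <= r) (k_le : 4 * k <= r) (r_le : r <= alpha).

(** The comparison near a corner passes along three great-circle arcs of length at most [r]; a
    variation of M / 3 on each adds up to M. *)
Definition tame (F : V -> R) (M : R) : Prop :=
  [/\ continuous F, forall x, dot x x = 1 -> `|F x| <= M &
      forall x y t, orthonormal x y -> `|t| <= r -> `|F (circ x y t) - F x| <= M / 3].

(** Not the whole strip, but the two bands of width [a] along its edges that the crossings may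
    occupy; the meeting of two such sets excludes only short ranges of phases. *)
Definition in_strip (E : V * V * R) (z : V) : Prop := exists t x : R,
  [/\ 0 < x < E.2, alpha / 2 - a <= `|t| <= alpha / 2 & z = strip J E.1.1 E.1.2 t x].

(** The arcs of length alpha that are removed from the two circles joined by the strip. *)
Definition on_arc (E : V * V * R) (z : V) : Prop := exists2 t : R,
  `|t| <= alpha / 2 & z = rot J t E.1.1 \/ z = rot J t (circ E.1.1 E.1.2 E.2).

Definition fint (F : V -> R) (x : V) : R :=
  oint (fun t => F (rot J t x)) 0 (2 * pi).

Variables (p v : V) (l : R) (u w : R -> R) (e : bool).
Hypotheses (pv : horizontal J p v) (l_gt0 : 0 < l) (l_le : l <= pi / 2).
Hypotheses (r_lel : r <= l).
Hypotheses (uw : profile a (l + k) l u w) (ruw : regular_profile J s u w).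
Let b := l + k.
Let L := 2 * b + 2 * pi - alpha.
Let q := circ p v l.
Let E (e : bool) t := strip J p v ((-1) ^+ e * (u t - alpha / 2)) (w t).

(** The way back is the mirror image of the way out, run in reverse. Both formulas agree on
    [b, L - b], where they describe the motion on the new circle, because [L] contains a full period
    2 pi; so any place in this interval would serve for glueing. *)
Definition excursion : R -> V := glue (E e) (fun t => E (~~ e) (L - t)) (L / 2).

Let bE : b = l + k. Proof. by []. Qed.
Let LE : L = 2 * b + 2 * pi - alpha. Proof. by []. Qed.
Let alphaE : alpha = alpha0 + k. Proof. by []. Qed.

Local Ltac slra := move: alpha0_gt0 k_ge0 a_ge0 alpha_lt a_lt r_gt0 a_le k_le
  r_le l_gt0 l_le r_lel bE LE alphaE; lra.

Let signN (c : bool) : (-1) ^+ (~~ c) = - (-1) ^+ c :> R.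
Proof. by case: c; rewrite ?expr0 ?expr1 ?opprK. Qed.

Let E_left c t : t <= 0 -> E c t = rot J ((-1) ^+ c * (t - alpha / 2)) p.
Proof.
have [H _ _ _] := uw; rewrite /E => /H[-> ->].
by rewrite /strip /circ cos0 sin0 scale1r scale0r addr0.
Qed.

Let E_right c t : b <= t -> E c t = rot J ((-1) ^+ c * (b - t - alpha / 2)) q.
Proof. by have [_ H _ _] := uw; rewrite /E => /H[-> ->]. Qed.

Let rot2pi t (c : bool) : rot J (t + (-1) ^+ c * (2 * pi)) =1 rot J t.
Proof.
move=> x; rewrite -rot_rot//; case: c; rewrite ?expr1 ?expr0.
  by have := rot_int J x (-1); rewrite intrN mulrN1 mulN1r => ->.
by have := rot_int J x 1; rewrite mulr1 mul1r => ->.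
Qed.

Let E_mid t : b <= t <= L - b -> E e t = E (~~ e) (L - t).
Proof.
move=> tb; rewrite !E_right; [|slra..].
rewrite -(rot2pi _ e) signN; congr (rot J _ q).
by rewrite /L; move: ((-1) ^+ e) => g; field.
Qed.

Lemma excursion_regular : regular s excursion.
Proof.
apply: (@regular_glue _ _ _ _ _ _ (L / 2 - b)); first slra.
- exact: ruw.
- by apply: (regular_reverse L); exact: ruw.
- by move=> x xL; apply: E_mid; slra.
Qed.

Lemma excursion_first t : t <= L - b -> excursion t = E e t.
Proof.
by move=> tL; rewrite /excursion /glue; case: leP => // Lt; rewrite E_mid//; slra.
Qed.

Lemma excursion_last t : b <= t -> excursion t = E (~~ e) (L - t).
Proof.
by move=> tL; rewrite /excursion /glue; case: leP => // Lt; rewrite E_mid//; slra.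
Qed.

Lemma excursion_left t : t <= 0 ->
  excursion t = rot J ((-1) ^+ e * (t - alpha / 2)) p.
Proof. by move=> t0; rewrite excursion_first ?E_left//; slra. Qed.

Lemma excursion_right t : L <= t ->
  excursion t = rot J ((-1) ^+ e * (t - L + alpha / 2)) p.
Proof.
move=> tL; rewrite excursion_last ?E_left ?signN; [|slra..].
by congr (rot J _ p); move: ((-1) ^+ e) => g; field.
Qed.

Lemma excursion_mid t : b <= t <= L - b ->
  excursion t = rot J ((-1) ^+ e * (b - t - alpha / 2)) q.
Proof. by move=> tb; rewrite excursion_first ?E_right//; slra. Qed.

Let profP t : 0 < t < b -> [/\ 0 <= u t, u t <= a, 0 < w t, w t < l & w t <= t].
Proof.
move=> tb; have [H0 Hb H Hi] := uw.
have [/andP[u0 ua] wt] := H t ltac:(rewrite -/b; slra).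
have [_ w0] := H0 0 (lexx _); have [_ wb] := Hb _ (lexx _).
split=> //; first by rewrite -w0; apply: Hi; rewrite -/b; slra.
by rewrite -[X in _ < X]wb; apply: Hi; rewrite -/b; slra.
Qed.

Let E_strip c t : 0 < t < b -> in_strip (p, v, l) (E c t).
Proof.
move=> /profP[u0 ua w0 wl _]; exists ((-1) ^+ c * (u t - alpha / 2)), (w t).
split => //; first by rewrite w0.
rewrite normrM normrX normrN normr1 expr1n mul1r ler0_norm; slra.
Qed.

Lemma excursion_image t : 0 < t < L ->
  in_strip (p, v, l) (excursion t) \/ exists t', excursion t = rot J t' q.
Proof.
move=> tL; have [tb|bt] := ltP t b.
  by left; rewrite excursion_first; [apply: E_strip|]; slra.
have [tb|Lbt] := leP t (L - b).
  by right; rewrite excursion_mid ?bt//; eexists.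
by left; rewrite excursion_last//; apply: E_strip; slra.
Qed.

Let w_bound t : 0 < t < b -> 0 <= w t <= pi / 2.
Proof. by move=> /profP[]; slra. Qed.

Let w_neq t : 0 < t < b -> w t <> l.
Proof. by move=> /profP[]; slra. Qed.

Let w_inj t t' : 0 < t < b -> 0 < t' < b -> w t = w t' -> t = t'.
Proof.
have [_ _ _ Hi] := uw; move=> tb tb' ww.
have [tt|tt|//] := ltgtP t t'.
  by have := Hi t t' ltac:(slra) tt ltac:(rewrite -/b; slra); rewrite ww ltxx.
by have := Hi t' t ltac:(slra) tt ltac:(rewrite -/b; slra); rewrite ww ltxx.
Qed.

Let normr_signM (c : bool) (x : R) : `|(-1) ^+ c * x| = `|x|.
Proof. by rewrite normrM normrX normrN normr1 expr1n mul1r. Qed.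

(** Strip coordinates separate points up to phases modulo 2 pi. Within one crossing the height is
    strictly increasing, and on the new circle less than a full turn is made. *)
Lemma excursion_inj t t' : 0 < t -> t < t' -> t' < L -> excursion t <> excursion t'.
Proof.
move=> t0 tt tL.
have lp : 0 <= l <= pi / 2 by slra.
have sI := @strip_inj _ _ J JJ dotJJ p v _ _ _ _ pv.
have [t'b|bt'] := ltP t' b.
  rewrite !excursion_first; [|slra..] => /sI[||/w_inj H _]; first [by apply: w_bound; slra|slra].
have [tb|bt] := ltP t b.
  have tb' : 0 < t < b by slra.
  rewrite excursion_first; last slra.
  have [t'L|Lt'] := leP t' (L - b).
    rewrite excursion_mid ?bt'// => /sI[||+ _]; [exact: w_bound|by []|].
    exact: w_neq.
  have tb'' : 0 < L - t' < b by slra.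
  rewrite excursion_last// => /sI[||/(w_inj tb' tb'') e1]; [exact: w_bound..|].
  have [u0 ua _ _ _] := profP tb'.
  (* At equal heights the two crossings differ in phase by alpha - 2 u, which lies strictly between
     0 and 2 pi since u <= a < alpha / 2. *)
  rewrite -e1 signN mulNr opprK -mulrDr; apply: cos_neq1.
  by rewrite normr_signM ltr0_norm; slra.
have [t'L|Lt'] := leP t' (L - b).
  rewrite !excursion_mid; [|slra..] => /sI[||_]; [by []..|].
  rewrite -mulrBr; apply: cos_neq1; rewrite normr_signM gtr0_norm; [|slra].
  by rewrite /L in t'L; slra.
have tb'' : 0 < L - t' < b by slra.
rewrite (@excursion_last t')//.
have [tL'|Lt] := leP t (L - b).
  rewrite excursion_mid ?bt// => /esym/sI[||+ _]; [exact: w_bound|by []|].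
  exact: w_neq.
rewrite excursion_last// => /sI[||/w_inj H _]; first [by apply: w_bound; slra|slra].
Qed.

Let continuous_tame F M g : tame F M -> regular s g -> continuous (F \o g).
Proof.
move=> [cF _ _] /regular_continuous cg x.
by apply: continuous_comp; [exact: cg|exact: cF].
Qed.

Let rot_continuous F M (z : V) (c : bool) (x : R) : tame F M -> dot z z = 1 ->
  continuous (fun t : R => F (rot J ((-1) ^+ c * t + x) z)).
Proof.
move=> tF z1; apply: (continuous_tame tF); apply: regular_nice.
by apply: (nice_affine c x (nice_circ s (orthonormal_J JJ dotJJ z1))).
Qed.

(** From the end [pp] of the removed arc, the excursion is reached by climbing [w t] and then moving
    [u t] along the fibre, and the removed arc by moving [t]; these are the three arcs behind the
    bound in [tame]. *)
Let near_corner F M t : tame F M -> 0 <= t <= r ->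
  `|F (excursion t) - F (rot J ((-1) ^+ e * (t - alpha / 2)) p)| <= M.
Proof.
move=> [cF bF lF] tr; rewrite excursion_first; last slra.
have [H0 _ H Hi] := uw; have [_ w0] := H0 0 (lexx _).
have [/andP[u0 ua] wt] := H t ltac:(rewrite -/b; slra).
have wt0 : 0 <= w t.
  have [tp|] := ltP 0 t; first by have := Hi 0 t (lexx _) tp ltac:(rewrite -/b; slra); lra.
  by move=> t0; rewrite (_ : t = 0) ?w0//; lra.
set g := (-1) ^+ e; have g1 x : `|g * x| = `|x| by exact: normr_signM.
have hh := horizontal_rot JJ dotJJ (g * - (alpha / 2)) pv.
set pp := rot J _ p in hh; set vv := rot J _ v in hh.
have X1 : dot (circ pp vv (w t)) (circ pp vv (w t)) = 1.
  exact: (horizontal_end _ hh).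
have [p1 _ _ _] := hh.
have e1 := lF _ _ (w t) (horizontal_orthonormal hh) ltac:(rewrite ger0_norm//; slra).
have e2 := lF _ _ (g * u t) (orthonormal_J JJ dotJJ X1)
  ltac:(rewrite g1 ger0_norm//; slra).
have e3 := lF _ _ (g * t) (orthonormal_J JJ dotJJ p1)
  ltac:(rewrite g1 ger0_norm//; slra).
have -> : E e t = circ (circ pp vv (w t)) (J (circ pp vv (w t))) (g * u t).
  by rewrite -rotE /E /strip /pp /vv -rot_circ rot_rot// -mulrDr.
have -> : rot J (g * (t - alpha / 2)) p = circ pp (J pp) (g * t).
  by rewrite -rotE /pp rot_rot// -mulrDr.
move: e1 e2 e3; rewrite !ler_norml; lra.
Qed.

(** Five terms remain, bounded by [M] times r (the start, compared with the removed arc), b - r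
    (rest of the first crossing), alpha - r (rest of the removed arc), b (second crossing) and alpha
    (arc missing on the new circle). Their sum 2 b + 2 alpha - r is 2 l + 2 alpha0 + 4 k - r, and
    [4 k <= r]. *)
Lemma excursion_integral F M : tame F M ->
  `|oint (F \o excursion) 0 L - fint F q
    - oint (fun t => F (rot J ((-1) ^+ e * (t - alpha / 2)) p)) 0 alpha|
  <= (2 * l + 2 * alpha0) * M.
Proof.
move=> tF; have [cF bF _] := tF.
have q1 : dot q q = 1 by exact: (horizontal_end _ pv).
have [p1 _ _ _] := pv.
have M0 : 0 <= M by rewrite (le_trans _ (bF _ p1)).
set A := fun t => _; set H := F \o excursion.
pose Q t := F (rot J t q).
have cH : continuous H by exact: (continuous_tame tF excursion_regular).
have cQ : continuous Q.
  have := @rot_continuous F M q false 0 tF q1.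
  by under eq_fun do rewrite expr0 mul1r addr0.
have cA : continuous A.
  have := @rot_continuous F M p e ((-1) ^+ e * - (alpha / 2)) tF p1.
  by under eq_fun do rewrite -mulrDr.
have Qper x : Q (x + 2 * pi) = Q x.
  by have := rot2pi x false q; rewrite expr0 mul1r /Q => ->.
have Q1 x : `|Q x| <= M by apply: bF; rewrite dot_rot.
have H1 x : `|H x| <= M by apply: bF; exact: (regular_unit _ excursion_regular).
have A1 x : `|A x| <= M by apply: bF; rewrite dot_rot.
have mid : oint H b (L - b) = oint Q (alpha / 2) (2 * pi - alpha / 2).
  have bL : b <= L - b by slra.
  have HQ x : b <= x <= L - b -> H x = Q ((-1) ^+ e * (b - x - alpha / 2)).
    by move=> xb; rewrite /H /= excursion_mid.
  move: HQ; case: e => HQ.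
    rewrite (@oint_shift _ H Q b (L - b) (alpha / 2 - b))//.
      by congr oint; rewrite ?LE; lra.
    by move=> x /HQ ->; congr Q; rewrite expr1; lra.
  rewrite (@oint_refl _ H Q b (L - b) (b - alpha / 2))//; last first.
    by move=> x /HQ ->; congr Q; rewrite expr0; lra.
  rewrite (@oint_shift _ Q Q _ _ (2 * pi))//; last slra.
  by congr oint; rewrite ?LE; lra.
have top : fint F q = oint Q (alpha / 2) (2 * pi - alpha / 2)
    + oint Q (2 * pi - alpha / 2) (2 * pi + alpha / 2).
  rewrite oint_add /fint -/Q -(oint_add Q 0 (alpha / 2)).
  rewrite (@oint_shift _ Q Q 0 (alpha / 2) (2 * pi))//; last slra.
  by rewrite add0r addrC [alpha / 2 + _]addrC oint_add.
have r0 : 0 <= r by slra.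
have rb : r <= b by slra.
have corner : `|oint H 0 r - oint A 0 r| <= (r - 0) * M.
  rewrite ointB//; apply: oint_bound => //.
    by move=> x; apply: cvgB; [exact: cH|exact: cA].
  by move=> x xr; exact: near_corner.
have b1 := @oint_bound _ H r b M rb cH (fun x _ => H1 x).
have b2 := @oint_bound _ A r alpha M r_le cA (fun x _ => A1 x).
have b3 := @oint_bound _ H (L - b) L M ltac:(slra) cH (fun x _ => H1 x).
have b4 := @oint_bound _ Q (2 * pi - alpha / 2) (2 * pi + alpha / 2) M
  ltac:(slra) cQ (fun x _ => Q1 x).
rewrite -(oint_add H 0 (L - b)) -(oint_add H 0 b) -(oint_add H 0 r b).
rewrite -(oint_add A 0 r alpha) mid top.
have kM : 4 * k * M <= r * M by rewrite ler_wpM2r.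
have -> : (2 * l + 2 * alpha0) * M =
  2 * b * M + 2 * alpha * M - 4 * k * M by rewrite alphaE bE; ring.
move: corner b1 b2 b3 b4; rewrite !ler_norml.
move: (oint H 0 r) (oint A 0 r) (oint H r b) (oint A r alpha) (oint H (L - b) L).
move: (oint Q _ _) (oint Q _ _) => x1 x2 x3 x4 x5 x6 x7.
rewrite subr0 !mulrBl; lra.
Qed.

End excursion_curve.

(** * Attaching an excursion to a closed tour *)

Section surgery.
Variables (R : realType) (d : nat).
Local Notation V := 'rV[R]_d.+1.
Variable J : {linear V -> V}.
Hypothesis JJ : forall x, J (J x) = - x.
Hypothesis dotJJ : forall x y, dot (J x) (J y) = dot x y.
Variables (s : bool) (alpha0 k a r : R) (x0 : V).
Hypotheses (alpha0_gt0 : 0 < alpha0) (k_ge0 : 0 <= k) (a_ge0 : 0 <= a).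
Let alpha := alpha0 + k.
Hypotheses (alpha_lt : alpha < 2 * pi) (a_lt : 2 * a < alpha).
Hypotheses (r_gt0 : 0 < r) (a_le : a <= r) (k_le : 4 * k <= r) (r_le : r <= alpha).
Hypothesis x01 : dot x0 x0 = 1.
Implicit Types (xs : seq V) (es : seq (V * V * R)) (E : V * V * R).
Local Notation on_arc := (on_arc J alpha0 k).
Local Notation in_strip := (in_strip J alpha0 k a).

(** A place where a further edge can be attached: the arc of length alpha centred at [z] stays off
    the base point, where the parameter starts anew, and off all removed arcs. *)
Definition free_arc es (z : V) : Prop := forall t : R, `|t| <= alpha / 2 ->
  rot J t z <> x0 /\ forall E, E \in es -> ~ on_arc E (rot J t z).

(* A closed curve [G] of length [T] that runs once through the circles through
   the points of [xs], except for short arcs that are replaced by two copies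
   of each strip of [es]. It starts and ends on the circle through [x0]; both
   ends are prolonged along that circle. *)
Record tour xs es (G : R -> V) (T : R) : Prop := Tour {
  tour_regular : regular s G;
  tour_ends : exists2 eta, 0 < eta < T &
    (forall t, t <= eta -> G t = rot J t x0) /\
    (forall t, T - eta <= t -> G t = rot J (t - T) x0);
  tour_inj : forall t t', 0 <= t -> t < t' -> t' < T -> G t <> G t';
  tour_image : forall t, 0 <= t < T ->
    (exists2 x, x \in xs & exists t', G t = rot J t' x) \/
    (exists2 E, E \in es & in_strip E (G t));
  tour_free : forall x th, x \in xs -> free_arc es (rot J th x) ->
    exists (e : bool) (t0 eta : R), [/\ 0 < eta, eta < t0, t0 + alpha + eta < T &
      forall t, - eta <= t <= alpha + eta ->
        G (t0 + t) = rot J ((-1) ^+ e * (t - alpha / 2)) (rot J th x)];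
  tour_integral : forall F M, tame r F M ->
    `|oint (F \o G) 0 T - \sum_(x <- xs) fint J F x|
      <= (\sum_(E <- es) (2 * E.2 + 2 * alpha0)) * M;
  tour_length : T = 2 * pi * (size xs)%:R + \sum_(E <- es) (2 * E.2 - 2 * alpha0)
}.

Local Ltac slra := move: alpha0_gt0 k_ge0 a_ge0 alpha_lt a_lt r_gt0 a_le k_le
  r_le; lra.

Let alpha_gt0 : 0 < alpha. Proof. rewrite /alpha; slra. Qed.

Let rot2pi t (n : int) z : rot J (t + 2 * pi * n%:~R) z = rot J t z.
Proof. by rewrite -rot_rot// rot_int. Qed.

Let signN (c : bool) : (-1) ^+ (~~ c) = - (-1) ^+ c :> R.
Proof. by case: c; rewrite ?expr0 ?expr1 ?opprK. Qed.

Let rot2pis t (n : int) (e : bool) z :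
  rot J (t - (-1) ^+ e * (2 * pi * n%:~R)) z = rot J t z.
Proof.
rewrite -[RHS](rot2pi t (if e then n else - n)); congr (rot J _ z).
by case: e; rewrite ?expr0 ?expr1 ?intrN; ring.
Qed.

Let ex_angle (th : R) : exists2 z : R, 0 <= z < 2 * pi & rot J th =1 rot J z.
Proof.
have [n nP] := ex_angle_mod th; exists (th - 2 * pi * n%:~R) => // z.
by rewrite -[RHS](rot2pi _ n) subrK.
Qed.

Lemma tour_init : tour [:: x0] [::] (fun t => rot J t x0) (2 * pi).
Proof.
have p0 := pi_gt0 R.
split.
- exact/regular_nice/(nice_circ s (orthonormal_J JJ dotJJ x01)).
- exists pi; first lra; split=> // t _.
  by rewrite -[RHS](rot2pi _ 1) mulr1 subrK.
- move=> t t' t0 tt t2 /(rot_inj JJ dotJJ x01); apply: cos_neq1.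
  by rewrite distrC gtr0_norm; lra.
- by move=> t _; left; exists x0; rewrite ?inE//; exists t.
- move=> x th; rewrite inE => /eqP ->; have [z zP e] := ex_angle th.
  rewrite e => fz.
  have za : alpha / 2 < z.
    rewrite ltNge; apply/negP => za; have [] := fz (- z); first by rewrite normrN ger0_norm; lra.
    by rewrite rot_rot// addNr rot0.
  have za' : z < 2 * pi - alpha / 2.
    rewrite ltNge; apply/negP => za'.
    have [] := fz (2 * pi - z); first by rewrite ger0_norm; lra.
    by rewrite rot_rot// subrK -[2 * pi]mulr1 (rot_int J x0 1).
  exists false, (z - alpha / 2), (Order.min (z - alpha / 2) (2 * pi - alpha / 2 - z) / 2).
  set m := Order.min _ _.
  have m1 : m <= z - alpha / 2 by rewrite ge_min lexx.
  have m2 : m <= 2 * pi - alpha / 2 - z by rewrite ge_min lexx orbT.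
  have m0 : 0 < m by rewrite lt_min; lra.
  split; [lra..|move=> t _].
  by rewrite rot_rot// expr0 mul1r; congr (rot J _ x0); lra.
- move=> F M tF; rewrite !big_cons !big_nil addr0 mul0r.
  by rewrite /fint [_ \o _]/comp subrr normr0.
- by rewrite big_nil mulr1 addr0.
Qed.

Section attach.
Variables (xs : seq V) (es : seq (V * V * R)) (G : R -> V) (T : R).
Variables (p v : V) (l : R) (u w : R -> R).
Let q := circ p v l.
Hypotheses (tG : tour xs es G T) (pv : horizontal J p v).
Hypotheses (r_lel : r <= l) (l_le : l <= pi / 2).
Hypotheses (uw : profile a (l + k) l u w) (ruw : regular_profile J s u w).
Hypothesis p_on : exists2 x, x \in xs & exists th, p = rot J th x.
Hypothesis p_free : free_arc es p.
Hypothesis q_off : forall x th, x \in xs -> q <> rot J th x.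
Hypothesis strip_off : forall x th t, x \in xs -> 0 < t < l ->
  circ p v t <> rot J th x.
Hypothesis q_off_strips : forall E th t, E \in es -> 0 < t < E.2 ->
  circ E.1.1 E.1.2 t <> rot J th q.
Hypothesis strips_disjoint : forall E z, E \in es -> in_strip E z ->
  ~ in_strip (p, v, l) z.

Let b := l + k.
Let L := 2 * b + 2 * pi - alpha.
Let exc := excursion J alpha0 k p v l u w.

Let l_gt0 : 0 < l. Proof. by apply: lt_le_trans r_lel. Qed.

Let rotN th z y : rot J th z = y -> z = rot J (- th) y.
Proof. by move=> <-; rewrite rot_rot// addNr rot0. Qed.

(** Rotating a common point back to a horizontal arc turns each of the four kinds of meeting into an
    excluded coincidence; only the meeting of two bands depends on the choice of the phase. *)
Let new_vs_old z : in_strip (p, v, l) z \/ (exists t', z = rot J t' q) ->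
  (exists2 x, x \in xs & exists t', z = rot J t' x) \/
    (exists2 E, E \in es & in_strip E z) -> False.
Proof.
case=> [[t [y [/= yl ta zE]]]|[t' zE]] [[x xxs [t'' zE']]|[E Ees Ez]].
- have : circ p v y = rot J (- t + t'') x.
    by rewrite -rot_rot// -zE'; apply: rotN; rewrite zE.
  exact: strip_off.
- by apply: (strips_disjoint Ees Ez); exists t, y.
- have : q = rot J (- t' + t'') x by rewrite -rot_rot// -zE'; apply: rotN; rewrite zE.
  exact: q_off.
- have [t [y [yl ta]]] := Ez; rewrite /strip => zE2.
  have : circ E.1.1 E.1.2 y = rot J (- t + t') q.
    by rewrite -rot_rot// -zE; apply: rotN; rewrite zE2.
  exact: q_off_strips.
Qed.

(** [z] is the distance along the new circle from the end of the first crossing to the free arc.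
    Only 2 pi - alpha of this circle is traversed; as a free arc avoids the removed part, it lies
    strictly inside, whence z + 2 alpha < 2 pi. The new circle is traversed in the direction
    opposite to [e]. *)
Let new_fibre (e : bool) th' : free_arc ((p, v, l) :: es) (rot J th' q) ->
  exists z : R, [/\ 0 < z, z + 2 * alpha < 2 * pi & forall t,
    rot J ((-1) ^+ e * (- z - t - alpha / 2)) q =
    rot J ((-1) ^+ (~~ e) * (t - alpha / 2)) (rot J th' q)].
Proof.
move=> yf; have ag : 0 < alpha := alpha_gt0.
have [n] := ex_angle_mod (- alpha - (-1) ^+ e * th').
have thE : (-1) ^+ e * ((-1) ^+ e * th') = th' by rewrite mulrA -expr2 sqrr_sign mul1r.
move: ((-1) ^+ e * th') thE => z1 thE zP.
pose z := - alpha - z1 - 2 * pi * n%:~R; rewrite -/z in zP.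
have off y' (m : int) : `|y'| <= alpha -> z1 = - y' - 2 * pi * m%:~R -> False.
  rewrite ler_norml => y'a z1E.
  have [_ /(_ (p, v, l))] := yf ((-1) ^+ e * (y' / 2))
    ltac:(rewrite normrM normrX normrN normr1 expr1n mul1r ler_norml -/alpha; lra).
  rewrite inE eqxx => /(_ isT); apply.
  exists ((-1) ^+ e * - (y' / 2)).
    by rewrite normrM normrX normrN normr1 expr1n mul1r ler_norml -/alpha; lra.
  right; rewrite rot_rot// -thE z1E -mulrDr.
  rewrite (_ : y' / 2 + _ = - (y' / 2) - 2 * pi * m%:~R); last lra.
  by rewrite mulrBr -[RHS](rot2pis _ m e).
have z_gt0 : 0 < z.
  rewrite lt_def (andP zP).1 andbT; apply/eqP => z0.
  by apply: (off alpha n); [rewrite ler_norml; lra|rewrite /z in z0; lra].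
have z_lt : z + 2 * alpha < 2 * pi.
  rewrite ltNge; apply/negP => zb; apply: (off (z + alpha - 2 * pi) (n + 1)).
    by rewrite ler_norml; lra.
  by rewrite intrD /z; lra.
exists z; split=> // t; rewrite rot_rot// -thE signN mulNr -mulrN -mulrDr.
rewrite -[LHS](rot2pis _ n e) -mulrBr; congr (rot J (_ * _) q).
by rewrite /z; lra.
Qed.

(** The integral over the removed arc leaves the old tour and reappears in the estimate of the
    excursion, so the two error bounds simply add. *)
Let attach_integral (G' : R -> V) (e : bool) (t0 : R) F M :
  0 <= t0 -> t0 + alpha <= T -> regular s G' ->
  (forall t, t <= t0 -> G' t = G t) ->
  (forall t, t0 <= t <= t0 + L -> G' t = exc e (t - t0)) ->
  (forall t, t0 + L <= t -> G' t = G (t - L + alpha)) ->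
  (forall t, 0 <= t <= alpha -> G (t0 + t) = rot J ((-1) ^+ e * (t - alpha / 2)) p) ->
  tame r F M ->
  `|oint (F \o G') 0 (T + L - alpha) - \sum_(x <- q :: xs) fint J F x|
    <= (\sum_(E <- (p, v, l) :: es) (2 * E.2 + 2 * alpha0)) * M.
Proof.
move=> t00 t0T rG' GA GB GC Gt0 tF; rewrite !big_cons.
have ag : 0 < alpha := alpha_gt0.
have L0 : 0 < L by rewrite /L /b; move: l_gt0; slra.
pose X := exc e.
have rX : regular s X by apply: (excursion_regular JJ (a := a) (r := r)).
have [cF bF _] := tF.
have cG : continuous (F \o G).
  move=> t; apply: continuous_comp; last exact: cF.
  exact: (regular_continuous (tour_regular tG)).
have cG' : continuous (F \o G').
  by move=> t; apply: continuous_comp; [exact: (regular_continuous rG')|exact: cF].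
have cX : continuous (F \o X).
  by move=> t; apply: continuous_comp; [exact: (regular_continuous rX)|exact: cF].
pose A t := F (rot J ((-1) ^+ e * (t - alpha / 2)) p).
have [p1 _ _ _] := pv.
have cA : continuous A.
  move=> t; apply: continuous_comp; last exact: cF.
  have := nice_affine e ((-1) ^+ e * - (alpha / 2)) (nice_circ s (orthonormal_J JJ dotJJ p1)).
  under eq_fun do rewrite -mulrDr.
  by move=> /regular_nice /regular_continuous; apply.
have i1 : oint (F \o G') 0 t0 = oint (F \o G) 0 t0.
  by apply: eq_oint => // t tt; rewrite /= GA//; lra.
have i2 : oint (F \o G') t0 (t0 + L) = oint (F \o X) 0 L.
  rewrite (@oint_shift _ _ (F \o X) _ _ (- t0))//; [|lra|].
    by rewrite subrr addrC addrA addNr add0r.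
  by move=> t tt; rewrite /= GB.
have i3 : oint (F \o G') (t0 + L) (T + L - alpha) = oint (F \o G) (t0 + alpha) T.
  rewrite (@oint_shift _ _ (F \o G) _ _ (- L + alpha))//; [|lra|].
    by congr oint; lra.
  by move=> t /andP[tt _]; rewrite /= GC//; congr (F (G _)); lra.
have i4 : oint (F \o G) t0 (t0 + alpha) = oint A 0 alpha.
  rewrite (@oint_shift _ _ A _ _ (- t0))//; [|by move: alpha_gt0; lra|].
    by rewrite subrr addrC addrA addNr add0r.
  move=> t tt; rewrite /= /A -Gt0; last lra.
  by congr (F (G _)); lra.
have iX : `|oint (F \o X) 0 L - fint J F q - oint A 0 alpha|
    <= (2 * l + 2 * alpha0) * M.
  by apply: (excursion_integral JJ dotJJ (a := a) (r := r) (s := s)).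
have iG := tour_integral tG tF.
rewrite -(oint_add _ 0 t0) -(oint_add _ t0 (t0 + L)) i1 i2 i3.
move: iG; rewrite -(oint_add _ 0 t0) -(oint_add _ t0 (t0 + alpha) T) i4.
move: iX; rewrite !ler_norml /= !mulrDl; lra.
Qed.

Lemma tour_attach : exists G' T', tour (q :: xs) ((p, v, l) :: es) G' T'.
Proof.
have ag : 0 < alpha := alpha_gt0.
have [x xxs [th pE]] := p_on.
have pf : free_arc es (rot J th x) by rewrite -pE.
have [e [t0 [eta [eta0 et0 t0T Gt0]]]] := tour_free tG xxs pf.
rewrite -pE in Gt0.
have p0 := pi_gt0 R.
have LE : L = 2 * b + 2 * pi - alpha by [].
have bE : b = l + k by [].
have L0 : 2 * b < L by rewrite /L; slra.
have b0 : 0 < b by move: l_gt0; slra.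
pose X := exc e.
have rX : regular s X by apply: (excursion_regular JJ (a := a) (r := r)).
have XL t : t <= 0 -> X t = rot J ((-1) ^+ e * (t - alpha / 2)) p.
  by apply: (excursion_left JJ (a := a) (r := r)).
have XR t : L <= t -> X t = rot J ((-1) ^+ e * (t - L + alpha / 2)) p.
  by apply: (excursion_right JJ (a := a) (r := r)).
have XM t : b <= t <= L - b -> X t = rot J ((-1) ^+ e * (b - t - alpha / 2)) q.
  by apply: (excursion_mid JJ (a := a) (r := r)).
have Ximg t : 0 < t < L -> in_strip (p, v, l) (X t) \/ exists t', X t = rot J t' q.
  by apply: (excursion_image JJ (a := a) (r := r)).
have Xinj t t' : 0 < t -> t < t' -> t' < L -> X t <> X t'.
  by apply: (excursion_inj JJ dotJJ (a := a) (r := r)).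
pose X' t := X (t - t0); pose G2 t := G (t - L + alpha).
(* Both joints lie eta / 2 outside the excursion, where its prolongation runs along the old circle
   together with the old tour; this provides the agreement on a neighbourhood that glueing
   requires. *)
pose G1 := glue X' G2 (t0 + L + eta / 2).
pose G' := glue G G1 (t0 - eta / 2).
have XG t : t0 - eta <= t <= t0 -> X' t = G t.
  move=> tt; rewrite /X' XL; last lra.
  by rewrite -[in RHS](subrK t0 t) [t - t0 + t0]addrC Gt0//; slra.
have XG2 t : t0 + L <= t <= t0 + L + eta -> X' t = G2 t.
  move=> tt; rewrite /X' XR; last lra.
  rewrite /G2 (_ : t - L + alpha = t0 + (t - t0 - L + alpha)); last lra.
  rewrite Gt0; last by move: alpha_gt0; lra.
  by congr (rot J (_ * _) p); lra.
have G1A t : t <= t0 + L -> G1 t = X' t.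
  by move=> tt; rewrite /G1 /glue ifT//; lra.
have rG1 : regular s G1.
  apply: (@regular_glue _ _ _ _ _ _ (eta / 2)); first lra.
  - by have := regular_shift (- t0) rX.
  - have := regular_shift (- L + alpha) (tour_regular tG).
    by under eq_fun do rewrite addrA.
  - by move=> t tt; apply: XG2; lra.
have rG' : regular s G'.
  apply: (@regular_glue _ _ _ _ _ _ (eta / 2)); first lra.
  - exact: tour_regular tG.
  - exact: rG1.
  - by move=> t tt; rewrite G1A ?XG//; lra.
have GA t : t <= t0 -> G' t = G t.
  move=> tt; rewrite /G' /glue; case: leP => // tt'.
  by rewrite G1A ?XG//; lra.
have GB t : t0 <= t <= t0 + L -> G' t = X' t.
  move=> tt; rewrite /G' /glue ifF; last by apply/negbTE; rewrite -ltNge; lra.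
  by rewrite G1A//; lra.
have GC t : t0 + L <= t -> G' t = G2 t.
  move=> tt; rewrite /G' /glue ifF; last by apply/negbTE; rewrite -ltNge; lra.
  by rewrite /G1 /glue; case: leP => // tt'; rewrite XG2//; lra.
pose T' := T + L - alpha.
have new t : t0 < t < t0 + L ->
    in_strip (p, v, l) (G' t) \/ exists t', G' t = rot J t' q.
  by move=> tt; rewrite GB; [apply: Ximg|]; lra.
have old t : 0 <= t < T' -> ~~ (t0 < t < t0 + L) ->
    (exists2 x, x \in xs & exists t', G' t = rot J t' x) \/
    (exists2 E, E \in es & in_strip E (G' t)).
  move=> tT tt; have [t1|t1] := leP t t0.
    by rewrite GA//; apply: (tour_image tG); lra.
  have t2 : t0 + L <= t by move: tt; rewrite t1 /= -leNgt.
  rewrite GC//; apply: (tour_image tG); rewrite /T' in tT; lra.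
clear XL XR XG XG2 G1A rG1 rX Ximg.
exists G', T'; split.
- exact: rG'.
- have [eta1 /andP[eta10 eta1T] [end1 end2]] := tour_ends tG.
  clear GB new old Xinj XM Gt0.
  have m1 : Order.min eta1 (Order.min t0 (T - t0 - alpha)) <= eta1.
    by rewrite ge_min lexx.
  have m2 : Order.min eta1 (Order.min t0 (T - t0 - alpha)) <= t0.
    by rewrite !ge_min lexx orbT.
  have m3 : Order.min eta1 (Order.min t0 (T - t0 - alpha)) <= T - t0 - alpha.
    by rewrite !ge_min lexx !orbT.
  exists (Order.min eta1 (Order.min t0 (T - t0 - alpha))).
    by rewrite !lt_min; rewrite /T'; lra.
  split=> t tt; first by rewrite GA ?end1//; lra.
  rewrite GC; last by rewrite /T' in tt; lra.
  by rewrite /G2 end2 /T'; [congr (rot J _ x0)|rewrite /T' in tt]; lra.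
- clear XM Gt0; move=> t t' tt0 tt tT' GG.
  have [nt|ot] := boolP (t0 < t < t0 + L); have [nt'|ot'] := boolP (t0 < t' < t0 + L).
  + clear GA GC new old; move: GG; rewrite !GB; [|lra..]; apply: Xinj; lra.
  + by apply: (new_vs_old (new _ nt)); rewrite GG; apply: old => //; lra.
  + by apply: (new_vs_old (new _ nt')); rewrite -GG; apply: old => //; lra.
  + clear new old GB Xinj; move: GG; have [t1|t1] := leP t t0.
      rewrite (GA t)//; have [t1'|t1'] := leP t' t0.
        by rewrite GA//; apply: (tour_inj tG) => //; lra.
      have t2 : t0 + L <= t' by move: ot'; rewrite t1' /= -leNgt.
      by rewrite GC//; apply: (tour_inj tG) => //; move: alpha_gt0; rewrite /T' in tT'; lra.
    have t2 : t0 + L <= t by move: ot; rewrite t1 /= -leNgt.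
    rewrite !GC//; last lra.
    by apply: (tour_inj tG) => //; move: alpha_gt0; rewrite /T' in tT'; lra.
- move=> t tT; have [nt|ot] := boolP (t0 < t < t0 + L).
    have [Es|[t' qt]] := new _ nt; first by right; exists (p, v, l); rewrite ?inE ?eqxx.
    by left; exists q; rewrite ?inE ?eqxx//; exists t'.
  have [[y yxs H]|[E Ees H]] := old _ tT ot.
    by left; exists y; rewrite // inE yxs orbT.
  by right; exists E; rewrite // inE Ees orbT.
- clear new old Xinj; move=> y th' yxs yf.
  have [yq|yxs'] : y = q \/ y \in xs.
    by move: yxs; rewrite inE => /predU1P.
    rewrite yq in yf *.
    have [z [z_gt0 z_lt zE]] := new_fibre e yf.
    exists (~~ e), (t0 + b + z), (Order.min z (2 * pi - 2 * alpha - z) / 2).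
    set mm := Order.min _ _.
    have m1 : mm <= z by rewrite ge_min lexx.
    have m2 : mm <= 2 * pi - 2 * alpha - z by rewrite ge_min lexx orbT.
    have m0 : 0 < mm by rewrite lt_min; lra.
    split; [lra|lra|rewrite /T'; lra|move=> t tt].
    rewrite GB; last lra.
    rewrite /X' XM; last lra.
    by rewrite -zE; congr (rot J (_ * _) q); lra.
  have yf' : free_arc es (rot J th' y).
    move=> t ta; have [H1 H2] := yf t ta; split=> // E Ees.
    by apply: H2; rewrite inE Ees orbT.
  have [e1 [t1 [eta2 [eta20 et1 t1T Gt1]]]] := tour_free tG yxs' yf'.
  (* A free arc of an old circle shares no time with the arc that is removed now, since a common
     point would lie on the latter. It is thus traversed entirely before it, or entirely after it
     and then with the delay L - alpha. *)
  have disj t : t1 <= t <= t1 + alpha -> t0 <= t <= t0 + alpha -> False.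
    move=> i1 i0; have := Gt1 (t - t1) ltac:(lra); rewrite addrC subrK => E1.
    have := Gt0 (t - t0) ltac:(lra); rewrite addrC subrK => E0.
    have [_ /(_ (p, v, l))] := yf ((-1) ^+ e1 * (t - t1 - alpha / 2))
      ltac:(rewrite normrM normrX normrN normr1 expr1n mul1r ler_norml -/alpha; lra).
    rewrite inE eqxx => /(_ isT); apply; rewrite -E1 E0.
    exists ((-1) ^+ e * (t - t0 - alpha / 2)); last by left.
    by rewrite normrM normrX normrN normr1 expr1n mul1r ler_norml -/alpha; lra.
  clear GB XM Gt0; have [t10|t10] := ltP (t1 + alpha) t0.
    exists e1, t1, (Order.min eta2 (t0 - alpha - t1)).
    have m1 : Order.min eta2 (t0 - alpha - t1) <= eta2 by rewrite ge_min lexx.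
    have m2 : Order.min eta2 (t0 - alpha - t1) <= t0 - alpha - t1.
      by rewrite ge_min lexx orbT.
    split; [by rewrite lt_min; lra|lra|rewrite /T'; lra|move=> t tt].
    by rewrite GA ?Gt1//; lra.
  have t01 : t0 + alpha < t1.
    rewrite ltNge; apply/negP => t01; move: alpha_gt0 => ?.
    have [tt|/ltW tt] := leP t0 t1; first by apply: (disj t1); lra.
    by apply: (disj t0); lra.
  exists e1, (t1 + L - alpha), (Order.min eta2 (t1 - alpha - t0)).
  have m1 : Order.min eta2 (t1 - alpha - t0) <= eta2 by rewrite ge_min lexx.
  have m2 : Order.min eta2 (t1 - alpha - t0) <= t1 - alpha - t0.
    by rewrite ge_min lexx orbT.
  split; [by rewrite lt_min; lra|lra|rewrite /T'; lra|move=> t tt].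
  rewrite GC; last lra.
  by rewrite /G2 -Gt1; [congr G|]; lra.
- move=> F M tF; apply: (attach_integral (e := e) (t0 := t0)) => //; try lra.
  by move=> t tt; apply: Gt0; lra.
- rewrite /T' (tour_length tG) big_cons /= -natr1 LE bE /alpha; lra.
Qed.

End attach.

End surgery.

(** * From tours to closed curves on [0, 1] *)

Section partitions.
Variable R : realType.

(* Real induction. *)
Lemma piecewise_local (P : R -> R -> Prop) :
  (forall t, 0 <= t <= 1 -> exists2 e, 0 < e &
    (forall x, t - e <= x < t -> P x t) /\ (forall y, t < y <= t + e -> P t y)) ->
  piecewise P.
Proof.
move=> H.
pose chain (x : R) := exists p : seq R, [/\ path <%R 0 p, last 0 p = x &
  forall i, (i < size p)%N -> P (nth 0 (0 :: p) i) (nth 0 p i)].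
have extend x y : chain x -> x < y -> P x y -> chain y.
  move=> [p [pp px pP]] xy Pxy; exists (rcons p y); split.
  - by rewrite rcons_path pp px.
  - by rewrite last_rcons.
  - move=> i; rewrite size_rcons ltnS leq_eqVlt => /predU1P[->|ip].
      by rewrite -rcons_cons !nth_rcons /= ltnS leqnn ltnn eqxx -last_nth px.
    by rewrite -rcons_cons !nth_rcons /= ltnS (ltnW ip) ip; exact: pP.
pose A := [set x | 0 <= x <= 1 /\ chain x].
have A0 : A 0 by split; [rewrite lexx ler01|exists [::]].
have supA : has_sup A by split; [exists 0|exists 1 => x [/andP[]]].
pose c := sup A.
have c1 : c <= 1 by apply: ge_sup; [exists 0|move=> x [/andP[]]].
have c0 : 0 <= c by apply: ub_le_sup => //; exact: supA.2.
have [e e0 [He1 He2]] := H c ltac:(by rewrite c0 c1).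
have chc : chain c.
  have [x Ax xc] := sup_adherent e0 supA; have [x01 chx] := Ax.
  have : x <= c by apply: ub_le_sup => //; exact: supA.2.
  rewrite le_eqVlt => /predU1P[<-//|xc']; apply: (extend _ _ chx xc').
  by apply: He1; rewrite xc' andbT ltW.
have {c1} [c1|c1] := ltP c 1; last first.
  have c1E : c = 1 by apply/eqP; rewrite eq_le c1 andbT; apply: ge_sup; [exists 0|move=> x [/andP[]]].
  have [p [pp pc pP]] := chc; exists p; split=> //; split=> //.
  by rewrite pc c1E.
pose y := Order.min (c + e) 1.
have cy : c < y by rewrite lt_min c1 ltrDl e0.
have Ay : A y.
  split; first by rewrite (le_trans c0 (ltW cy)) ge_min lexx orbT.
  apply: (extend _ _ chc cy); apply: He2; rewrite cy /= /y ge_min lexx//.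
have : y <= c by apply: ub_le_sup => //; exact: supA.2.
by rewrite leNgt cy.
Qed.

(** At the corners the derivative inside [curve_integral] has no controlled value; these finitely
    many points form a null set. Off this set [f] also inherits the measurability of [g]. *)
Lemma Rintegral_cofinite (f g : R -> R) (N : set R) : finite_set N ->
  continuous g -> (forall x, ~ N x -> 0 <= x <= 1 -> f x = g x) ->
  \int[lebesgue_measure]_(x in `[0, 1]) f x =
  \int[lebesgue_measure]_(x in `[0, 1]) g x.
Proof.
move=> finN cg fg; rewrite /Rintegral; congr fine.
have cN : countable N by exact: finite_set_countable.
have mN : measurable N.
  apply: countable_measurable => // x; exact: measurable_set1.
have mg D : measurable D -> measurable_fun D g.
  move=> mD; apply: measurable_funTS.
  exact: continuous_measurable_fun.
apply: ae_eq_integral => //.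
- apply/measurable_EFinP.
  rewrite -(setUIDK `[0, 1] N).
  apply/measurable_funU; [exact: measurableI|exact: measurableD|split].
    move=> _ B mB; apply: countable_measurable.
      by move=> x; exact: measurable_set1.
    by apply: sub_countable cN; apply: subset_card_le => x [[]].
  apply: eq_measurable_fun (mg _ _) => //; last exact: measurableD.
  by move=> x; rewrite inE => -[/=]; rewrite in_itv/= => x01 Nx; rewrite fg.
- by apply/measurable_EFinP; exact: mg.
- exists N; split => //.
    exact: countable_lebesgue_measure0.
  move=> x /= /not_implyP[]; rewrite in_itv/= => x01 fgx.
  by apply: contrapT => Nx; apply: fgx; rewrite fg.
Qed.

End partitions.

Section closing_up.
Variables (R : realType) (d : nat).
Local Notation V := 'rV[R]_d.+1.
Variable J : {linear V -> V}.
Hypothesis JJ : forall x, J (J x) = - x.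
Hypothesis dotJJ : forall x y, dot (J x) (J y) = dot x y.

(** Made total by the default [point] off the unit sphere; it is evaluated at unit vectors only. *)
Definition to_sphere (x : V) : sphere R d :=
  if pselect (x \in @unit_sphere R d) is left h then SigSub h else point.

Lemma emb_to_sphere x : dot x x = 1 -> emb (to_sphere x) = x.
Proof.
move=> x1; rewrite /to_sphere; case: pselect => // -[].
by rewrite inE /unit_sphere /=; exact/enorm1P.
Qed.

Lemma emb_unit (x : sphere R d) : dot (emb x) (emb x) = 1.
Proof. by apply/enorm1P; exact: (set_mem (valP x)). Qed.

Lemma emb_inj : injective (@emb R d).
Proof. exact: val_inj. Qed.

Lemma piece_of (P : R -> R -> Prop) (p : seq R) a t :
  path <%R a p -> (forall i, (i < size p)%N -> P (nth 0 (a :: p) i) (nth 0 p i)) ->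
  a < t -> t < last a p -> t \notin p -> exists x y, P x y /\ x < t < y.
Proof.
elim: p a => [|b p IH] a /=; first by move=> _ _ /lt_trans /[apply]; rewrite ltxx.
move=> /andP[ab pb] HP at_ tl; rewrite inE negb_or => /andP[tb tp].
have [tb'|bt|te] := ltgtP t b; last by rewrite te eqxx in tb.
  by exists a, b; split; [exact: (HP 0%N)|rewrite at_].
by apply: (IH b) => // i ip; exact: (HP i.+1).
Qed.

Variables (s : bool) (alpha0 k a r : R) (x0 : V).
Variables (xs : seq V) (es : seq (V * V * R)) (G : R -> V) (T : R).
Hypothesis x01 : dot x0 x0 = 1.
Hypothesis tG : tour J s alpha0 k a r x0 xs es G T.

Let T_gt0 : 0 < T.
Proof. by have [eta /andP[/lt_trans H /H]] := tour_ends tG. Qed.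

Let G1 t : dot (G t) (G t) = 1. Proof. exact: regular_unit (tour_regular tG). Qed.

Definition tour_curve (t : R) : sphere R d := to_sphere (G (T * t)).
Local Notation gamma := tour_curve.

Let embg t : emb (gamma t) = G (T * t). Proof. exact: emb_to_sphere. Qed.

Let GT : G T = G 0.
Proof.
have [eta /andP[e0 eT] [H1 H2]] := tour_ends tG.
by rewrite (H1 0) ?(H2 T) ?subrr//; lra.
Qed.

Lemma tour_simple : simple_curve gamma.
Proof.
apply/seteqP; split => // -[t t'] [/= t0 tt t1 gg].
have := congr1 emb gg; rewrite !embg.
apply: (tour_inj tG).
- by rewrite mulr_ge0// ltW.
- by rewrite ltr_pM2l.
- by rewrite -[X in _ < X]mulr1 ltr_pM2l.
Qed.

Lemma tour_closed : closed_curve gamma.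
Proof.
split; last by apply: emb_inj; rewrite !embg mulr1 mulr0.
apply: continuous_subspaceT; apply: continuous_comp_initial.
rewrite (_ : _ \o _ = G \o (fun t => T * t)); last by apply/funext => t; exact: embg.
move=> t; apply: continuous_comp; first exact: mulrl_continuous.
exact: (regular_continuous (tour_regular tG)).
Qed.

Let piece (x y : R) := exists2 h, nice s h & forall t, x <= t <= y -> G (T * t) = h (T * t).

Let piecewise_nice : piecewise piece.
Proof.
apply: piecewise_local => t t01.
have [h [h' [e [[e0 nh nh' Gh Gh'] _]]]] := tour_regular tG (T * t).
exists (e / T); first by rewrite divr_gt0.
have Te : T * (e / T) = e by rewrite mulrCA divff ?mulr1// gt_eqF.
split=> x /andP[x1 x2].
  exists h => // y /andP[xy yt]; apply: Gh; rewrite ler_pM2l// yt andbT.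
  rewrite -Te -mulrBr ler_pM2l//; lra.
exists h' => // y /andP[xy yt]; apply: Gh'; rewrite ler_pM2l// xy /=.
by rewrite -[X in _ <= _ + X]Te -mulrDr ler_pM2l//; lra.
Qed.

Let scaled_smooth (h : R -> V) (c : R) : unit_smooth h -> smooth_fun (fun t => h (T * t + c)).
Proof. by move=> [sh _]; apply: smooth_row => i; exact: (@smooth_affine _ _ _ _ (sh i)). Qed.

Let scaled_derive (h : R -> V) (c t : R) : unit_smooth h ->
  enorm (derive1 (fun t => h (T * t + c)) t) = T.
Proof.
move=> uh; rewrite derive1_affine; last by move=> y; exact: unit_smooth_derivable.
by rewrite enormZ (uh.2 _).2 mulr1 gtr0_norm.
Qed.

Let enorm_neq0 (x : V) : enorm x = T -> x != 0.
Proof.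
move=> xT; apply/eqP => x00; move: T_gt0; rewrite -xT x00 /enorm.
by rewrite -(scale0r (0 : V)) dotZl mul0r sqrtr0 ltxx.
Qed.

Lemma tour_smooth_arcs : piecewise (smooth_arc gamma).
Proof.
have [p [pp pP]] := piecewise_nice; exists p; split=> // i /pP[h nh Gh].
have uh := nice_unit_smooth nh.
exists (fun t => h (T * t + 0)); split; first exact: scaled_smooth.
by move=> t tt; rewrite embg Gh// addr0; split=> //; exact/enorm_neq0/scaled_derive.
Qed.

Lemma tour_geodesic : s = false -> geodesic_cycle gamma.
Proof.
move=> s0; split; first exact: tour_closed.
have [p [pp pP]] := piecewise_nice; exists p; split=> // i /pP[h].
rewrite s0 => -[u [w [uw ->]]] Gh.
have [u1 w1 uw0] := orthonormal_circ (T * nth 0 (0 :: p) i) uw.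
exists (circ u w (T * nth 0 (0 :: p) i)), (circ w (- u) (T * nth 0 (0 :: p) i)), T.
split=> // t tt; rewrite embg Gh// -[RHS]circ_shift; congr circ; ring.
Qed.

(** Inside each piece the curve has constant speed [T], so the integrand agrees with the continuous
    function [g] off the partition points; the chain rule then leads to the interval [0, T]. *)
Lemma tour_curve_integral (F : V -> R) (f : sphere R d -> R) : continuous F ->
  (forall x, f x = F (emb x)) -> curve_integral gamma f = oint (F \o G) 0 T.
Proof.
move=> cF fF.
have cFG : continuous (F \o G).
  move=> t; apply: continuous_comp; last exact: cF.
  exact: (regular_continuous (tour_regular tG)).
have [H dH] := ex_antiderivative cFG.
pose g t := F (G (T * t)) * T.
have cg : continuous g.
  move=> t; apply: cvgM; last exact: cvg_cst.
  apply: (@continuous_comp _ _ _ (fun t => T * t) (F \o G)); last exact: cFG.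
  exact: mulrl_continuous.
have [p [[pp /eqP p1] pP]] := piecewise_nice.
rewrite /curve_integral (@Rintegral_cofinite _ _ g [set` 0 :: p])//.
- rewrite oint_Rintegral// (ointE _ _ dH).
  have dHT (x : R) : is_derive x 1 (H \o (fun x => T * x)) (g x).
    apply: is_derive1_comp => //.
    by rewrite -[X in is_derive _ _ _ X]mulr1; exact: (@is_deriveZ _ _ _ id).
  by rewrite (ointE _ _ dHT) /= mulr1 mulr0.
- exact: finite_seq.
- move=> t /= tp /andP[t0 t1]; rewrite fF embg; congr (_ * _).
  move: tp; rewrite inE => /negP; rewrite negb_or => /andP[tn0 tp].
  have t0' : 0 < t by rewrite lt_def tn0.
  have t1' : t < last 0 p.
    rewrite p1 lt_neqAle t1 andbT; apply/eqP => t1E.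
    move: tp; rewrite t1E -p1; case: (p) p1 => [|b q] /=.
      by move=> /eqP; rewrite eq_sym oner_eq0.
    by rewrite mem_last.
  have [x [y [[h nh Gh] /andP[xt ty]]]] := piece_of pp pP t0' t1' tp.
  have uh := nice_unit_smooth nh.
  rewrite -[RHS](@scaled_derive h 0 t uh) !derive1E; congr enorm.
  apply: near_eq_derive; near=> z; rewrite /= embg Gh ?addr0//.
  apply/andP; split; apply: ltW; near: z; [exact: lt_nbhsr|exact: lt_nbhsl].
Unshelve. all: by end_near. Qed.

(** The periodic extension is smooth at the integers because both ends of the tour run along the
    circle through [x0], so that near an integer it is a rotation of [x0]. Elsewhere it coincides
    locally with one smooth arc of the regular curve. *)
Lemma tour_smooth_closed : s = true -> smooth_closed_curve gamma.
Proof.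
move=> s1; pose g (t : R) := G (T * (t - (Num.floor t)%:~R)).
have fl (y : R) (m : int) : m%:~R <= y -> y < m%:~R + 1 -> Num.floor y = m.
  by move=> my ym; apply: floor_def; rewrite my /= intrD.
have loc (t : R) : exists2 h, unit_smooth h & exists c, \near t, h (T * t + c) = g t.
  pose n := Num.floor t; have tn : t < n%:~R + 1 by have := floorD1_gt t; rewrite intrD.
  have nt : n%:~R <= t by exact: floor_le_tmp.
  have [tE|tn'] := eqVneq t n%:~R.
    have [eta /andP[e0 eT] [H1 H2]] := tour_ends tG.
    exists (circ x0 (J x0)); first exact: (circ_unit_smooth (orthonormal_J JJ dotJJ x01)).
    exists (- (T * n%:~R)); have eT0 : 0 < eta / T by rewrite divr_gt0.
    have eT1 : T * (eta / T) = eta by rewrite mulrCA divff ?mulr1// gt_eqF.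
    near=> y.
    have y1 : n%:~R - 1 < y by near: y; apply: lt_nbhsr; lra.
    have y2 : y < n%:~R + 1 by near: y; apply: lt_nbhsl; lra.
    have y3 : n%:~R - eta / T < y by near: y; apply: lt_nbhsr; lra.
    have y4 : y < n%:~R + eta / T by near: y; apply: lt_nbhsl; lra.
    rewrite -rotE -mulrBr /g; have [ny|yn] := leP n%:~R y.
      rewrite (fl _ n)// H1// -[leRHS]eT1 ler_pM2l//; lra.
    rewrite (fl _ (n - 1)) ?intrB; [|lra..].
    rewrite H2; first by congr (rot J _ x0); ring.
    rewrite -[X in _ - X]eT1 -[X in X - _]mulr1 -mulrBr ler_pM2l//; lra.
  have [h [h' [e [[e0 nh nh' Gh Gh'] hh']]]] := tour_regular tG (T * (t - n%:~R)).
  exists h; first exact: nice_unit_smooth nh.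
  exists (- (T * n%:~R)); have eT0 : 0 < e / T by rewrite divr_gt0.
  have eT1 : T * (e / T) = e by rewrite mulrCA divff ?mulr1// gt_eqF.
  near=> y.
  have y1 : n%:~R < y by near: y; apply: lt_nbhsr; rewrite lt_def tn'.
  have y2 : y < n%:~R + 1 by near: y; apply: lt_nbhsl; lra.
  have y3 : t - e / T < y by near: y; apply: lt_nbhsr; lra.
  have y4 : y < t + e / T by near: y; apply: lt_nbhsl; lra.
  rewrite /g (fl _ n) ?ltW// -mulrBr; have [ty|yt] := leP y t.
    rewrite Gh// -[X in _ - X <= _]eT1 -mulrBr !ler_pM2l//; lra.
  rewrite Gh' ?hh'// -[X in _ <= _ + X]eT1 -mulrDr !ler_pM2l//; lra.
exists g; split.
- apply: smooth_row => i; apply: smooth_local => t.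
  have [h uh [c gh]] := loc t.
  exists (fun t => h (T * t + c) 0 i); first exact: (@smooth_affine _ _ _ _ (uh.1 i)).
  by apply: filterS gh => y ->.
- move=> t; rewrite /g; congr (G (T * _)).
  rewrite (fl (t + 1) (Num.floor t + 1)) ?intrD; first ring.
    by rewrite lerD2r; exact: floor_le_tmp.
  by rewrite ltrD2r; have := floorD1_gt t; rewrite intrD.
- move=> t; have [h uh [c gh]] := loc t; apply: enorm_neq0.
  rewrite derive1E -(near_eq_derive _ gh) -derive1E; exact: scaled_derive.
- move=> t /andP[t0]; rewrite le_eqVlt => /predU1P[->|t1].
    by rewrite embg /g floor1 subrr mulr0 mulr1 GT.
  by rewrite embg /g (fl t 0) ?subr0// add0r.
Unshelve. all: by end_near. Qed.

End closing_up.

(** * Growing the spanning tree *)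

Section growing_tree.
Variables (R : realType) (d : nat).
Local Notation V := 'rV[R]_d.+1.
Variable J : {linear V -> V}.
Hypothesis JJ : forall x, J (J x) = - x.
Hypothesis dotJJ : forall x y, dot (J x) (J y) = dot x y.

(** A rotation of the base point shifts the interval of integration; the part beyond 2 pi is moved
    back by periodicity. *)
Lemma fint_rot (F : V -> R) th x : continuous F -> dot x x = 1 ->
  fint J F (rot J th x) = fint J F x.
Proof.
move=> cF x1; rewrite /fint.
have cQ y : dot y y = 1 -> continuous (fun t => F (rot J t y)).
  move=> y1 t; apply: continuous_comp; last exact: cF.
  exact: (regular_continuous (regular_nice (nice_circ false (orthonormal_J JJ dotJJ y1)))).
pose Q t := F (rot J t x).
have cQx : continuous Q by exact: cQ.
have shift (z b c : R) : b <= c -> oint Q (b + z) (c + z) = oint (fun t => F (rot J t (rot J z x))) b c.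
  move=> bc; apply/esym/oint_shift => //; first by apply: cQ; rewrite dot_rot.
  by move=> t _; rewrite rot_rot.
have p0 := pi_gt0 R.
have [n] := ex_angle_mod th; set z := th - _ => z02.
have rz y : rot J th y = rot J z y.
  by rewrite /z -[RHS](rot_rot JJ) -mulrN -intrN rot_int.
rewrite rz -shift; last lra.
rewrite add0r -(oint_add Q z (2 * pi)) -[RHS](oint_add Q 0 z) addrC; congr (_ + _).
rewrite [2 * pi + z]addrC -[X in oint Q X _]add0r.
apply/esym; apply: oint_shift => //; first lra.
move=> t _; rewrite /Q -(rot_rot JJ); congr (F (rot J t _)).
by have := rot_int J x 1; rewrite mulr1.
Qed.

Variables (s : bool) (alpha0 k a r : R).
Hypotheses (alpha0_gt0 : 0 < alpha0) (k_ge0 : 0 <= k) (a_ge0 : 0 <= a).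
Let alpha := alpha0 + k.
Hypotheses (alpha_lt : alpha < 2 * pi) (a_lt : 2 * a < alpha).
Hypotheses (r_gt0 : 0 < r) (a_le : a <= r) (k_le : 4 * k <= r) (r_le : r <= alpha).

Local Ltac slra := move: alpha0_gt0 k_ge0 a_ge0 alpha_lt a_lt r_gt0 a_le k_le
  r_le; lra.

Let rotN th (z y : V) : rot J th z = y -> z = rot J (- th) y.
Proof. by move=> <-; rewrite rot_rot// addNr rot0. Qed.

(* Choice of the phase at which a new strip is attached. *)
Lemma ex_phase (x0 p v : V) (l : R) (es : seq (V * V * R)) (end_ : pred (V * V * R)) :
  dot x0 x0 = 1 -> horizontal J p v -> l <= pi / 2 ->
  (forall E, E \in es -> horizontal J E.1.1 E.1.2 /\ E.2 <= pi / 2) ->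
  (forall E, E \in es -> ~~ end_ E ->
    forall t, E.1.1 <> rot J t p /\ circ E.1.1 E.1.2 E.2 <> rot J t p) ->
  (forall E, E \in es -> end_ E ->
    (forall t, E.1.1 <> rot J t p) \/ (forall t, circ E.1.1 E.1.2 E.2 <> rot J t p)) ->
  alpha + 2 * alpha * (count end_ es)%:R + 6 * a * (size es)%:R < 2 * pi ->
  exists c, free_arc J alpha0 k x0 es (rot J c p) /\
    forall E z, E \in es -> in_strip J alpha0 k a E z ->
      ~ in_strip J alpha0 k a (rot J c p, rot J c v, l) z.
Proof.
move=> x01 pv lp hes off one small.
have [p1 _ _ _] := pv.
(* Phases of the obstacles on the circle of [p]: the base point, an end of an older edge, the
   overlap with an older strip. If an obstacle is absent, the default 0 merely forbids one more arc,
   which the count already includes. *)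
pose th0 := xget 0 [set t | x0 = rot J t p].
pose th1 E := xget 0 [set t : R | E.1.1 = rot J t p \/ circ E.1.1 E.1.2 E.2 = rot J t p].
pose ph (E : V * V * R) := xget 0 [set t : R | exists x y : R, [/\ 0 < x < l, 0 < y < E.2 &
  rot J t (circ p v x) = circ E.1.1 E.1.2 y]].
(* Half-width alpha / 2 keeps the new arc off the point [x0]; half-width alpha keeps it off an older
   removed arc, both being of half-width alpha / 2. Bands of two strips can meet only if the phase,
   counted from [ph E], is within [a] of 0 (same side) or of alpha - a or its negative (opposite
   sides): three intervals per strip. *)
pose B := (th0, alpha / 2) :: [seq (th1 E, alpha) | E <- es & end_ E] ++
  flatten [seq [:: (ph E, a); (ph E + (alpha - a), a); (ph E - (alpha - a), a)] | E <- es].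
have a0 : 0 < alpha by rewrite /alpha; slra.
have [||c cP] := @avoid_arcs _ B.
- move=> K; rewrite inE mem_cat => /predU1P[->/=|/orP[/mapP[E _ ->]|/flatten_mapP[E _]]].
  + by rewrite divr_ge0 ?ltW.
  + exact: ltW.
  + by rewrite !inE => /orP[/eqP->|/orP[/eqP->|/eqP->]].
- apply: le_lt_trans small; rewrite /B big_cons big_cat /= big_map big_filter big_flatten /= big_map.
  rewrite -[leRHS]addrA (_ : 2 * (alpha / 2) = alpha); last by field.
  rewrite lerD2l lerD//.
    by rewrite big_const_seq iter_addr addr0 mulr_natr.
  under eq_bigr do rewrite !big_cons big_nil /=.
  rewrite big_const_seq iter_addr addr0 count_predT -mulr_natr.
  by rewrite le_eqVlt; apply/orP; left; apply/eqP; ring.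
exists c; split.
- move=> t ta; rewrite rot_rot//; split=> [e0|E Ees [t' t'a]].
    have thE : x0 = rot J th0 p.
      by have := @xgetI _ 0 [set t | x0 = rot J t p] (t + c) (esym e0).
    have := cP (th0, alpha / 2) (- t); rewrite inE eqxx normrN => /(_ isT ta); apply.
    have := rot_inj JJ dotJJ p1 (etrans e0 thE).
    by congr (cos _ = 1); rewrite /=; ring.
  have [eE|neE] := boolP (end_ E); last first.
    have [off1 off2] := off _ Ees neE (- t' + (t + c)).
    by rewrite -(rot_rot JJ (- t')) in off1 off2; case=> /esym/rotN.
  move=> H; have {H} [P HP PE] : exists2 P, P = E.1.1 \/ P = circ E.1.1 E.1.2 E.2 &
      rot J (t + c) p = rot J t' P.
    by case: H => H; eexists; [left| |right|]; first [reflexivity|exact: H].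
  have PE' : P = rot J (- t' + (t + c)) p.
    by rewrite -(rot_rot JJ (- t')); exact/rotN/esym.
  have thE : P = rot J (th1 E) p.
    have : [set t : R | E.1.1 = rot J t p \/ circ E.1.1 E.1.2 E.2 = rot J t p] (th1 E).
      apply: (@xgetI _ 0 _ (- t' + (t + c))) => /=.
      by case: HP => <-; [left|right].
    case: (one _ Ees eE) => ne /=; case: HP => HP; rewrite HP in PE' *.
    + by have := ne _ PE'.
    + by case=> // /ne.
    + by case=> // /ne.
    + by have := ne _ PE'.
  have := cP (th1 E, alpha) (t' - t).
  rewrite inE mem_cat map_f ?orbT ?mem_filter ?eE// => /(_ isT).
  have ta2 : `|t' - t| <= alpha by move: ta t'a; rewrite !ler_norml /alpha; lra.
  move=> /(_ ta2); apply.
  move: PE; rewrite thE rot_rot// => /(rot_inj JJ dotJJ p1).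
  by congr (cos _ = 1); rewrite /=; ring.
- move=> E z Ees [t' [y [yE t'a ->]]] [t [x [/= xl ta]]].
  have [hE lE] := hes _ Ees.
  rewrite /strip -rot_circ rot_rot// => e1.
  have {}e1 : rot J (- t' + (t + c)) (circ p v x) = circ E.1.1 E.1.2 y.
    by rewrite -(rot_rot JJ (- t')) -e1 rot_rot// addNr rot0.
  have [x' [y' [xl' yE' e2]]] : [set t : R | exists x y : R, [/\ 0 < x < l, 0 < y < E.2 &
      rot J t (circ p v x) = circ E.1.1 E.1.2 y]] (ph E).
    by apply: (@xgetI _ 0 _ (- t' + (t + c))); exists x, y.
  have cE := strip_phase JJ dotJJ pv hE _ _ _ _ e1 e2.
  have {}cE : cos (- t' + (t + c) - ph E) = 1 by apply: cE; lra.
  have inB K : K \in [:: (ph E, a); (ph E + (alpha - a), a); (ph E - (alpha - a), a)] -> K \in B.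
    by move=> KE; rewrite inE mem_cat; apply/orP; right; apply/orP; right;
      apply/flatten_mapP; exists E.
  have away w : `|t' - t - w| <= a -> (ph E + w, a) \in B -> False.
    move=> wa wB; apply: (cP _ (t' - t - w) wB wa).
    by rewrite -cE; congr cos; rewrite /=; ring.
  have [H|[H|H]] : `|t' - t - 0| <= a \/ `|t' - t - (alpha - a)| <= a \/
      `|t' - t - - (alpha - a)| <= a.
    move: ta t'a; rewrite -/alpha => ta t'a.
    have [t0|t0] := leP 0 t; have [t0'|t0'] := leP 0 t'; move: ta t'a;
      rewrite ?(ger0_norm t0) ?(ltr0_norm t0) ?(ger0_norm t0') ?(ltr0_norm t0') => ta t'a.
    + by left; rewrite ler_norml; lra.
    + by right; right; rewrite ler_norml; lra.
    + by right; left; rewrite ler_norml; lra.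
    + by left; rewrite ler_norml; lra.
  + by apply: away H _; rewrite addr0 inB// inE eqxx.
  + by apply: away H _; rewrite inB// !inE eqxx orbT.
  + by apply: away H _; rewrite inB// !inE eqxx !orbT.
Qed.

Let sub_in_count (U : eqType) (a1 a2 : pred U) (q : seq U) :
  {in q, forall x, a1 x -> a2 x} -> (count a1 q <= count a2 q)%N.
Proof.
move=> H; rewrite (eq_in_count (a2 := predI a1 a2)).
  by apply: sub_count => x /= /andP[].
by move=> x xq /=; case: (boolP (a1 x)) => // /(H _ xq) ->.
Qed.

Section grow.
Variables (I : finType) (rep : I -> V) (Tr : rel I) (pp vv : I -> I -> V).
Variables (w : I -> I -> R) (root : I).
Hypothesis rep1 : forall i, dot (rep i) (rep i) = 1.
Hypothesis rep_neq : forall i j t, rep i = rot J t (rep j) -> i = j.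
Hypothesis Tsym : symmetric Tr.
Hypothesis Tirr : irreflexive Tr.
Hypothesis Tconn : forall x y, connect Tr x y.
Hypothesis Tacyclic : forall q, (2 < size q)%N -> ~~ ucycleb Tr q.
Hypothesis wC : forall i j, w i j = w j i.
Hypothesis lift : forall i j, Tr i j -> [/\ horizontal J (pp i j) (vv i j),
  r <= w i j <= pi / 2, exists t, pp i j = rot J t (rep i),
  exists t, circ (pp i j) (vv i j) (w i j) = rot J t (rep j) &
  forall x m t, 0 < x < w i j -> circ (pp i j) (vv i j) x <> rot J t (rep m)].
Hypothesis prof : forall i j, Tr i j -> exists u w',
  profile a (w i j + k) (w i j) u w' /\ regular_profile J s u w'.
Hypothesis small : alpha + 2 * alpha * (max_degree Tr).-1%:R + 6 * a * #|I|%:R < 2 * pi.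
Implicit Types (ed : seq (I * I * R)) (e : I * I * R).

(** An edge is stored as parent, child and phase, the phase being the angle by which the chosen lift
    from parent to child is rotated. Hence [visited] lists the children, newest first, and finally
    the root. *)
Definition strip_of e : V * V * R :=
  (rot J e.2 (pp e.1.1 e.1.2), rot J e.2 (vv e.1.1 e.1.2), w e.1.1 e.1.2).

Definition far_end (E : V * V * R) : V := circ E.1.1 E.1.2 E.2.

Definition visited ed : seq I := [seq e.1.2 | e <- ed] ++ [:: root].

Definition fibres ed : seq V := [seq far_end (strip_of e) | e <- ed] ++ [:: rep root].

Definition incident y e : bool := (e.1.1 == y) || (e.1.2 == y).

Definition inner (vs : seq I) : rel I := [rel x y | [&& Tr x y, x \in vs & y \in vs]].

(** [grown_count] bounds the edges attached at [y] so that an unvisited neighbour still finds room;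
    [grown_conn] serves to exclude a second edge to a new vertex; [grown_weight] runs over ordered
    pairs and becomes [W_] once all vertices are visited. *)
Record grown ed : Prop := Grown {
  grown_uniq : uniq (visited ed);
  grown_edges : forall e, e \in ed -> Tr e.1.1 e.1.2 /\ e.1.1 \in visited ed;
  grown_conn : forall x y, x \in visited ed -> y \in visited ed ->
    connect (inner (visited ed)) x y;
  grown_count : forall y, y \in visited ed ->
    (count (incident y) ed <= #|[pred x | (x \in visited ed) && Tr y x]|)%N;
  grown_weight : \sum_(e <- ed) 2 * w e.1.1 e.1.2 =
    \sum_(x <- visited ed) \sum_(y <- visited ed | Tr x y) w x y;
  grown_tour : exists G T, tour J s alpha0 k a r (rep root) (fibres ed)
    [seq strip_of e | e <- ed] G T
}.

Lemma grown_init : grown [::].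
Proof.
split=> //.
- by move=> x y; rewrite !inE => /eqP-> /eqP->.
- by rewrite big_nil !big_cons !big_nil Tirr addr0.
- by exists (fun t => rot J t (rep root)), (2 * pi); apply: tour_init.
Qed.

Let child_visited e ed : e \in ed -> e.1.2 \in visited ed.
Proof. by move=> eed; rewrite mem_cat; apply/orP; left; apply/mapP; exists e. Qed.

Lemma fibres_visited ed x : (forall e, e \in ed -> Tr e.1.1 e.1.2) ->
  x \in fibres ed -> exists2 y, y \in visited ed & exists t, x = rot J t (rep y).
Proof.
move=> Ted; rewrite mem_cat => /orP[/mapP[e eed ->]|]; last first.
  rewrite inE => /eqP ->; exists root; first by rewrite mem_cat inE eqxx orbT.
  by exists 0; rewrite rot0.
have [_ _ _ [t qE] _] := lift (Ted _ eed).
exists e.1.2; first exact: child_visited.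
by exists (e.2 + t); rewrite /far_end /= -rot_circ qE rot_rot.
Qed.

Lemma visited_fibres ed y : (forall e, e \in ed -> Tr e.1.1 e.1.2) ->
  y \in visited ed -> exists2 x, x \in fibres ed & exists t, rep y = rot J t x.
Proof.
move=> Ted; rewrite mem_cat => /orP[/mapP[e eed ->]|]; last first.
  rewrite inE => /eqP ->; exists (rep root); first by rewrite mem_cat inE eqxx orbT.
  by exists 0; rewrite rot0.
have [_ _ _ [t qE] _] := lift (Ted _ eed).
exists (far_end (strip_of e)).
  by rewrite mem_cat; apply/orP; left; apply/mapP; exists e.
exists (- (e.2 + t)); rewrite /far_end /= -rot_circ qE [rot J e.2 _]rot_rot//.
by rewrite rot_rot// addNr rot0.
Qed.

Lemma fint_fibres ed F : (forall e, e \in ed -> Tr e.1.1 e.1.2) -> continuous F ->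
  \sum_(x <- fibres ed) fint J F x = \sum_(y <- visited ed) fint J F (rep y).
Proof.
move=> Ted cF; rewrite !big_cat !big_seq1 !big_map; congr (_ + _).
apply: eq_big_seq => e eed; have [_ _ _ [t qE] _] := lift (Ted _ eed).
by rewrite /far_end /= -rot_circ qE rot_rot// (fint_rot _ cF).
Qed.

(* A second edge to the visited part of the tree would close a cycle. *)
Lemma unique_neighbour ed y y' z : grown ed -> y \in visited ed ->
  y' \in visited ed -> z \notin visited ed -> Tr y z -> Tr y' z -> y = y'.
Proof.
move=> ged yv y'v zv yz y'z; apply/eqP/negP => /negP yy'.
have /connectP[q0 pq0 lq0] := grown_conn ged yv y'v.
case: (shortenP pq0) lq0 => q pq uq _ lq.
have qv : all (mem (visited ed)) (y :: q).
  rewrite /= yv /=; elim: q (y) pq {uq lq} => //= b q IH c /andP[/and3P[_ _ bv] /IH ->].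
  by rewrite andbT.
have := @Tacyclic (z :: y :: q); rewrite /ucycleb /=.
have -> : (z \notin y :: q).
  by apply: contra zv => /(allP qv).
have sq : (2 < (size q).+2)%N.
  by case: (q) lq => // /eqP; rewrite eq_sym (negPf yy').
move: uq => /= /andP[-> ->]; rewrite !andbT => /(_ sq)/negP; apply.
rewrite Tsym yz /= rcons_path -lq y'z andbT.
by apply: sub_path pq => b c /and3P[].
Qed.

Lemma card_neighbours ed y z : z \notin visited ed ->
  #|[pred x | (x \in z :: visited ed) && Tr y x]| =
  (Tr y z + #|[pred x | (x \in visited ed) && Tr y x]|)%N.
Proof.
move=> zv; rewrite (cardD1 z) !inE eqxx /=; congr (_ + _)%N.
apply: eq_card => x; rewrite !inE; case: eqP => [->|_] //=.
by rewrite (negPf zv).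
Qed.

(** A path from the root to an unvisited vertex leaves the visited set along some edge of the tree;
    this edge is attached. *)
Lemma grow_step ed : grown ed -> (size (visited ed) < #|I|)%N ->
  exists e, grown (e :: ed).
Proof.
move=> ged small_ed.
have Ted e : e \in ed -> Tr e.1.1 e.1.2 by move=> /(grown_edges ged)[].
have [y [z [yv zv yz]]] : exists y z, [/\ y \in visited ed, z \notin visited ed & Tr y z].
  have [z0 z0v] : exists z0, z0 \notin visited ed.
    apply/existsP; rewrite -negb_forall; apply: contraTN small_ed => /forallP H.
    rewrite -leqNgt cardE uniq_leq_size ?enum_uniq// => x _; exact: H.
  have rv : root \in visited ed by rewrite mem_cat inE eqxx orbT.
  have /connectP[q pq lq] := Tconn root z0.
  elim: q root rv pq lq => [|b q IH] c cv /=.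
    by move=> _ e0; rewrite e0 cv in z0v.
  move=> /andP[cb pq] lq; have [bv|bv] := boolP (b \in visited ed).
    exact: IH bv pq lq.
  by exists c, b.
have [hpv /andP[rw wp] [tp pE] [tq qE] inner_off] := lift yz.
set p := pp y z in hpv pE qE inner_off; set v := vv y z in hpv qE inner_off.
set l := w y z in rw wp qE inner_off.
have [G [T tGT]] := grown_tour ged.
pose end_ (E : V * V * R) := `[< (exists t, E.1.1 = rot J t p) \/
  (exists t, far_end E = rot J t p) >].
have end1 e : e \in ed -> (exists t, (strip_of e).1.1 = rot J t p) -> e.1.1 = y.
  move=> /Ted/lift[_ _ [t1 pE1] _ _] [t]; rewrite /= pE1 pE !rot_rot// => /(rotN).
  by rewrite rot_rot// => /rep_neq.
have end2 e : e \in ed -> (exists t, far_end (strip_of e) = rot J t p) -> e.1.2 = y.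
  move=> /Ted/lift[_ _ _ [t1 qE1] _] [t].
  rewrite /far_end /= -rot_circ qE1 pE !rot_rot// => /(rotN).
  by rewrite rot_rot// => /rep_neq.
(* The neighbour [z] of [y] is unvisited, so the visited neighbours number at most N_Y - 1. *)
have cnt : (count (incident y) ed <= (max_degree Tr).-1)%N.
  apply: leq_trans (grown_count ged yv) _.
  have : (#|[pred x | Tr y x]| <= max_degree Tr)%N.
    exact: (@leq_bigmax _ (fun x => #|[pred y | Tr x y]|)).
  rewrite (cardD1 z) inE yz add1n => H.
  rewrite -ltnS (leq_trans _ (leqSpred _)) // (leq_ltn_trans _ H)//.
  apply: subset_leq_card; apply/fintype.subsetP => x; rewrite !inE => /andP[xv ->].
  by rewrite andbT; apply: contraNneq zv => <-.
have [||||c [cfree cstrips]] := @ex_phase (rep root) p v l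
    [seq strip_of e | e <- ed] end_ (rep1 root) hpv wp.
- move=> E /mapP[e eed ->]; have [h /andP[_ ?] _ _ _] := lift (Ted _ eed).
  by split=> //; exact: horizontal_rot.
- move=> E _ /asboolPn nE t; split=> H; apply: nE; [left|right]; by exists t.
- move=> E /mapP[e eed ->] _.
  have [H|H] := pselect (exists t, (strip_of e).1.1 = rot J t p); last first.
    by left=> t H'; apply: H; exists t.
  right=> t H'; have e1 := end1 _ eed H.
  have e2 : e.1.2 = y by apply: end2 => //; exists t.
  by have := Ted _ eed; rewrite e1 e2 Tirr.
- apply: le_lt_trans small; rewrite size_map lerD//.
    rewrite lerD2l ler_wpM2l ?mulr_ge0//; first by rewrite /alpha; slra.
    rewrite ler_nat (leq_trans _ cnt)// count_map.
    apply: sub_in_count => e eed /= /asboolP[H|H]; rewrite /incident.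
      by rewrite (end1 _ eed H) eqxx.
    by rewrite (end2 _ eed H) eqxx orbT.
  rewrite ler_wpM2l ?mulr_ge0// ler_nat ltnW//.
  by move: small_ed; rewrite size_cat size_map addn1 => /ltnW.
have [u [w' [uw ruw]]] := prof yz.
pose e0 : I * I * R := (y, z, c).
have vE : visited (e0 :: ed) = z :: visited ed by [].
have Ted0 e : e \in e0 :: ed -> Tr e.1.1 e.1.2.
  by rewrite inE => /predU1P[->|/Ted].
have offz x t : x \in fibres ed -> rot J t (rep z) <> x.
  move=> /(fibres_visited Ted)[x' x'v [t' ->]] /rotN; rewrite rot_rot// => /rep_neq zx'.
  by rewrite zx' x'v in zv.
have [||||||G' [T' tG']] := @tour_attach _ _ J JJ dotJJ s alpha0 k a r (rep root)
    alpha0_gt0 k_ge0 a_ge0 alpha_lt a_lt r_gt0 a_le k_le r_le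
    (fibres ed) [seq strip_of e | e <- ed] G T (rot J c p) (rot J c v) l u w' tGT
    (horizontal_rot JJ dotJJ c hpv) rw wp uw ruw.
- have [x xf [t yE]] := visited_fibres Ted yv; exists x => //.
  by exists (c + (tp + t)); rewrite pE yE !rot_rot// addrA.
- exact: cfree.
- move=> x t xf; rewrite -rot_circ qE rot_rot// => /esym/rotN; rewrite rot_rot//.
  by move=> /esym; exact: offz.
- move=> x th t /(fibres_visited Ted)[x' _ [t' ->]] tl.
  rewrite -rot_circ rot_rot// => /rotN; rewrite rot_rot//; exact: inner_off.
- move=> E th t /mapP[e eed ->] /= tw; rewrite -!rot_circ qE !rot_rot// => /rotN.
  rewrite rot_rot//; have [_ _ _ _ H] := lift (Ted _ eed); exact: H.
- by move=> E z' Ees; exact: cstrips.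
exists e0; split.
- by rewrite vE /= zv (grown_uniq ged).
- move=> e ee; split; first exact: Ted0.
  rewrite vE inE; move: ee; rewrite inE => /predU1P[->|/(grown_edges ged)[_ ->]].
    by rewrite /= yv orbT.
  by rewrite orbT.
- rewrite vE.
  have sub x x' : x \in visited ed -> x' \in visited ed ->
      connect (inner (z :: visited ed)) x x'.
    move=> xv x'v; apply: connect_sub (grown_conn ged xv x'v) => b b' /and3P[Tb bv b'v].
    by apply: connect1; rewrite /inner /= Tb !inE bv b'v !orbT.
  have zy : connect (inner (z :: visited ed)) z y.
    by apply: connect1; rewrite /inner /= Tsym yz !inE eqxx yv orbT.
  have yz' : connect (inner (z :: visited ed)) y z.
    by apply: connect1; rewrite /inner /= yz !inE eqxx yv orbT.
  move=> x x'; rewrite !inE => /predU1P[->|xv] /predU1P[->|x'v].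
  + exact: connect0.
  + exact: connect_trans zy (sub _ _ yv x'v).
  + exact: connect_trans (sub _ _ xv yv) yz'.
  + exact: sub.
- move=> b; rewrite vE card_neighbours// inE => bv.
  rewrite /= {1}/incident /=; case: (eqVneq b z) bv => [->|bz] /= bv.
    have -> : count (incident z) ed = 0%N.
      apply/eqP; rewrite -leqn0 leqNgt -has_count; apply/hasPn => e eed.
      rewrite /incident negb_or; apply/andP; split; apply: contra zv => /eqP <-.
        by have [] := grown_edges ged eed.
      exact: child_visited.
    rewrite Tirr orbT addn0 add0n; apply/card_gt0P; exists y.
    by rewrite inE yv Tsym yz.
  rewrite orbF.
  case: eqVneq => [<-|yb]; first by rewrite yz leq_add2l (grown_count ged).
  by rewrite add0n (leq_trans (grown_count ged bv))// leq_addl.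
- rewrite vE !big_cons (grown_weight ged) /= Tirr.
  have zsum : \sum_(x <- visited ed | Tr z x) w z x = w y z.
    rewrite big_mkcond (bigD1_seq y) ?(grown_uniq ged)//= Tsym yz wC.
    rewrite big_seq_cond big1 ?addr0// => x /andP[xv xy]; case: ifP => // zx.
    rewrite (unique_neighbour ged xv yv zv _ yz) ?eqxx// in xy.
    by rewrite Tsym.
  rewrite zsum.
  have -> : \sum_(x <- visited ed) \sum_(x' <- z :: visited ed | Tr x x') w x x' =
      \sum_(x <- visited ed | Tr z x) w z x +
      \sum_(x <- visited ed) \sum_(x' <- visited ed | Tr x x') w x x'.
    rewrite [X in _ = X + _]big_mkcond -big_split; apply: eq_bigr => x _ /=.
    by rewrite big_cons Tsym; case: ifP => _; rewrite ?add0r// wC.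
  by rewrite zsum; ring.
- by exists G', T'.
Qed.

Lemma grow_all : exists2 ed, grown ed & perm_eq (visited ed) (enum I).
Proof.
have fin ed : grown ed -> ~~ (size (visited ed) < #|I|)%N ->
    perm_eq (visited ed) (enum I).
  rewrite -leqNgt => ged le; apply: uniq_perm; rewrite ?enum_uniq ?(grown_uniq ged)//.
  have [_ H] := uniq_min_size (grown_uniq ged) (s2 := enum I)
    (fun x _ => mem_enum I x) ltac:(by rewrite -cardE).
  exact: H.
suff H n : exists ed, grown ed /\ ((n <= size (visited ed))%N \/ perm_eq (visited ed) (enum I)).
  have [ed [ged [le|pe]]] := H #|I|; last by exists ed.
  by exists ed => //; apply: fin => //; rewrite -leqNgt.
elim: n => [|n [ed [ged H]]]; first by exists [::]; split; [exact: grown_init|left].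
have [small_ed|big_ed] := boolP (size (visited ed) < #|I|)%N; last first.
  by exists ed; split=> //; right; exact: fin.
have [e ge] := grow_step ged small_ed; exists (e :: ed); split=> //; left.
case: H => [|pe]; first by rewrite /= ltnS.
by move: small_ed; rewrite (perm_size pe) -cardE ltnn.
Qed.

End grow.

End growing_tree.

(** * Uniform equicontinuity of polynomials on great circles *)

Lemma continuous_sumr (R : realType) (T : topologicalType) (I : Type) (s : seq I)
    (P : pred I) (F : I -> T -> R) :
  (forall i, P i -> continuous (F i)) ->
  continuous (fun x => \sum_(i <- s | P i) F i x).
Proof. by apply: continuous_big => -[x y]; exact: add_continuous. Qed.

Lemma continuous_prodr (R : realType) (T : topologicalType) (I : Type) (s : seq I)
    (P : pred I) (F : I -> T -> R) :
  (forall i, P i -> continuous (F i)) ->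
  continuous (fun x => \prod_(i <- s | P i) F i x).
Proof. by apply: continuous_big => -[x y]; exact: mul_continuous. Qed.

Section trigonometric_polynomials.
Variable R : realType.
Implicit Types g h : R -> R.

(** Normal form of a trigonometric polynomial of degree at most [k]: the summand with [P] is its
    even part and the one with [Q] its odd part, so each is bounded by the sup norm of [g]. *)
Definition trig_poly (k : nat) g : Prop := exists P Q : {poly R},
  [/\ (size P <= k.+1)%N, (size Q <= k)%N &
      forall x, g x = P.[cos x] + sin x * Q.[cos x]].

Lemma trig_polyW k k' g : (k <= k')%N -> trig_poly k g -> trig_poly k' g.
Proof.
move=> kk' [P [Q [sP sQ gE]]]; exists P, Q; split=> //.
- exact: leq_trans sP _.
- exact: leq_trans sQ _.
Qed.

Lemma trig_poly_cst c : trig_poly 0 (fun=> c).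
Proof.
exists c%:P, 0; split=> [||x]; first exact: size_polyC_leq1.
  by rewrite size_poly0.
by rewrite hornerC horner0 mulr0 addr0.
Qed.

Lemma trig_poly_linear a b : trig_poly 1 (fun x => cos x * a + sin x * b).
Proof.
exists (a *: 'X), b%:P; split=> [||x].
- by apply: leq_trans (size_scale_leq _ _) _; rewrite size_polyX.
- exact: size_polyC_leq1.
- by rewrite hornerZ hornerX hornerC mulrC.
Qed.

Lemma trig_polyD k g h : trig_poly k g -> trig_poly k h ->
  trig_poly k (fun x => g x + h x).
Proof.
move=> [P [Q [sP sQ gE]]] [P' [Q' [sP' sQ' hE]]].
exists (P + P'), (Q + Q'); split=> [||x].
- by apply: leq_trans (size_polyD _ _) _; rewrite geq_max sP.
- by apply: leq_trans (size_polyD _ _) _; rewrite geq_max sQ.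
- by rewrite gE hE !hornerD; ring.
Qed.

Lemma trig_polyM k k' g h : trig_poly k g -> trig_poly k' h ->
  trig_poly (k + k') (fun x => g x * h x).
Proof.
move=> [P [Q [sP sQ gE]]] [P' [Q' [sP' sQ' hE]]].
have sM (A B : {poly R}) i j l : (size A <= i)%N -> (size B <= j)%N ->
    ((i + j).-1 <= l)%N -> (size (A * B)%R <= l)%N.
  by move=> sA sB; apply: leq_trans; apply: leq_trans (size_polyMleq _ _) _; lia.
(* The product of the two sine parts returns to the normal form by sin^2 = 1 - cos^2. *)
exists (P * P' + (1 - 'X ^+ 2) * (Q * Q')), (P * Q' + Q * P'); split=> [||x].
- apply: leq_trans (size_polyD _ _) _; rewrite geq_max.
  rewrite (sM _ _ _ _ _ sP sP') ?addSn ?addnS//=.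
  case: k sQ {gE sP} => [|k] sQ.
    by move: sQ; rewrite leqn0 size_poly_eq0 => /eqP->; rewrite mul0r mulr0 size_poly0.
  case: k' sQ' {hE sP'} => [|k'] sQ'.
    by move: sQ'; rewrite leqn0 size_poly_eq0 => /eqP->; rewrite !mulr0 size_poly0.
  apply: (sM _ _ 3 (k + k').+1); last by lia.
    rewrite -opprB size_polyN -[1]/(1%:P) size_XnsubC//.
  by apply: (sM _ _ _ _ _ sQ sQ'); lia.
- apply: leq_trans (size_polyD _ _) _; rewrite geq_max.
  by rewrite (sM _ _ _ _ _ sP sQ') ?(sM _ _ _ _ _ sQ sP')//; lia.
- rewrite gE hE !(hornerD, hornerM, hornerN, hornerXn, hornerC) -[1 - _](_ : sin x ^+ 2 = _).
    by ring.
  by rewrite sin2cos2 hornerX expr2.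
Qed.

Lemma trig_polyX k g i : trig_poly k g -> trig_poly (k * i) (fun x => g x ^+ i).
Proof.
move=> tg; elim: i => [|i IH]; first by rewrite muln0; exact: trig_poly_cst.
rewrite mulnS; under eq_fun do rewrite exprS; exact: trig_polyM.
Qed.

Lemma trig_poly_sum (I : Type) (s : seq I) (P : pred I) (g : I -> R -> R) k :
  (forall i, P i -> trig_poly k (g i)) ->
  trig_poly k (fun x => \sum_(i <- s | P i) g i x).
Proof.
move=> tg; elim: s => [|i s IH].
  under eq_fun do rewrite big_nil; apply: trig_polyW (trig_poly_cst _) => //.
under eq_fun do rewrite big_cons.
by case: (boolP (P i)) => [Pi|_]; [apply: trig_polyD (tg _ Pi) IH|exact: IH].
Qed.

Lemma trig_poly_prod (I : Type) (s : seq I) (g : I -> R -> R) (k : I -> nat) :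
  (forall i, trig_poly (k i) (g i)) ->
  trig_poly (\sum_(i <- s) k i)%N (fun x => \prod_(i <- s) g i x).
Proof.
move=> tg; elim: s => [|i s IH].
  rewrite big_nil (_ : (fun x => _) = fun=> 1); first exact: trig_poly_cst.
  by apply/funext => x; rewrite big_nil.
rewrite big_cons.
rewrite (_ : (fun x => _) = fun x => g i x * \prod_(j <- s) g j x).
  exact: trig_polyM.
by apply/funext => x; rewrite big_cons.
Qed.

(* Interpolating the coefficients of [cos]-parity and [sin]-parity at fixed
   nodes bounds the oscillation near 0 by the sup norm, uniformly in [g]. *)
Lemma trig_poly_equicontinuous k : exists2 e : R, 0 < e &
  forall g (M : R), trig_poly k g -> (forall x, `|g x| <= M) ->
  forall x, `|x| <= e -> `|g x - g 0| <= M / 3.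
Proof.
(* The [k + 1] nodes used lie strictly between 0 and 1, so the sine at the angle [acos (xi i)] is
   positive and a bound on the odd part yields one on the values of [Q]. *)
pose xi (i : nat) : R := i.+1%:R / k.+2%:R.
have k2 : 0 < k.+2%:R :> R by rewrite ltr0n.
have xi_inj : injective xi.
  move=> i j /(congr1 (fun y => y * k.+2%:R)); rewrite !divfK ?gt_eqF//.
  by move=> /eqP; rewrite eqr_nat => /eqP[].
have xi_gt0 i : 0 < xi i by rewrite divr_gt0.
have xi_lt1 (i : 'I_k.+1) : xi i < 1.
  by rewrite ltr_pdivrMr// mul1r ltr_nat ltnS ltn_ord.
have si_gt0 (i : 'I_k.+1) : 0 < sin (acos (xi i)).
  rewrite sin_acos; last by rewrite (le_trans _ (ltW (xi_gt0 i))) ?lerN10// ltW.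
  by rewrite sqrtr_gt0 subr_gt0 -[ltRHS](expr1n _ 2) ltrXn2r// ltW.
pose l (i : 'I_k.+1) : {poly R} := tnth (k.+1.-lagrange xi) i.
have lE (P : {poly R}) : (size P <= k.+1)%N -> P = \sum_(i < k.+1) P.[xi i]%:P * l i.
  exact: lagrange_gen.
(* A modulus of continuity at 0 that depends on [k] only: the interpolation formula gives |g x - g
   0| <= M K(x). *)
pose K (x : R) : R := \sum_i (`|(l i).[cos x] - (l i).[1]| +
  `|sin x| * (`|(l i).[cos x]| / sin (acos (xi i)))).
have lc i : continuous (fun x : R => (l i).[cos x]).
  by move=> x; apply: continuous_comp; [exact: continuous_cos|exact: continuous_horner].
have Kc : continuous K.
  apply: continuous_sumr => i _ x; apply: cvgD.
    by apply: cvg_norm; apply: cvgB; [exact: lc|exact: cvg_cst].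
  apply: cvgM; first by apply: cvg_norm; exact: continuous_sin.
  by apply: cvgM; [apply: cvg_norm; exact: lc|exact: cvg_cst].
have K0 : K 0 = 0.
  by rewrite /K big1// => i _; rewrite cos0 sin0 subrr normr0 mul0r addr0.
have [e /= e0 eK] : exists2 e : R, 0 < e & forall x, `|x| < e -> K x < 3^-1.
  have := Kc 0; rewrite /continuous_at K0 => /cvgrPdist_lt /(_ 3^-1).
  have -> : (0 < 3^-1 :> R) by rewrite invr_gt0.
  move=> /(_ isT) /nbhs_ballP[e /= e0 eK]; exists e => // x xe.
  have := eK x; rewrite /ball/= sub0r normrN => /(_ xe).
  by rewrite sub0r normrN => /(le_lt_trans (ler_norm _)).
exists (e / 2); first by rewrite divr_gt0.
move=> g M [P [Q [sP sQ gE]]] gM x xe.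
have M0 : 0 <= M by apply: le_trans (gM 0).
have PM y : `|P.[cos y]| <= M.
  have := gM y; have := gM (- y); rewrite !gE cosN sinN mulNr !ler_norml.
  by move=> /andP[? ?] /andP[? ?]; apply/andP; split; lra.
have QM y : `|sin y * Q.[cos y]| <= M.
  have := gM y; have := gM (- y); rewrite !gE cosN sinN mulNr !ler_norml.
  by move=> /andP[? ?] /andP[? ?]; apply/andP; split; lra.
have xi_acos (i : 'I_k.+1) : cos (acos (xi i)) = xi i.
  by apply: acosK; rewrite in_itv/= (le_trans _ (ltW (xi_gt0 i))) ?lerN10// ltW.
have gK : `|g x - g 0| <= M * K x.
  rewrite !gE sin0 mul0r addr0 cos0 {1 2}(lE P)// {1}(lE Q (leq_trans sQ (leqnSn _))).
  rewrite !horner_sum mulr_sumr addrAC -sumrB -big_split/= /K mulr_sumr.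
  apply: le_trans (ler_norm_sum _ _ _) _; apply: ler_sum => i _.
  rewrite !hornerM !hornerC -mulrBr [leRHS]mulrDr.
  apply: le_trans (ler_normD _ _) _; apply: lerD; rewrite !normrM.
    by apply: ler_wpM2r => //; rewrite -xi_acos.
  rewrite [leRHS]mulrCA; apply: ler_wpM2l => //.
  rewrite [leRHS]mulrCA [leLHS]mulrC.
  apply: ler_wpM2l => //; rewrite ler_pdivlMr// mulrC.
  by have := QM (acos (xi i)); rewrite normrM xi_acos (gtr0_norm (si_gt0 i)).
apply: le_trans gK _; apply: ler_wpM2l => //; apply: ltW; apply: eK.
by apply: le_lt_trans xe _; rewrite ltr_pdivrMr// ltr_pMr// ltr1n.
Qed.

End trigonometric_polynomials.

Section polynomial_functions.
Variables (R : realType) (d : nat).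
Local Notation V := 'rV[R]_d.+1.
Local Notation mpol := (mpoly.mpoly d.+1 R).

Definition peval (p : mpol) (v : V) : R := mpoly.meval (fun i => v 0 i) p.

Lemma pevalE p v : peval p v =
  \sum_(m <- mpoly.msupp p) mpoly.mcoeff m p * \prod_i v 0 i ^+ (m i).
Proof. exact: mpoly.mevalE. Qed.

Lemma peval_continuous p : continuous (peval p).
Proof.
rewrite (_ : peval p = fun v => \sum_(m <- mpoly.msupp p)
    mpoly.mcoeff m p * \prod_i v 0 i ^+ (m i)); last by apply/funext => v; exact: pevalE.
apply: continuous_sumr => m _ v.
apply: (@continuousM R V (fun=> mpoly.mcoeff m p) (fun v => \prod_i v 0 i ^+ m i)); first by apply: cst_continuous.
move: v; apply: continuous_prodr => i _ v.
apply: (@continuous_comp V R R (fun v : V => v 0 i) (fun y => y ^+ m i)).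
  exact: coord_continuous.
exact: exprn_continuous.
Qed.

Lemma coord_le1 (x : V) i : dot x x = 1 -> `|x 0 i| <= 1.
Proof.
move=> x1; rewrite -(expr_le1 (n := 2))// real_normK ?num_real// -x1 /dot.
by rewrite (bigD1 i)//= -expr2 lerDl sumr_ge0// => j _; rewrite -expr2 sqr_ge0.
Qed.

Lemma peval_bounded p x : dot x x = 1 ->
  `|peval p x| <= \sum_(m <- mpoly.msupp p) `|mpoly.mcoeff m p|.
Proof.
move=> x1; rewrite pevalE; apply: le_trans (ler_norm_sum _ _ _) _.
apply: ler_sum => m _; rewrite normrM ler_piMr// normr_prod.
apply: prodr_ile1 => i _; rewrite normr_ge0 normrX/=.
by rewrite exprn_ile1// coord_le1.
Qed.

(** Each coordinate of a great circle is linear in cos and sin, so a monomial of degree m becomes a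
    trigonometric polynomial of degree at most m. *)
Lemma trig_poly_peval p t x y : (mpoly.msize p <= t.+1)%N ->
  trig_poly t (fun th => peval p (circ x y th)).
Proof.
move=> pt.
rewrite (_ : (fun th => _) = fun th => \sum_(m <- mpoly.msupp p | (mpoly.mdeg m <= t)%N)
   mpoly.mcoeff m p * \prod_i (cos th * x 0 i + sin th * y 0 i) ^+ (m i)).
  apply: trig_poly_sum => m mt.
  apply: (@trig_polyW _ (0 + \sum_i 1 * m i)%N).
    by rewrite add0n; under eq_bigr do rewrite mul1n; rewrite -mpoly.mdegE.
  apply: trig_polyM; first exact: trig_poly_cst.
  by apply: trig_poly_prod => i; apply: trig_polyX; exact: trig_poly_linear.
apply/funext => th; rewrite pevalE big_seq [RHS]big_mkcond/= [RHS]big_seq.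
apply: eq_bigr => m /mpoly.msize_mdeg_lt/leq_trans/(_ pt); rewrite ltnS => ->.
by congr (_ * _); apply: eq_bigr => i _; rewrite !mxE.
Qed.

(** [sup] has its meaning only on bounded sets; the sum of the absolute values of the coefficients
    is a bound, as coordinates on the sphere are at most 1 in absolute value. *)
Lemma sphere_poly_sup (f : sphere R d -> R) t : sphere_poly t f ->
  forall x, `|f x| <= sup (range (fun x => `|f x|)).
Proof.
move=> [p [_ fE]] x; apply: ub_le_sup; last by exists x.
exists (\sum_(m <- mpoly.msupp p) `|mpoly.mcoeff m p|) => _ [y _ <-].
by rewrite fE; apply: peval_bounded; exact: emb_unit.
Qed.

Lemma sphere_poly_tame t : exists2 e : R, 0 < e &
  forall (f : sphere R d -> R) r, r <= e -> sphere_poly t f ->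
  exists F : V -> R, [/\ forall x, f x = F (emb x), continuous F &
    tame r F (sup (range (fun x => `|f x|)))].
Proof.
have [e e0 eP] := @trig_poly_equicontinuous R t.
exists e => // f r re tf; have [p [pt fE]] := tf.
have fF x : f x = peval p (emb x) by rewrite fE.
have pM x : dot x x = 1 -> `|peval p x| <= sup (range (fun x => `|f x|)).
  by move=> x1; rewrite -(emb_to_sphere x1) -fF; exact: (sphere_poly_sup tf).
exists (peval p); split; [by []|exact: peval_continuous|].
split=> [|//|x y th xy thr]; first exact: peval_continuous.
have := eP _ (sup (range (fun x => `|f x|))) (trig_poly_peval x y pt).
rewrite [circ x y 0](_ : _ = x); last first.
  by rewrite /circ cos0 sin0 scale1r scale0r addr0.
apply; last exact: le_trans re.
move=> a; apply: pM; case: xy => x1 y1 xy.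
by rewrite dot_circ// subrr cos0.
Qed.

End polynomial_functions.

(** * Integrals over the sphere and averages over fibres *)

Section linear_integrals.
Variable R : realType.

Lemma ointD (f g : R -> R) a b : continuous f -> continuous g ->
  oint (fun x => f x + g x) a b = oint f a b + oint g a b.
Proof.
move=> /ex_antiderivative[F dF] /ex_antiderivative[G dG].
rewrite (ointE _ _ dF) (ointE _ _ dG) (ointE _ _ (fun x => is_deriveD (dF x) (dG x))).
by rewrite !fctE; ring.
Qed.

Lemma oint_cst (c a b : R) : oint (fun=> c) a b = (b - a) * c.
Proof.
have dF (x : R) : is_derive x 1 (fun x : R => c * x) c.
  by rewrite -[X in is_derive _ _ _ X]mulr1; exact: (@is_deriveZ _ _ _ id).
by rewrite (ointE _ _ dF); ring.
Qed.

Lemma ointZ (f : R -> R) c a b : continuous f ->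
  oint (fun x => f x * c) a b = oint f a b * c.
Proof.
move=> /ex_antiderivative[F dF]; rewrite (ointE _ _ dF).
have dcF (x : R) : is_derive x 1 (fun x => c * F x) (f x * c).
  by rewrite mulrC; exact: is_deriveZ.
by rewrite (ointE _ _ dcF); ring.
Qed.

Lemma oint_lincomb (I : Type) (s : seq I) (f : I -> R -> R) (c : I -> R) a b :
  (forall i, continuous (f i)) ->
  oint (fun x => \sum_(i <- s) f i x * c i) a b = \sum_(i <- s) oint (f i) a b * c i.
Proof.
move=> cf; have cfc i : continuous (fun x => f i x * c i).
  by move=> x; apply: cvgM; [exact: cf|exact: cvg_cst].
elim: s => [|i s IH]; first by under eq_fun do rewrite big_nil; rewrite oint_cst mulr0 big_nil.
under eq_fun do rewrite big_cons; rewrite big_cons -IH -ointZ// ointD//.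
by apply: continuous_sumr.
Qed.

End linear_integrals.

Section borel_measurability.
Variable R : realType.

Lemma continuous_borel_measurable (T : ptopologicalType) (f : T -> R) :
  continuous f -> measurable_fun [set: borel T] (f : borel T -> R).
Proof.
move=> /continuousP cf; apply: (measurability _ (RGenOpens.measurableE R)).
move=> _ [_ [x [y ->] <-]]; rewrite setTI; apply: sub_sigma_algebra.
by apply: cf; exact: interval_open.
Qed.

Lemma continuous_borel_borel (T T' : ptopologicalType) (f : T -> T') :
  continuous f -> measurable_fun [set: borel T] (f : borel T -> borel T').
Proof.
move=> /continuousP cf; apply: (@measurability _ _ (borel T) (borel T') setT f (@open T') erefl).
by move=> _ [A oA <-]; rewrite setTI; apply: sub_sigma_algebra; exact: cf.
Qed.

End borel_measurability.

Lemma dotE (R : realType) m (x y : 'rV[R]_m) : dot x y = (x *m y^T) 0 0.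
Proof. by rewrite mxE; apply: eq_bigr => i _; rewrite mxE. Qed.

Section sphere_integrals.
Variables (R : realType) (d : nat).
Local Notation V := 'rV[R]_d.+1.
Local Notation mpol := (mpoly.mpoly d.+1 R).
Variable sigma : probability (borel (sphere R d)) R.
Hypothesis usigma : uniform_measure sigma.

Lemma emb_continuous : continuous (@emb R d).
Proof. exact: initial_continuous. Qed.

Definition pint (p : mpol) : R := \int[sigma]_x peval p (emb x).

Lemma peval_emb_continuous p : continuous (fun x : sphere R d => peval p (emb x)).
Proof.
move=> x; apply: (@continuous_comp (sphere R d) V R (@emb R d) (peval p)).
  exact: emb_continuous.
exact: peval_continuous.
Qed.

Lemma peval_integrable p :
  sigma.-integrable setT (EFin \o (fun x => peval p (emb x))).
Proof.
apply: measurable_bounded_integrable => //.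
- by apply: (le_lt_trans (probability_le1 sigma measurableT)); rewrite ltry.
- exact: (@continuous_borel_measurable R (sphere R d) _ (@peval_emb_continuous p)).
exists (\sum_(m <- mpoly.msupp p) `|mpoly.mcoeff m p|); split.
  by apply: ger0_real; exact: sumr_ge0.
move=> M /ltW pM x _; apply: le_trans pM.
exact: peval_bounded (emb_unit x).
Qed.

Lemma pintD p q : pint (p + q) = pint p + pint q.
Proof.
rewrite /pint -RintegralD//; [|exact: peval_integrable..].
by apply: eq_Rintegral => x _; rewrite /peval mpoly.mevalD.
Qed.

Lemma pintZ c p : pint (c *: p) = c * pint p.
Proof.
rewrite /pint -RintegralZl//; [|exact: peval_integrable].
by apply: eq_Rintegral => x _; rewrite /peval mpoly.mevalZ.
Qed.

Lemma eq_pint p q : (forall x, dot x x = 1 -> peval p x = peval q x) -> pint p = pint q.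
Proof. by move=> pq; apply: eq_Rintegral => x _; rewrite pq//; exact: emb_unit. Qed.

Lemma pint_lincomb (I : Type) (s : seq I) (c : I -> R) (q : I -> mpol) :
  pint (\sum_(i <- s) c i *: q i) = \sum_(i <- s) c i * pint (q i).
Proof.
elim: s => [|i s IH]; last by rewrite !big_cons pintD pintZ IH.
by rewrite !big_nil -[0]/(GRing.zero) -(scale0r (0 : mpol)) pintZ mul0r.
Qed.

Lemma pint1 : pint 1 = 1.
Proof.
rewrite /pint; under eq_Rintegral do rewrite /peval mpoly.meval1.
rewrite Rintegral_cst//.
by rewrite mul1r; exact: (congr1 fine (probability_setT sigma)).
Qed.

(** Invariance on sets passes to integrals through the image measure: the map induced by [Q] is
    continuous, hence Borel, and the image of [sigma] under it is [sigma]. *)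
Lemma pint_orthogonal (Q : 'M[R]_d.+1) p q : Q *m Q^T = 1%:M ->
  (forall x, peval q x = peval p (x *m Q)) -> pint q = pint p.
Proof.
move=> QQ qE.
have Q1 x : dot x x = 1 -> dot (x *m Q) (x *m Q) = 1.
  move=> x1; rewrite -[RHS]x1 !dotE trmx_mul mulmxA -(mulmxA x) QQ mulmx1//.
pose phi (x : sphere R d) : sphere R d := to_sphere (emb x *m Q).
have phiE x : emb (phi x) = emb x *m Q by apply: emb_to_sphere; apply: Q1; exact: emb_unit.
have phic : continuous phi.
  apply: continuous_comp_initial.
  rewrite (_ : _ \o _ = fun x => emb x *m Q); last by apply/funext => x; exact: phiE.
  move=> x; apply: (@continuous_comp (sphere R d) V V (@emb R d) (fun y => y *m Q)).
    exact: emb_continuous.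
  rewrite (_ : (fun y => _) = fun y : V => \sum_i y 0 i *: row i Q); last first.
    by apply/funext => y; rewrite mulmx_sum_row.
  move: (emb x); apply: continuous_big => [[y z]|i _ y]; first exact: add_continuous.
  by apply: (@cvgZr_tmp R V V (nbhs y) _ (fun x : V => x 0 i)); exact: coord_continuous.
have inv := usigma QQ phiE.
rewrite /pint /Rintegral; congr fine.
pose f (x : borel (sphere R d)) := (peval p (emb x))%:E.
have mf : measurable_fun setT f.
  apply/measurable_EFinP.
  exact: (@continuous_borel_measurable R (sphere R d) _ (@peval_emb_continuous p)).
have fphi : f \o phi = fun x => (peval q (emb x))%:E.
  by apply/funext => x /=; rewrite /f phiE qE.
have mphi := @continuous_borel_borel (sphere R d) (sphere R d) phi phic.
have := integral_pushforward mphi (mu := sigma) mf (D := setT).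
rewrite preimage_setT fphi => /(_ (peval_integrable q) measurableT) <-.
apply: eq_measure_integral => A mA _; exact: inv.
Qed.

End sphere_integrals.

Section fibre_averages.
Variables (R : realType) (d : nat).
Local Notation V := 'rV[R]_d.+1.
Local Notation mpol := (mpoly.mpoly d.+1 R).

Lemma peval_lincomb (I : Type) (s : seq I) (P : pred I) (c : I -> R) (q : I -> mpol) x :
  peval (\sum_(i <- s | P i) c i *: q i) x = \sum_(i <- s | P i) c i * peval (q i) x.
Proof. by rewrite /peval raddf_sum/=; apply: eq_bigr => i _; rewrite mpoly.mevalZ. Qed.

(** Integrating such a sum over [t] acts on the coefficients alone and leaves a polynomial in [x];
    it commutes with the integral over the sphere by linearity, which takes the place of Fubini's
    theorem. *)
Definition separated (k : nat) (h : R -> V -> R) : Prop :=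
  exists (I : finType) (a : I -> R -> R) (q : I -> mpol),
  [/\ forall i, continuous (a i), forall i, (mpoly.msize (q i) <= k.+1)%N &
      forall t x, h t x = \sum_i a i t * peval (q i) x].

Lemma separatedW k k' h : (k <= k')%N -> separated k h -> separated k' h.
Proof.
move=> kk' [I [a [q [ca sq hE]]]]; exists I, a, q; split=> // i.
exact: leq_trans (sq i) _.
Qed.

Lemma separated_cst c : separated 0 (fun _ _ => c).
Proof.
exists unit, (fun _ _ => c), (fun=> 1); split=> [i x|i|t x]; first exact: cvg_cst.
  by rewrite mpoly.msize1.
by rewrite big_const card_unit/= addr0 /peval mpoly.meval1 mulr1.
Qed.

Lemma separatedD k g h : separated k g -> separated k h ->
  separated k (fun t x => g t x + h t x).
Proof.
move=> [I [a [q [ca sq gE]]]] [I' [a' [q' [ca' sq' hE]]]].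
exists (I + I')%type, (fun i => match i with inl i => a i | inr i => a' i end),
  (fun i => match i with inl i => q i | inr i => q' i end).
by split=> [[i|i]|[i|i]|t x] //; rewrite gE hE big_sumType.
Qed.

Lemma separatedM k k' g h : separated k g -> separated k' h ->
  separated (k + k') (fun t x => g t x * h t x).
Proof.
move=> [I [a [q [ca sq gE]]]] [I' [a' [q' [ca' sq' hE]]]].
exists (I * I')%type, (fun i t => a i.1 t * a' i.2 t), (fun i => q i.1 * q' i.2).
split=> [[i i'] x|[i i']|t x] /=.
- by apply: cvgM; [exact: ca|exact: ca'].
- have [->|q0] := eqVneq (q i) 0; first by rewrite mul0r mpoly.mmeasure0.
  have [->|q'0] := eqVneq (q' i') 0; first by rewrite mulr0 mpoly.mmeasure0.
  rewrite mpoly.msizeM// -subn1 leq_subLR.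
  by apply: leq_trans (leq_add (sq i) (sq' i')) _; rewrite addSn addnS.
- rewrite gE hE big_distrlr/= pair_big/=; apply: eq_bigr => -[i i'] _ /=.
  by rewrite /peval mpoly.mevalM; ring.
Qed.

Lemma separatedX k g n : separated k g -> separated (k * n) (fun t x => g t x ^+ n).
Proof.
move=> sg; elim: n => [|n IH]; first by rewrite muln0; exact: separated_cst.
by rewrite mulnS; have := separatedM sg IH; under eq_fun do under eq_fun do rewrite -exprS.
Qed.

Lemma separated_sum (I : Type) (s : seq I) (P : pred I) (h : I -> R -> V -> R) k :
  (forall i, P i -> separated k (h i)) ->
  separated k (fun t x => \sum_(i <- s | P i) h i t x).
Proof.
move=> sh; elim: s => [|i s IH].
  under eq_fun do under eq_fun do rewrite big_nil.
  exact: separatedW (separated_cst _).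
under eq_fun do under eq_fun do rewrite big_cons.
by case: (boolP (P i)) => [Pi|_]; [apply: separatedD (sh _ Pi) IH|exact: IH].
Qed.

Lemma separated_prod (I : Type) (s : seq I) (h : I -> R -> V -> R) (k : I -> nat) :
  (forall i, separated (k i) (h i)) ->
  separated (\sum_(i <- s) k i)%N (fun t x => \prod_(i <- s) h i t x).
Proof.
move=> sh; elim: s => [|i s IH].
  rewrite big_nil (_ : (fun t x => _) = fun _ _ => 1); first exact: separated_cst.
  by apply/funext => t; apply/funext => x; rewrite big_nil.
rewrite big_cons (_ : (fun t x => _) = fun t x => h i t x * \prod_(j <- s) h j t x).
  exact: separatedM.
by apply/funext => t; apply/funext => x; rewrite big_cons.
Qed.

Variable J : {linear V -> V}.
Hypothesis JJ : forall x, J (J x) = - x.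
Hypothesis dotJJ : forall x y, dot (J x) (J y) = dot x y.

Lemma separated_rot_coord i : separated 1 (fun t x => rot J t x 0 i).
Proof.
pose X j : mpol := mpoly.mpolyX R (mpoly.mnm1 j).
have sX j : mpoly.msize (X j) = 2%N by rewrite mpoly.msizeX mpoly.mdeg1.
exists bool, (fun b t => if b then cos t else sin t),
  (fun b => if b then X i else \sum_j (lin1_mx J j i) *: X j).
split=> [[] x|[]|t x].
- exact: continuous_cos.
- exact: continuous_sin.
- by rewrite sX.
- apply: leq_trans (mpoly.mmeasure_sum _ _ _ _) _.
  apply/bigmax_leqP_seq => j _ _; apply: leq_trans (mpoly.mmeasureZ_le _ _ _) _.
  by rewrite sX.
- rewrite big_bool/= !mxE; congr (_ * _ + _ * _); first by rewrite /peval mpoly.mevalXU.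
  rewrite -(mul_rV_lin1 J) mxE peval_lincomb; apply: eq_bigr => j _.
  by rewrite /peval mpoly.mevalXU mulrC.
Qed.

Lemma separated_rot_peval p k : (mpoly.msize p <= k.+1)%N ->
  separated k (fun t x => peval p (rot J t x)).
Proof.
move=> pk.
rewrite (_ : (fun t x => _) = fun t x => \sum_(m <- mpoly.msupp p | (mpoly.mdeg m <= k)%N)
   mpoly.mcoeff m p * \prod_i (rot J t x 0 i) ^+ (m i)).
  apply: separated_sum => m mk.
  apply: (@separatedW (0 + \sum_i 1 * m i)%N).
    by rewrite add0n; under eq_bigr do rewrite mul1n; rewrite -mpoly.mdegE.
  apply: separatedM; first exact: separated_cst.
  by apply: separated_prod => i; apply: separatedX; exact: separated_rot_coord.
apply/funext => t; apply/funext => x; rewrite pevalE big_seq [RHS]big_mkcond/= [RHS]big_seq.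
by apply: eq_bigr => m /mpoly.msize_mdeg_lt/leq_trans/(_ pk); rewrite ltnS => ->.
Qed.

Lemma orthogonal_dot (Q : 'M[R]_d.+1) :
  (forall x y, dot (x *m Q) (y *m Q) = dot x y) -> Q *m Q^T = 1%:M.
Proof.
move=> QD; apply/matrixP => i j.
have := QD (delta_mx 0 i) (delta_mx 0 j); rewrite -!rowE.
rewrite [RHS]dotE trmx_delta -rowE !mxE eqxx andbT => <-.
by apply: eq_bigr => l _; rewrite !mxE.
Qed.

Variable sigma : probability (borel (sphere R d)) R.
Hypothesis usigma : uniform_measure sigma.

(** Each rotation is orthogonal, so the integral of the rotated polynomial over the sphere does not
    depend on the angle, and integrating over a period only multiplies it by 2 pi. *)
Lemma ex_fibre_average k p : (mpoly.msize p <= k.+1)%N ->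
  exists q : mpol, [/\ (mpoly.msize q <= k.+1)%N,
    forall x, peval q x = fint J (peval p) x & pint sigma q = 2 * pi * pint sigma p].
Proof.
move=> /separated_rot_peval[I [a [q [ca sq pE]]]].
exists (\sum_i oint (a i) 0 (2 * pi) *: q i); split.
- apply: leq_trans (mpoly.mmeasure_sum _ _ _ _) _.
  apply/bigmax_leqP_seq => j _ _; apply: leq_trans (mpoly.mmeasureZ_le _ _ _) _.
  exact: sq.
- move=> x; rewrite /fint.
  have -> : (fun t => peval p (rot J t x)) = fun t => \sum_i a i t * peval (q i) x.
    by apply/funext => t; exact: pE.
  by rewrite oint_lincomb// peval_lincomb.
rewrite pint_lincomb -oint_lincomb//.
rewrite (_ : (fun t => _) = fun=> pint sigma p); first by rewrite oint_cst subr0.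
apply/funext => t; rewrite -pint_lincomb.
have QE x : x *m ((cos t)%:M + sin t *: lin1_mx J) = rot J t x.
  by rewrite mulmxDr mul_mx_scalar -scalemxAr mul_rV_lin1.
apply: (pint_orthogonal usigma (orthogonal_dot (Q := (cos t)%:M + sin t *: lin1_mx J) _)).
  by move=> x y; rewrite !QE dot_rot.
by move=> x; rewrite QE pE peval_lincomb.
Qed.

Let even_part p : mpol :=
  \sum_(m <- mpoly.msupp p | ~~ odd (mpoly.mdeg m)) mpoly.mcoeff m p *: mpoly.mpolyX R m.

Let peval_even_part p x : peval (even_part p) x = (peval p x + peval p (- x)) / 2.
Proof.
rewrite peval_lincomb !pevalE -big_split/= mulr_suml big_mkcond/=.
apply: eq_bigr => m _; rewrite -mulrDr.
have -> : \prod_i (- x) 0 i ^+ m i = (-1) ^+ mpoly.mdeg m * \prod_i x 0 i ^+ m i.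
  rewrite mpoly.mdegE -prodrXr -big_split/=; apply: eq_bigr => i _.
  by rewrite mxE [LHS]exprNn.
by rewrite -signr_odd /peval mpoly.mevalX; case: odd => /=; rewrite ?expr0 ?expr1; field.
Qed.

(* Antipodal points lie on the same fibre, so only the even part of [p] counts. *)
Lemma ex_fibre_average_even t p : (mpoly.msize p <= t.+1)%N ->
  exists q : mpol, [/\ (mpoly.msize q <= (t./2).*2.+1)%N,
    forall x, dot x x = 1 -> peval q x = fint J (peval p) x &
    pint sigma q = 2 * pi * pint sigma p].
Proof.
(* [q'] averages [p] itself and provides the integral; [q] averages the even part and provides the
   degree. Both equal [fint] on the sphere. *)
move=> pt; have [q' [_ q'E q'I]] := ex_fibre_average pt.
have [|q [sq qE _]] := @ex_fibre_average (t./2).*2 (even_part p).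
  apply: leq_trans (mpoly.mmeasure_sum _ _ _ _) _.
  apply/bigmax_leqP_seq => m mp me; apply: leq_trans (mpoly.mmeasureZ_le _ _ _) _.
  rewrite mpoly.msizeX ltnS; have := leq_trans (mpoly.msize_mdeg_lt mp) pt.
  by rewrite ltnS => /half_leq; rewrite -leq_double (even_halfK me).
have qE' x : dot x x = 1 -> peval q x = fint J (peval p) x.
  move=> x1; rewrite qE.
  have cF (y : V) : dot y y = 1 -> continuous (fun t => peval p (rot J t y)).
    move=> y1 a; apply: (@continuous_comp R V R (fun t => rot J t y) (peval p)).
      exact: (regular_continuous (regular_nice (nice_circ false (orthonormal_J JJ dotJJ y1)))).
    exact: peval_continuous.
  have x1' : dot (- x) (- x) = 1 by rewrite dotNl dotNr opprK.
  have -> : fint J (peval (even_part p)) x = (fint J (peval p) x + fint J (peval p) (- x)) / 2.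
    rewrite /fint -ointD; [|exact: cF..].
    rewrite -ointZ; last first.
      by move=> a; apply: cvgD; exact: cF.
    congr (oint _ _ _); apply/funext => a; rewrite peval_even_part.
    by rewrite -[- rot J a x]scaleN1r -rotZ scaleN1r.
  have -> : - x = rot J pi x by rewrite /rot cospi sinpi scale0r addr0 scaleN1r.
  by rewrite (fint_rot JJ dotJJ)//; [field|exact: peval_continuous].
exists q; split=> //; rewrite -q'I; apply: eq_pint => x x1.
by rewrite qE'.
Qed.

End fibre_averages.

(** * Horizontal lifts of minimal geodesics *)

Section lifting_geodesics.
Variables (R : realType) (d : nat).
Local Notation V := 'rV[R]_d.+1.
Variable J : {linear V -> V}.
Hypothesis JJ : forall x, J (J x) = - x.
Hypothesis dotJJ : forall x y, dot (J x) (J y) = dot x y.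

(** The Fubini-Study distance: the arccosine of the modulus of the Hermitian product, computed from
    its real and imaginary parts. *)
Definition hdist (p q : V) : R := acos (Num.sqrt (dot p q ^+ 2 + dot p (J q) ^+ 2)).

Lemma ex_angle (a b : R) : a ^+ 2 + b ^+ 2 = 1 -> exists t, cos t = a /\ sin t = b.
Proof.
move=> ab; have a1 : -1 <= a <= 1.
  by rewrite -ler_norml -(expr_le1 (n := 2))// real_normK ?num_real// -ab lerDl sqr_ge0.
have sb : sin (acos a) = `|b|.
  by rewrite sin_acos// -ab addrAC subrr add0r sqrtr_sqr.
have ca : cos (acos a) = a by apply: acosK; rewrite in_itv.
have [b0|b0] := leP 0 b; first by exists (acos a); rewrite ca sb ger0_norm.
by exists (- acos a); rewrite cosN sinN ca sb ltr0_norm// opprK.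
Qed.

Lemma hdot_rotr p q t : dot p (rot J t q) ^+ 2 + dot p (J (rot J t q)) ^+ 2 =
  dot p q ^+ 2 + dot p (J q) ^+ 2.
Proof.
rewrite (J_rot J) -!(dotC (rot _ _ _)) !dot_rotl JJ dotNl -!(dotC p).
rewrite -[RHS]mul1r -(cos2Dsin2 t); ring.
Qed.

Lemma hdotC p q : dot p q ^+ 2 + dot p (J q) ^+ 2 = dot q p ^+ 2 + dot q (J p) ^+ 2.
Proof. by rewrite (dotC q) -[dot q (J p)]opprK -(dotJl JJ dotJJ) sqrrN (dotC _ p). Qed.

Lemma hdist_rotr p q t : hdist p (rot J t q) = hdist p q.
Proof. by rewrite /hdist hdot_rotr. Qed.

Lemma hdistC p q : hdist p q = hdist q p.
Proof. by rewrite /hdist hdotC. Qed.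

Lemma hdist_rotl p q t : hdist (rot J t p) q = hdist p q.
Proof. by rewrite hdistC hdist_rotr hdistC. Qed.

(* The fibre point of [q] closest to [p] is horizontally displaced. *)
Lemma ex_aligned p q : exists t, dot p (rot J t q) = Num.sqrt (dot p q ^+ 2 + dot p (J q) ^+ 2)
  /\ dot p (J (rot J t q)) = 0.
Proof.
set rho := Num.sqrt _.
have rho2 : rho ^+ 2 = dot p q ^+ 2 + dot p (J q) ^+ 2.
  by rewrite sqr_sqrtr// addr_ge0// sqr_ge0.
have [r0|r0] := eqVneq rho 0.
  move: rho2; rewrite r0 expr0n/= => /esym/eqP; rewrite paddr_eq0 ?sqr_ge0//.
  rewrite !sqrf_eq0 => /andP[/eqP pq /eqP pJq]; exists 0.
  by rewrite rot0.
have [|t [ct st]] := @ex_angle (dot p q / rho) (dot p (J q) / rho).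
  by rewrite !expr_div_n -mulrDl -rho2 divff// sqrf_eq0.
exists t; rewrite (J_rot J) -!(dotC (rot _ _ _)) !dot_rotl JJ dotNl -!(dotC p) ct st.
split; last by field.
by rewrite -[RHS](mulfK r0) -expr2 rho2; field.
Qed.

Lemma hdot_le1 p q : dot p p = 1 -> dot q q = 1 ->
  Num.sqrt (dot p q ^+ 2 + dot p (J q) ^+ 2) <= 1.
Proof.
move=> p1 q1; have [t [<- _]] := ex_aligned p q.
by apply: unit_dot_le1 => //; rewrite dot_rot.
Qed.

Lemma cos_hdist p q : dot p p = 1 -> dot q q = 1 ->
  cos (hdist p q) = Num.sqrt (dot p q ^+ 2 + dot p (J q) ^+ 2).
Proof.
move=> p1 q1; apply: acosK; rewrite in_itv/= hdot_le1// andbT.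
by apply: le_trans (sqrtr_ge0 _); rewrite lerN10.
Qed.

Lemma hdist_itv p q : dot p p = 1 -> dot q q = 1 -> 0 <= hdist p q <= pi / 2.
Proof.
move=> p1 q1; have r1 := hdot_le1 p1 q1.
have r0 : -1 <= Num.sqrt (dot p q ^+ 2 + dot p (J q) ^+ 2).
  by apply: le_trans (sqrtr_ge0 _); rewrite lerN10.
rewrite acos_ge0 ?r1 ?r0//= leNgt; apply/negP => hp.
have hpi : hdist p q <= pi by rewrite acos_lepi// r0 r1.
have : 0 < sin (hdist p q - pi / 2).
  by have p0 := pi_gt0 R; apply: sin_gt0_pi; apply/andP; split; [move: hp; rewrite /hdist|]; lra.
rewrite sinB cos_pihalf mulr0 sub0r sin_pihalf mulr1 cos_hdist// oppr_gt0.
by rewrite ltNge sqrtr_ge0.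
Qed.

Lemma dot_le_cos_hdist p q : dot p p = 1 -> dot q q = 1 ->
  dot p q <= cos (hdist p q).
Proof.
move=> p1 q1; rewrite cos_hdist//; apply: le_trans (ler_norm _) _.
by rewrite -sqrtr_sqr; apply: ler_wsqrtr; rewrite lerDl sqr_ge0.
Qed.

Lemma hdist_eq0 p q : dot p p = 1 -> dot q q = 1 -> hdist p q = 0 ->
  exists t, p = rot J t q.
Proof.
move=> p1 q1 pq0; have [t [pt _]] := ex_aligned p q; exists t.
apply: unit_dot_eq1 => //; first by rewrite dot_rot.
by rewrite pt -cos_hdist// pq0 cos0.
Qed.

(** The equality case of the triangle inequality on the sphere. The squared norm of the difference
    of both sides is -2 sin s sin s' (cos(s + s') - dot p q), which is at most 0. *)
Lemma triangle_equality (x p q : V) s s' : dot x x = 1 -> dot p p = 1 -> dot q q = 1 ->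
  0 <= sin s -> 0 <= sin s' -> dot p x = cos s -> dot q x = cos s' ->
  dot p q <= cos (s + s') ->
  sin (s + s') *: x = sin s' *: p + sin s *: q.
Proof.
move=> x1 p1 q1 s0 s'0 px qx pq.
apply/eqP; rewrite -subr_eq0; apply/eqP/dot_eq0.
apply/eqP; rewrite eq_le dot_ge0 andbT.
rewrite !(dotDl, dotDr, dotNl, dotNr, dotZl, dotZr) !(dotC x) (dotC q p) x1 p1 q1 px qx.
have : sin s * sin s' * (cos (s + s') - dot p q) >= 0 by rewrite !mulr_ge0// subr_ge0.
have := cos2Dsin2 s; have := cos2Dsin2 s'.
rewrite sinD cosD.
move: (dot p q) (cos s) (sin s) (cos s') (sin s') => D c S c' S' h1 h2 h3.
rewrite -subr_ge0.
set X := (X in 0 <= X).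
rewrite [X](_ : _ = 2 * (S * S' * (c * c' - S * S' - D))
  + (S' ^+ 2 * (c ^+ 2 + S ^+ 2 - 1) + S ^+ 2 * (c' ^+ 2 + S' ^+ 2 - 1))); last first.
  by rewrite /X; ring.
by rewrite h1 h2 !subrr !mulr0 !addr0 mulr_ge0.
Qed.

Lemma half_geodesic p m x s l : dot p p = 1 -> dot m m = 1 -> dot x x = 1 ->
  0 < s < l -> l < pi / 2 -> dot p m = cos l -> dot p (J m) = 0 ->
  hdist p x = s -> hdist x m = l - s ->
  exists t, sin l *: rot J t x = sin (l - s) *: p + sin s *: m.
Proof.
move=> p1 m1 x1 /andP[s0 sl] l2 pm pJm px xm.
have p0 := pi_gt0 R.
have [t [mt _]] := ex_aligned m x.
set z := rot J t x in mt.
have z1 : dot z z = 1 by rewrite dot_rot.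
have mz : dot m z = cos (l - s) by rewrite mt -cos_hdist// hdistC xm.
have [t' [zp _]] := ex_aligned z p.
set p' := rot J t' p in zp.
have p'1 : dot p' p' = 1 by rewrite dot_rot.
have zp' : dot p' z = cos s by rewrite dotC zp -cos_hdist// hdist_rotl hdistC px.
have cl : 0 < cos l by apply: cos_gt0_pihalf; apply/andP; split; lra.
have sl0 : 0 < sin l by apply: sin_gt0_pi; lra.
have sls : 0 < sin (l - s) by apply: sin_gt0_pi; lra.
have ss0 : 0 < sin s by apply: sin_gt0_pi; lra.
have p'm : dot p' m = cos t' * cos l.
  by rewrite dot_rotl pm (dotJl JJ dotJJ) pJm oppr0 mulr0 addr0.
have te : sin l *: z = sin (l - s) *: p' + sin s *: m.
  have -> : l = s + (l - s) by ring.
  rewrite [X in sin (X - s)](_ : _ = l); last by ring.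
  apply: triangle_equality => //; try exact: ltW.
  rewrite p'm (_ : s + (l - s) = l); last by ring.
  by rewrite ler_piMl ?cos_le1// ltW.
exists t; rewrite -/z te; congr (_ *: _ + _).
have := congr1 (fun y => dot y m) te.
rewrite [RHS]dotDl !dotZl (dotC z) mz m1 p'm => te'.
have c1 : cos t' = 1.
  apply: (mulIf (lt0r_neq0 cl)); apply: (mulfI (lt0r_neq0 sls)).
  have : sin (l - (l - s)) = sin s by congr sin; ring.
  by rewrite sinB mul1r; lra.
have [k tk] := cos_eq1 c1.
by rewrite /p' tk rot_int.
Qed.

(** A minimal geodesic may have length pi/2, and then the Hermitian product of its ends vanishes and
    distinguishes no phase. Both ends are therefore aligned with the midpoint, at distance
    [l <= pi / 4], and the halves are lifted one by one. *)
Lemma ex_geodesic_lift (g : R -> V) l : 0 < l -> l <= pi / 4 -> (forall s, dot (g s) (g s) = 1) ->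
  (forall s s', 0 <= s <= 2 * l -> 0 <= s' <= 2 * l -> hdist (g s) (g s') = `|s - s'|) ->
  exists p v, [/\ horizontal J p v, exists t, p = rot J t (g 0),
    exists t, circ p v (2 * l) = rot J t (g (2 * l)) &
    forall s, 0 < s < 2 * l -> exists t, circ p v s = rot J t (g s)].
Proof.
move=> l0 l4 g1 gd; have p0 := pi_gt0 R.
have cl : 0 < cos l by apply: cos_gt0_pihalf; apply/andP; split; lra.
have sl0 : 0 < sin l by apply: sin_gt0_pi; lra.
have sl_neq0 := lt0r_neq0 sl0.
set m := g l; have m1 : dot m m = 1 by exact: g1.
have aligned s : 0 <= s <= 2 * l -> `|l - s| = l -> exists t,
    dot (rot J t (g s)) m = cos l /\ dot (rot J t (g s)) (J m) = 0.
  move=> s2 ls; have [t [mt mJt]] := ex_aligned m (g s); exists t; split.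
    by rewrite dotC mt -cos_hdist// gd ?ls//; lra.
  by rewrite -[LHS]opprK -(dotJl JJ dotJJ) dotC mJt oppr0.
have [||t [pm pJm]] := aligned 0; [lra|by rewrite subr0 gtr0_norm|].
have [||t' [qm qJm]] := aligned (2 * l); [lra| |].
  by rewrite distrC gtr0_norm; lra.
set p := rot J t (g 0) in pm pJm; set q := rot J t' (g (2 * l)) in qm qJm.
have p1 : dot p p = 1 by rewrite dot_rot.
have q1 : dot q q = 1 by rewrite dot_rot.
have pE : p = rot J t (g 0) by [].
have qrE : q = rot J t' (g (2 * l)) by [].
clearbody p q.
(* The aligned ends have spherical distance at least 2 l, so the midpoint lies between them and both
   halves belong to one great circle. *)
have te : sin (l + l) *: m = sin l *: p + sin l *: q.
  apply: triangle_equality => //; try exact: ltW.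
  apply: le_trans (dot_le_cos_hdist p1 q1) _.
  rewrite pE qrE hdist_rotl hdist_rotr gd; [|lra..].
  by rewrite sub0r normrN gtr0_norm; [rewrite mulr2n mulrDl mul1r|lra].
have qE : q = (2 * cos l) *: m - p.
  apply: (scalerI sl_neq0); rewrite scalerBr scalerA.
  rewrite (_ : sin l * (2 * cos l) = sin (l + l)); last by rewrite sinD; ring.
  by rewrite te addrAC subrr add0r.
pose v := (sin l)^-1 *: (m - cos l *: p).
have vE : sin l *: v = m - cos l *: p by rewrite /v scalerA divff// scale1r.
have circE s : sin l *: circ p v s = sin (l - s) *: p + sin s *: m.
  rewrite /circ scalerDr (scalerA _ (sin s)) [sin l * sin s]mulrC -[X in _ + X]scalerA vE.
  by move: (p : V) (m : V) => P M; apply/rowP => i; rewrite sinB !mxE; ring.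
exists p, v; split.
- have mp : dot m p = cos l by rewrite dotC.
  have slV : (sin l)^-1 * sin l = 1 by rewrite mulVf.
  split=> //; rewrite /v ?dotZl ?dotZr ?dotDr ?dotDl.
  - rewrite !dotNl !dotNr !dotZl !dotZr pm mp m1 p1 mulr1 mulrA -expr2.
    rewrite (_ : _ + _ = sin l ^+ 2); first by rewrite -exprMn slV expr1n.
    by rewrite sin2cos2; ring.
  - by rewrite dotNr dotZr p1 pm mulr1 subrr mulr0.
  - rewrite dotNr dotZr (dot0J JJ dotJJ) (dotJl JJ dotJJ) pJm.
    by rewrite mulr0 subr0 oppr0 mulr0.
- by exists t.
- exists t'; apply: (scalerI sl_neq0); rewrite circE -qrE qE.
  rewrite (_ : l - 2 * l = - l); last by ring.
  rewrite sinN scaleNr addrC scalerBr; congr (_ - _).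
  by rewrite scalerA mulr2n mulrDl mul1r sinD; congr (_ *: _); ring.
move=> s /andP[s0 s2].
have [sl|sl|->] := ltgtP s l.
- have [||||t2 H] := @half_geodesic p m (g s) s l p1 m1 (g1 s) _ _ pm pJm.
  + by rewrite s0.
  + lra.
  + by rewrite pE hdist_rotl gd ?sub0r ?normrN ?gtr0_norm//; lra.
  + by rewrite gd ?ltr0_norm ?opprB//; lra.
  by exists t2; apply: (scalerI sl_neq0); rewrite H circE.
- have [||||t2 H] := @half_geodesic q m (g s) (2 * l - s) l q1 m1 (g1 s) _ _ qm qJm.
  + lra.
  + lra.
  + by rewrite qrE hdist_rotl gd ?gtr0_norm//; lra.
  + by rewrite gd ?gtr0_norm//; lra.
  exists t2; apply: (scalerI sl_neq0); rewrite H circE qE.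
  have -> : l - (2 * l - s) = s - l by ring.
  have -> : 2 * l - s = l - (s - l) by ring.
  have [y ->] : exists y, s = y + l by exists (s - l); ring.
  rewrite addrK (_ : l - (y + l) = - y) ?sinN; last by ring.
  by move: (p : V) (m : V) => P M; apply/rowP => i; rewrite sinB sinD !mxE; ring.
exists 0; rewrite rot0; apply: (scalerI sl_neq0); rewrite circE subrr sin0 scale0r add0r//.
Qed.

End lifting_geodesics.

(** * The Hopf fibration and the distance on projective space *)

Section hopf_fibration.
Variables (R : realType) (n : nat).
Local Notation V := 'rV[R]_(n + n.+1).+1.

(* Multiplication by the imaginary unit *)
Definition hopfJ : {linear V -> V} :=
  mulmxr (block_mx 0 1%:M (- 1%:M) 0 : 'M[R]_(n.+1 + n.+1)).

Lemma hopfJE (x : 'rV[R]_(n.+1 + n.+1)) : hopfJ x = row_mx (- rsubmx x) (lsubmx x).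
Proof.
transitivity (x *m (block_mx 0 1%:M (- 1%:M) 0)); first by [].
rewrite -[x in LHS]hsubmxK mul_row_block !mulmx0 add0r addr0.
by rewrite mulmxN !mulmx1.
Qed.

Lemma hopfJJ x : hopfJ (hopfJ x) = - x.
Proof.
suff: forall x : 'rV[R]_(n.+1 + n.+1), hopfJ (hopfJ x) = - x by apply.
move=> {}x; rewrite [hopfJ x]hopfJE hopfJE row_mxKl row_mxKr -opp_row_mx.
by rewrite hsubmxK.
Qed.

Lemma dot_hopfJ x y : dot (hopfJ x) (hopfJ y) = dot x y.
Proof.
have dot_row (a b : 'rV[R]_n.+1) (c e : 'rV[R]_n.+1) :
    dot (row_mx a b) (row_mx c e) = dot a c + dot b e.
  rewrite /dot big_split_ord/=; congr (_ + _); apply: eq_bigr => i _.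
    by rewrite !row_mxEl.
  by rewrite !row_mxEr.
suff: forall x y : 'rV[R]_(n.+1 + n.+1), dot (hopfJ x) (hopfJ y) = dot x y by apply.
move=> {}x {}y; rewrite !hopfJE dot_row dotNl dotNr opprK addrC.
by rewrite -dot_row !hsubmxK.
Qed.

Lemma of_complexZ z (x : 'rV[R]_(n.+1 + n.+1)) :
  of_complex (z *: to_complex x) = complex.Re z *: x + complex.Im z *: (hopfJ x : 'rV_(n.+1 + n.+1)).
Proof.
rewrite hopfJE; have {2}-> : x = row_mx (lsubmx x) (rsubmx x) by rewrite hsubmxK.
rewrite !scale_row_mx add_row_mx.
case: z => a b; congr row_mx; apply/rowP => j; rewrite !mxE/=; ring.
Qed.

Lemma of_complexK : cancel (@of_complex R n) (@to_complex R n).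
Proof.
move=> w; apply/rowP => j; rewrite mxE row_mxEl row_mxEr !mxE.
by case: (w 0 j).
Qed.

Lemma of_complex_cembed z (x : hopf_sphere R n) :
  of_complex (z *: cembed x) = complex.Re z *: emb x + complex.Im z *: hopfJ (emb x).
Proof. exact: of_complexZ. Qed.

Lemma normc_eq1 (z : R[i]) : `|z| = 1 <-> exists t, z = Complex (cos t) (sin t).
Proof.
case: z => a b; rewrite normc_def/=; split=> [/complexI ab|[t [-> ->]]].
  have ab1 : a ^+ 2 + b ^+ 2 = 1.
    by rewrite -(sqr_sqrtr (_ : 0 <= a ^+ 2 + b ^+ 2)) ?ab ?expr1n// addr_ge0 ?sqr_ge0.
  by have [t [<- <-]] := ex_angle ab1; exists t.
by rewrite cos2Dsin2 sqrtr1.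
Qed.

Lemma same_fiberP (x y : hopf_sphere R n) :
  same_fiber x y <-> exists t, emb y = rot hopfJ t (emb x).
Proof.
split=> [/asboolP[z [/normc_eq1[t ->] xy]]|[t xy]].
  exists t; have := congr1 (@of_complex R n) xy.
  by rewrite -[cembed y]scale1r !of_complex_cembed/= scale1r scale0r addr0.
apply/asboolP; exists (Complex (cos t) (sin t)).
split; first by apply/normc_eq1; exists t.
apply: (can_inj of_complexK); rewrite of_complex_cembed/=.
by rewrite -[cembed y]scale1r of_complex_cembed/= scale1r scale0r addr0 xy.
Qed.

Lemma acos_anti (a b : R) : -1 <= a -> a <= b -> b <= 1 -> acos b <= acos a.
Proof.
move=> a1 ab b1; have ia : -1 <= a <= 1 by rewrite a1 (le_trans ab).
have ib : -1 <= b <= 1 by rewrite b1 (le_trans a1).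
rewrite leNgt -ltr_cos ?in_itv/= ?acos_ge0 ?acos_lepi//.
by rewrite !acosK ?in_itv// -leNgt.
Qed.

(** The infimum is attained at an aligned representative; no rotation does better, because a real
    part is at most the modulus. *)
Lemma CP_distE (y1 y2 : CP R n) :
  CP_dist y1 y2 = hdist hopfJ (emb (repr y1)) (emb (repr y2)).
Proof.
set p := emb (repr y1); set q := emb (repr y2).
have p1 : dot p p = 1 by exact: emb_unit.
have q1 : dot q q = 1 by exact: emb_unit.
have zE t : of_complex (Complex (cos t) (sin t) *: cembed (repr y2)) = rot hopfJ t q.
  exact: of_complex_cembed.
rewrite /CP_dist; apply/eqP; rewrite eq_le; apply/andP; split.
  have [t [pq _]] := ex_aligned hopfJJ p q.
  apply: ge_inf.
    exists 0 => _ [z /= /normc_eq1[t' ->] <-]; rewrite zE acos_ge0// -ler_norml.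
    by apply: unit_dot_abs_le1 => //; rewrite (dot_rot hopfJJ dot_hopfJ).
  exists (Complex (cos t) (sin t)); first by apply/normc_eq1; exists t.
  by rewrite zE pq.
apply: lb_le_inf.
  by exists (acos (dot p (of_complex (1 *: cembed (repr y2))))); exists 1 => //=; rewrite normr1.
move=> _ [z /= /normc_eq1[t ->] <-]; rewrite zE.
have r1 : dot (rot hopfJ t q) (rot hopfJ t q) = 1 by rewrite (dot_rot hopfJJ dot_hopfJ).
rewrite -(hdist_rotr hopfJJ _ _ t); apply: acos_anti.
- by have := unit_dot_abs_le1 p1 r1; rewrite ler_norml => /andP[].
- apply: le_trans (ler_norm _) _; rewrite -sqrtr_sqr; apply: ler_wsqrtr.
  by rewrite lerDl sqr_ge0.
- exact: (hdot_le1 hopfJJ dot_hopfJ).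
Qed.

Lemma Pi_repr (y : CP R n) : Pi (repr y) = y.
Proof. exact: reprK. Qed.

Lemma eq_Pi (x y : hopf_sphere R n) : Pi x = Pi y <-> same_fiber x y.
Proof. by split=> [/eqmodP|xy]; [|apply/eqmodP]. Qed.

Lemma eq_CP (y1 y2 : CP R n) t : emb (repr y2) = rot hopfJ t (emb (repr y1)) -> y1 = y2.
Proof.
move=> yt; rewrite -(Pi_repr y1) -(Pi_repr y2); apply/eq_Pi/same_fiberP.
by exists t.
Qed.

Lemma CP_dist_gt0 (y1 y2 : CP R n) : y1 != y2 -> 0 < CP_dist y1 y2.
Proof.
have p1 := emb_unit (repr y1); have q1 := emb_unit (repr y2).
rewrite CP_distE lt_neqAle; have /andP[-> _] := hdist_itv hopfJJ dot_hopfJ p1 q1.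
rewrite andbT; apply: contraNN => /eqP/esym/(hdist_eq0 hopfJJ dot_hopfJ p1 q1)[t pq].
by apply/eqP/esym/(eq_CP pq).
Qed.

Lemma CP_dist_le (y1 y2 : CP R n) : CP_dist y1 y2 <= pi / 2.
Proof.
by rewrite CP_distE; have /andP[] := 
  hdist_itv hopfJJ dot_hopfJ (emb_unit (repr y1)) (emb_unit (repr y2)).
Qed.

Lemma CP_distC (y1 y2 : CP R n) : CP_dist y1 y2 = CP_dist y2 y1.
Proof. by rewrite !CP_distE (hdistC hopfJJ dot_hopfJ). Qed.

(** [repr (c s)] is an arbitrary point of its fibre, possibly discontinuous in s; only the distances
    between fibres enter the lift. If an interior point lay over [Y], then [c s] would belong to
    [Y]. *)
Lemma geodesic_graph_lift (Y : {fset CP R n}) (y1 y2 : Y) : geodesic_graph y1 y2 ->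
  exists p v, [/\ horizontal hopfJ p v,
    exists t, p = rot hopfJ t (emb (repr (val y1))),
    exists t, circ p v (CP_dist (val y1) (val y2)) = rot hopfJ t (emb (repr (val y2))) &
    forall s, 0 < s < CP_dist (val y1) (val y2) -> forall (y : Y) t,
      circ p v s <> rot hopfJ t (emb (repr (val y)))].
Proof.
move=> /asboolP[y12 [c [[c0 cd cE] cY]]].
have d0 : 0 < CP_dist (val y1) (val y2) by apply: CP_dist_gt0; apply: contraNN y12 => /eqP/val_inj->.
have d2 := CP_dist_le (val y1) (val y2).
set d := CP_dist _ _ in cd cE cY d0 d2 *.
have dE : d = 2 * (d / 2) by field.
have [||||p [v [pv p0 pd ps]]] := @ex_geodesic_lift _ _ _ hopfJJ dot_hopfJ
    (fun s => emb (repr (c s))) (d / 2).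
- by rewrite divr_gt0.
- by lra.
- by move=> s; exact: emb_unit.
- by move=> s s'; rewrite -dE -CP_distE; exact: cE.
move: pd ps; rewrite -dE cd => pd ps; rewrite c0 in p0.
exists p, v; split=> // s sd y t py.
have /negP := cY s sd; apply.
have [t' pt'] := ps s sd.
rewrite (_ : c s = val y); first exact: valP.
apply/esym/(@eq_CP _ _ (- t' + t)).
by rewrite -(rot_rot hopfJJ) -py pt' (rot_rot hopfJJ) addNr rot0.
Qed.

End hopf_fibration.

(** * Second moments and design sets *)

Section second_moments.
Variables (R : realType) (d : nat).
Local Notation V := 'rV[R]_d.+1.
Local Notation mpol := (mpoly.mpoly d.+1 R).
Variable sigma : probability (borel (sphere R d)) R.
Hypothesis usigma : uniform_measure sigma.

Definition linear_form (u : V) : mpol := \sum_i u 0 i *: mpoly.mpolyX R (mpoly.mnm1 i).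

Lemma peval_linear_form u x : peval (linear_form u) x = dot u x.
Proof.
rewrite peval_lincomb; apply: eq_bigr => i _.
by rewrite /peval mpoly.mevalXU.
Qed.

Lemma msize_linear_form u : (mpoly.msize (linear_form u) <= 2)%N.
Proof.
apply: leq_trans (mpoly.mmeasure_sum _ _ _ _) _.
apply/bigmax_leqP_seq => j _ _; apply: leq_trans (mpoly.mmeasureZ_le _ _ _) _.
by rewrite mpoly.msizeX mpoly.mdeg1.
Qed.

Definition square_form (u : V) : mpol := linear_form u * linear_form u.

Lemma peval_square_form u x : peval (square_form u) x = dot u x ^+ 2.
Proof. by rewrite /peval mpoly.mevalM -!/(peval _ _) peval_linear_form expr2. Qed.

Lemma msize_square_form u : (mpoly.msize (square_form u) <= 3)%N.
Proof.
have := msize_linear_form u; rewrite /square_form.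
have [->|l0] := eqVneq (linear_form u) 0; first by rewrite mul0r mpoly.mmeasure0.
by rewrite mpoly.msizeM//; case: (mpoly.mmeasure _ _) => [|[|[|]]].
Qed.

(* The reflection exchanging [u] and [v] *)
Lemma pint_square_form u v : dot u u = 1 -> dot v v = 1 ->
  pint sigma (square_form u) = pint sigma (square_form v).
Proof.
move=> u1 v1; have [->//|uv] := eqVneq u v.
have [w wdef] : exists w : V, w = u - v by eexists.
have w0 : dot w w != 0.
  by rewrite wdef; apply: contraNneq uv => /dot_eq0/eqP; rewrite subr_eq0.
have wE : dot w w = 2 - 2 * dot u v.
  by rewrite wdef !(dotDl, dotDr, dotNl, dotNr) u1 v1 (dotC v u); ring.
pose Q := 1%:M - (2 / dot w w) *: (w^T *m w).
have QE x : x *m Q = x - (2 * dot x w / dot w w) *: w.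
  rewrite /Q mulmxBr mulmx1 -scalemxAr mulmxA [x *m w^T]mx11_scalar -dotE mul_scalar_mx scalerA.
  by congr (_ - _ *: _); field.
apply/esym/(pint_orthogonal usigma (Q := Q)).
  apply: orthogonal_dot => x y; rewrite !QE.
  rewrite !(dotDl, dotDr, dotNl, dotNr, dotZl, dotZr) (dotC w y).
  by field.
move=> x; rewrite !peval_square_form QE dotDr dotNr dotZr; congr (_ ^+ 2).
have uw : dot u w = 1 - dot u v by rewrite wdef dotDr dotNr u1.
have xw : dot x w = dot u x - dot v x by rewrite wdef dotDr dotNr !(dotC x).
by rewrite uw xw; move: w0; rewrite wE => w0; field.
Qed.

(** The squares of the [d + 1] coordinates have equal integrals and add up to 1 on the sphere. *)
Lemma pint_square_formE u : dot u u = 1 -> d.+1%:R * pint sigma (square_form u) = 1.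
Proof.
move=> u1; rewrite -[RHS](pint1 sigma).
transitivity (pint sigma (\sum_i 1 *: square_form (delta_mx 0 i))).
  rewrite pint_lincomb (eq_bigr (fun=> pint sigma (square_form u))).
    by rewrite sumr_const card_ord mulr_natl.
  move=> i _; rewrite mul1r; apply: pint_square_form => //.
  by rewrite dotE trmx_delta -rowE !mxE !eqxx.
apply: eq_pint => x x1; rewrite peval_lincomb /peval mpoly.meval1 -[RHS]x1.
apply: eq_bigr => i _; by rewrite mul1r -/(peval _ _) peval_square_form dotE -rowE !mxE expr2.
Qed.

End second_moments.

Section designs.
Variables (R : realType) (n : nat).
Local Notation V := 'rV[R]_(n + n.+1).+1.
Local Notation mpol := (mpoly.mpoly (n + n.+1).+1 R).
Local Notation J := (@hopfJ R n).
Variable sigma : probability (borel (hopf_sphere R n)) R.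
Hypothesis usigma : uniform_measure sigma.
Variables (k : nat) (Y : {fset CP R n}).
Hypothesis design : design_set sigma k Y.

(** A polynomial that is constant on fibres descends to projective space, continuously for the
    quotient topology, and the measure there is an image measure. *)
Lemma design_pint (q : mpol) : (mpoly.msize q <= k.*2.+1)%N ->
  (forall x t, dot x x = 1 -> peval q (rot J t x) = peval q x) ->
  (#|` Y|)%:R^-1 * \sum_(y <- Y) peval q (emb (repr y)) = pint sigma q.
Proof.
move=> qk qJ; pose g (y : CP R n) := peval q (emb (repr y)).
have gPi x : g (Pi x) = peval q (emb x).
  rewrite /g; have /eq_Pi/same_fiberP[t ->] : Pi x = Pi (repr (Pi x)) by rewrite Pi_repr.

  by rewrite qJ//; exact: emb_unit.
have gc : continuous g.
  apply/quotient_continuous.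
  rewrite (_ : g \o _ = fun x => peval q (emb x)); first exact: peval_emb_continuous.
  by apply/funext => x; exact: gPi.
have Pic : continuous (@Pi R n) by exact: pi_continuous.
have := design (g := g); rewrite /CP_measure => H.
have /H {}H : CP_poly k g.
  by exists q; split=> // x; exact: gPi.
have mPi := @continuous_borel_borel (hopf_sphere R n) (CP R n) _ Pic.
have mg : measurable_fun setT ((fun y => (g y)%:E) : borel (CP R n) -> \bar R).
  by apply/measurable_EFinP; exact: (@continuous_borel_measurable R (CP R n) _ gc).
have gPiE : (fun y => (g y)%:E) \o @Pi R n = fun x => (peval q (emb x))%:E.
  by apply/funext => x /=; rewrite gPi.
have := integral_pushforward mPi (mu := sigma) mg (D := setT).
rewrite preimage_setT gPiE => /(_ (peval_integrable sigma q) measurableT).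
by rewrite -H /pint /Rintegral => <-.
Qed.

(** Tested on the constant 1: for empty [Y] the average would be 0, as the inverse of 0 is 0. *)
Lemma design_neq0 : #|` Y| != 0%N.
Proof.
apply/eqP => Y0.
have := @design_pint 1; rewrite mpoly.msize1 pint1 Y0 invr0 mul0r => H.
have /eqP : (0 : R) = 1 by apply: H => // x t _; rewrite /peval !mpoly.meval1.
by rewrite eq_sym oner_eq0.
Qed.

(** The design property is applied to the fibre average of the even part, whose degree is small
    enough even for odd [t]. *)
Lemma design_fint t f F : k = t./2 -> sphere_poly t f -> (forall x, f x = F (emb x)) ->
  \sum_(y <- Y) fint J F (emb (repr y)) = 2 * pi * (#|` Y|)%:R * \int[sigma]_x f x.
Proof.
move=> kt [p [pt fp]] fF.
have [q [qt qE qI]] := ex_fibre_average_even (@hopfJJ R n) (@dot_hopfJ R n) usigma pt.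
have FE x : dot x x = 1 -> fint J F x = peval q x.
  move=> x1; rewrite qE// /fint; congr (oint _ _ _); apply/funext => a.
  have r1 : dot (rot J a x) (rot J a x) = 1.
    by rewrite (dot_rot (@hopfJJ R n) (@dot_hopfJ R n)).
  by rewrite -(emb_to_sphere r1) -fF fp.
have fI : \int[sigma]_x f x = pint sigma p by apply: eq_Rintegral => x _; exact: fp.
rewrite fI mulrAC -qI -(design_pint (q := q)); last 2 first.
- by rewrite kt.
- move=> x a x1; rewrite !qE ?(dot_rot (@hopfJJ R n) (@dot_hopfJ R n))//.
  by apply: (fint_rot (@hopfJJ R n) (@dot_hopfJ R n)) => //; exact: peval_continuous.
rewrite mulrAC mulVf ?mul1r ?pnatr_eq0 ?design_neq0//.
by apply: eq_bigr => y _; rewrite FE//; exact: emb_unit.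
Qed.

(* For a single point [p], the function [x |-> |<x, p>|^2] equals 1 at [p],
   while its mean is 1/(n+1). *)
Lemma design_gt1 : (0 < n)%N -> (0 < k)%N -> (1 < #|` Y|)%N.
Proof.
move=> n0 k0; rewrite ltn_neqAle lt0n design_neq0 andbT eq_sym.
apply/negP => /cardfs1P[y0 Y0].
set p := emb (repr y0); have p1 : dot p p = 1 by exact: emb_unit.
have Jp1 : dot (J p) (J p) = 1 by rewrite dot_hopfJ.
have qE x : peval (square_form p + square_form (J p)) x = dot x p ^+ 2 + dot x (J p) ^+ 2.
  by rewrite /peval mpoly.mevalD -!/(peval _ _) !peval_square_form !(dotC x).
have := design_pint (q := square_form p + square_form (J p)).
rewrite Y0 cardfs1 invr1 mul1r big_seq_fset1 => H.
have {}H : 1 = pint sigma (square_form p + square_form (J p)).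
  rewrite -H.
  - by rewrite qE p1 (dotJ0 (@hopfJJ R n) (@dot_hopfJ R n)) expr0n/= addr0 expr1n.
  - apply: leq_trans (mpoly.mmeasureD_le _ _ _) _; rewrite geq_max.
    by rewrite !(leq_trans (msize_square_form _))//; lia.
  - move=> x t x1; rewrite !qE (hdotC (@hopfJJ R n) (@dot_hopfJ R n)).
    by rewrite (hdot_rotr (@hopfJJ R n)) -(hdotC (@hopfJJ R n) (@dot_hopfJ R n)).
move: H; rewrite pintD => H.
have := pint_square_formE usigma p1; have := pint_square_formE usigma Jp1.
have nE : (n + n.+1).+1%:R = 2 * n%:R + 2 :> R by rewrite -addSn natrD -natr1; ring.
move: H; move: (pint sigma (square_form (J p))) (pint sigma (square_form p)) => A B H.
rewrite nE => HA HB.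
have : (2 * n%:R + 2) * (B + A) = 2 :> R by rewrite mulrDr HA HB.
move=> /eqP; rewrite -H mulr1 -[2]/(2%:R) -natrM -natrD eqr_nat.
by lia.
Qed.

End designs.

(** * Choice of the constants and tours of design sets *)

(** The bound on delta says alpha0 N < pi, so the slack [S] is positive. Quantities [k] and [a] of
    size at most [eta] use up at most half of it. They are quantified after [eta], since the profile
    that determines them is built from [eta]. *)
Lemma ex_small_parameters (R : realType) (delta m N C r0 rw : R) :
  0 < delta -> 0 < m -> 1 <= N -> 0 <= C -> 0 < r0 -> 0 < rw ->
  delta * N < 2 * pi * m ->
  exists alpha0 r eta : R,
    [/\ 2 * alpha0 * m = delta, 0 < alpha0, [/\ 0 < r, r <= r0, r <= rw & r <= alpha0],
        0 < eta &
        forall k a, 0 <= k <= eta -> 0 <= a <= eta ->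
        [/\ alpha0 + k < 2 * pi, 2 * a < alpha0 + k, a <= r, 4 * k <= r &
        alpha0 + k + 2 * (alpha0 + k) * (N - 1) + 6 * a * C < 2 * pi]] /\ 4 * eta <= r.
Proof.
move=> delta0 m0 N1 C0 r0_gt0 rw0 deltaM.
pose alpha0 := delta / (2 * m).
have alpha0_gt0 : 0 < alpha0 by rewrite divr_gt0// mulr_gt0.
have alpha0N : alpha0 * N < pi.
  by rewrite /alpha0 mulrAC ltr_pdivrMr ?mulr_gt0//; lra.
pose S := 2 * pi - alpha0 * (2 * N - 1).
have S0 : 0 < S by rewrite /S; lra.
pose r := Order.min r0 (Order.min rw alpha0).
have r_gt0 : 0 < r by rewrite !lt_min r0_gt0 rw0.
have r_le0 : r <= r0 by rewrite ge_min lexx.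
have r_lew : r <= rw by rewrite !ge_min lexx orbT.
have r_lea : r <= alpha0 by rewrite !ge_min lexx !orbT.
pose D := (2 * N - 1) + 6 * C.
have D0 : 0 < D by rewrite /D; lra.
pose eta := Order.min (r / 4) (S / (2 * D)).
have eta0 : 0 < eta by rewrite lt_min !divr_gt0// mulr_gt0.
have eta_r : 4 * eta <= r.
  by rewrite mulrC -ler_pdivlMr// ge_min lexx.
have eta_S : eta * D <= S / 2.
  by rewrite -ler_pdivlMr// -mulrA -invfM ge_min lexx orbT.
exists alpha0, r, eta; split=> //; split=> //.
  by rewrite /alpha0; field; rewrite lt0r_neq0.
move=> k a /andP[k_ge0 k_eta] /andP[a_ge0 a_eta].
have h1 : k * (2 * N - 1) <= eta * (2 * N - 1) by apply: ler_wpM2r => //; lra.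
have h2 : a * C <= eta * C by exact: ler_wpM2r.
have h3 : alpha0 + k + 2 * (alpha0 + k) * (N - 1) + 6 * a * C < 2 * pi.
  move: h1 h2 eta_S S0; rewrite /S /D; lra.
split=> //; try lra.
apply: le_lt_trans h3; rewrite -addrA lerDl addr_ge0// !mulr_ge0//; lra.
Qed.

Section tours_of_designs.
Variables (R : realType) (n : nat) (Y : {fset CP R n}) (T : rel Y).
Local Notation V := 'rV[R]_(n + n.+1).+1.
Local Notation J := (@hopfJ R n).
Local Notation N := (max_degree T).
Local Notation w := (@edge_weight R n Y).
Hypothesis treeT : spanning_tree (@geodesic_graph R n Y) T.
Hypothesis Y2 : (1 < #|` Y|)%N.

Let Tsym : symmetric T. Proof. by case: treeT. Qed.

Let Tgeo x y : T x y -> geodesic_graph x y.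
Proof. by case: treeT => _ + _ _; apply. Qed.

Lemma tree_irreflexive : irreflexive T.
Proof. by move=> x; apply/negP => /Tgeo/asboolP[]; rewrite eqxx. Qed.

Lemma edge_weight_gt0 x y : T x y -> 0 < w x y.
Proof.
move=> /Tgeo/asboolP[xy _]; apply: CP_dist_gt0.
by apply: contraNN xy => /eqP/val_inj->.
Qed.

Let cardY : #|{: Y}| = #|` Y|. Proof. exact/esym/cardfE. Qed.

Lemma ex_edge : exists x y, T x y.
Proof.
have [x [y xy]] : exists x y : Y, x != y.
  have /card_gt1P[x [y [_ _ xy]]] : (1 < #|{: Y}|)%N by rewrite cardY.
  by exists x, y.
have /connectP[[|z p] /= xp yp] : connect T x y by case: treeT.
  by rewrite yp eqxx in xy.
by case/andP: xp => xz _; exists x, z.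
Qed.

Lemma max_degree_gt0 : (0 < N)%N.
Proof.
have [x [y xy]] := ex_edge; rewrite /max_degree (bigD1 x)//= leq_max.
by apply/orP; left; apply/card_gt0P; exists y.
Qed.

Lemma W_E : W_ T = \sum_x \sum_(y | T x y) w x y.
Proof. by rewrite /W_ /graph_weight mulrC divfK. Qed.

Lemma W_gt0 : 0 < W_ T.
Proof.
rewrite W_E; have [x [y xy]] := ex_edge.
have w0 x' y' : T x' y' -> 0 <= w x' y' by move=> /edge_weight_gt0/ltW.
rewrite (bigD1 x)//= (bigD1 y)//=.
apply: ltr_pwDl; last by apply: sumr_ge0 => ? _; apply: sumr_ge0 => ? /w0.
apply: ltr_pwDl; first exact: edge_weight_gt0.
by apply: sumr_ge0 => y' /andP[/w0].
Qed.

Lemma M_gt0 : 0 < M_ T.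
Proof.
rewrite divr_gt0 ?ltr0n ?max_degree_gt0//.
by rewrite !mulr_gt0 ?pi_gt0// subr_gt0 ltr1n.
Qed.

Let min_weight : exists2 r : R, 0 < r & forall x y, T x y -> r <= w x y.
Proof.
exists (\big[Order.min/1]_(e : Y * Y | T e.1 e.2) w e.1 e.2).
  by apply: lt_bigmin => // e; exact: edge_weight_gt0.
by move=> x y xy; apply: (@bigmin_le_cond _ _ _ _ (x, y)).
Qed.

(** Besides the tour, the list [es] certifies that the tree has |Y| - 1 edges and that their weights
    make up [W_]. *)
Lemma ex_design_tour (s : bool) delta r0 : 0 < r0 -> 0 < delta < M_ T ->
  exists alpha0 k a r x0 xs es G L, [/\ tour J s alpha0 k a r x0 xs es G L,
    dot x0 x0 = 1 /\ r <= r0, 2 * alpha0 * (#|` Y|.-1)%:R = delta,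
    [/\ size xs = #|` Y|, size es = #|` Y|.-1, W_ T = \sum_(E <- es) 2 * E.2 &
      forall E, E \in es -> exists x y, T x y /\ E.2 = w x y] &
    forall F, continuous F ->
      \sum_(x <- xs) fint J F x = \sum_(y <- Y) fint J F (emb (repr y))].
Proof.
move=> r0_gt0 /andP[delta0 deltaM].
set m : R := (#|` Y|.-1)%:R; have m0 : 0 < m by rewrite ltr0n -subn1 subn_gt0.
have N1 : (1 : R) <= N%:R by rewrite ler1n max_degree_gt0.
have NE : (N.-1)%:R = N%:R - 1 :> R.
  by rewrite -subn1 natrB// max_degree_gt0.
have deltaN : delta * N%:R < 2 * pi * m.
  move: deltaM; rewrite /M_ ltr_pdivlMr ?(lt_le_trans ltr01)//.
  by rewrite /m -subn1 natrB// ltnW.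
have [rw rw0 rwP] := min_weight.
have [alpha0 [r [eta [[am alpha0_gt0 [r_gt0 r_le0 r_lew r_lea] eta0 small] eta_r]]]] :=
  ex_small_parameters delta0 m0 N1 (ler0n R #|{: Y}|) r0_gt0 rw0 deltaN.
(* The smooth profile deviates by at most [eta], so [a = eta]; right-angled corners have neither
   width nor additional length. *)
have [k [a [k_eta a_eta prof]]] : exists k a, [/\ 0 <= k <= eta, 0 <= a <= eta &
    forall x y, T x y -> exists u w', profile a (w x y + k) (w x y) u w' /\ regular_profile J s u w'].
  case: s.
    have [k [k_eta kP]] := ex_smooth_profile eta0.
    exists k, eta; split=> // [|x y xy]; first by rewrite lexx ltW.
    have [|u [w' [uw suw]]] := kP (w x y).
      have := rwP _ _ xy; move: eta0 eta_r r_lew; lra.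
    exists u, w'; split=> //.
    exact: (regular_smooth_profile (@hopfJJ R n) (@dot_hopfJ R n)).
  exists 0, 0; split=> [||x y xy]; rewrite ?lexx ?ltW//.
  rewrite addr0.
  exact: (ex_geodesic_profile (@hopfJJ R n) (@dot_hopfJ R n) (edge_weight_gt0 xy)).
have [alpha_lt a_lt a_le k_le sm] := small _ _ k_eta a_eta.
have /choice[pv pvP] : forall e : Y * Y, exists pv : V * V, T e.1 e.2 ->
    [/\ horizontal J pv.1 pv.2, exists t, pv.1 = rot J t (emb (repr (val e.1))),
      exists t, circ pv.1 pv.2 (w e.1 e.2) = rot J t (emb (repr (val e.2))) &
      forall x (y : Y) t, 0 < x < w e.1 e.2 -> circ pv.1 pv.2 x <> rot J t (emb (repr (val y)))].
  move=> [x y]; case: (boolP (T x y)) => [/Tgeo/geodesic_graph_lift|_]; last by exists 0.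
  by move=> [p [v [pv px py pi]]]; exists (p, v) => _; split=> // s' z t /pi; apply.
have [y0 _] := ex_edge.
have /andP[k_ge0 _] := k_eta; have /andP[a_ge0 _] := a_eta.
pose rep (y : Y) : V := emb (repr (val y)).
have rep1 y : dot (rep y) (rep y) = 1 by exact: emb_unit.
have rep_neq x y t : rep x = rot J t (rep y) -> x = y.
  by move=> xy; apply/val_inj/esym/(eq_CP xy).
have lift x y : T x y -> [/\ horizontal J (pv (x, y)).1 (pv (x, y)).2,
  r <= w x y <= pi / 2, exists t, (pv (x, y)).1 = rot J t (rep x),
  exists t, circ (pv (x, y)).1 (pv (x, y)).2 (w x y) = rot J t (rep y) &
  forall z m t, 0 < z < w x y -> circ (pv (x, y)).1 (pv (x, y)).2 z <> rot J t (rep m)].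
  move=> xy; have [? ? ? ?] := pvP (x, y) xy; split=> //.
  by rewrite (le_trans r_lew (rwP _ _ xy)) CP_dist_le.
have Tcon x y : connect T x y by case: treeT.
have Tacyc q : (2 < size q)%N -> ~~ ucycleb T q by case: treeT => _ _ _; apply.
have wC x y : w x y = w y x by exact: CP_distC.
rewrite -NE in sm.
have r_le : r <= alpha0 + k by rewrite (le_trans r_lea)// lerDl.
have [ed ged pe] := @grow_all R _ J (@hopfJJ R n) (@dot_hopfJ R n)
  s alpha0 k a r alpha0_gt0 k_ge0 a_ge0 alpha_lt a_lt r_gt0 a_le k_le
  r_le Y rep T
  (fun x y => (pv (x, y)).1) (fun x y => (pv (x, y)).2) w y0 rep1 rep_neq Tsym tree_irreflexive
  Tcon Tacyc wC lift prof sm.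
have [G [L tG]] := grown_tour ged.
have edT e : e \in ed -> T e.1.1 e.1.2 by move=> /(grown_edges ged)[].
have sY : (size ed).+1 = #|` Y|.
  by rewrite -cardY cardE -(perm_size pe) size_cat size_map addn1.
exists alpha0, k, a, r, (rep y0), (fibres J rep (fun x y => (pv (x, y)).1)
  (fun x y => (pv (x, y)).2) w y0 ed), [seq strip_of J (fun x y => (pv (x, y)).1)
  (fun x y => (pv (x, y)).2) w e | e <- ed], G, L; split=> //.
- split.
  + by rewrite size_cat size_map addn1.
  + by rewrite size_map -sY.
  + rewrite big_map/= (grown_weight ged) W_E (perm_big _ pe)/= big_enum/=.
    by apply: eq_bigr => x _; rewrite (perm_big _ pe)/= big_enum_cond.
  + by move=> _ /mapP[e eed ->]; exists e.1.1, e.1.2; split=> //; exact: edT.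
- move=> F cF; rewrite (fint_fibres (@hopfJJ R n) (@dot_hopfJ R n) _ rep1 lift edT cF).
  by rewrite (perm_big _ pe)/= big_enum/= [RHS]big_seq_fsetE.
Qed.

End tours_of_designs.

Theorem proposition3p1 (R : realType) (n t : nat)
    (sigma : probability (borel (hopf_sphere R n)) R)
    (Y : {fset CP R n}) (T : rel Y) :
  (0 < n)%N -> (2 <= t)%N ->
  uniform_measure sigma ->
  design_set sigma t./2 Y ->
  minimum_spanning_tree (@edge_weight R n Y) (@geodesic_graph R n Y) T ->
  [/\ 0 < W_ T,
      W_ T <= 2 * ((#|` Y|)%:R - 1)
              * sup [set CP_dist y1 y2 | y1 in [set` Y] & y2 in [set` Y]],
      0 < M_ T &
      forall delta : R, 0 < delta < M_ T ->
        let eps := (W_ T + delta) / (2 * pi * (#|` Y|)%:R) in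
        let c := (2 * pi * (#|` Y|)%:R)^-1 in
        let l := 2 * pi * (#|` Y|)%:R + W_ T - delta in
        (exists gamma : R -> hopf_sphere R n,
           [/\ simple_curve gamma, approx_design_curve sigma eps c t gamma,
               curve_length gamma = l & geodesic_cycle gamma]) /\
        (exists gamma : R -> hopf_sphere R n,
           [/\ simple_curve gamma, approx_design_curve sigma eps c t gamma,
               curve_length gamma = l & smooth_closed_curve gamma])].
Proof.
move=> n0 t2 usigma design [treeT _].
have k0 : (0 < t./2)%N by rewrite half_gt0.
(* With two points the tree has an edge, which makes both [W_] and [M_] positive. *)
have Y2 := design_gt1 usigma design n0 k0.
have W0 := W_gt0 treeT Y2; have M0 := M_gt0 treeT Y2.
have p0 := pi_gt0 R.
have cY0 : 0 < 2 * pi * (#|` Y|)%:R :> R by rewrite !mulr_gt0// ltr0n ltnW.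
have mE : (#|` Y|.-1)%:R = (#|` Y|)%:R - 1 :> R by rewrite -subn1 natrB// ltnW.
split=> //.
  (* A tour for any admissible delta lists the |Y| - 1 edges; each weight is at most the
     supremum. *)
  have M2 : 0 < M_ T / 2 < M_ T by rewrite divr_gt0//= ltr_pdivrMr// ltr_pMr// ltr1n.
  have [_ [_ [_ [_ [_ [_ [es [_ [_ [_ _ _ [_ ses -> esT] _]]]]]]]]]] :=
    ex_design_tour treeT Y2 false (@ltr01 R) M2.
  set S := sup _.
  apply: (@le_trans _ _ (\sum_(E <- es) 2 * S)); last first.
    by rewrite big_const_seq iter_addr_0 count_predT ses -mE -mulr_natl; lra.
  rewrite !big_seq; apply: ler_sum => E /esT[x [y [_ ->]]]; rewrite ler_pM2l//.
  apply: ub_le_sup.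
    by exists (pi / 2) => _ [y1 _ [y2 _ <-]]; exact: CP_dist_le.
  by exists (val x); [exact: valP|exists (val y); [exact: valP|]].
move=> delta deltaM eps c l; have /andP[delta0 _] := deltaM.
have [r0 r0_gt0 r0P] := @sphere_poly_tame R (n + n.+1) t.
have curve s : exists gamma : R -> hopf_sphere R n,
    [/\ simple_curve gamma, approx_design_curve sigma eps c t gamma,
        curve_length gamma = l & if s then smooth_closed_curve gamma else geodesic_cycle gamma].
  have [alpha0 [k [a [r [x0 [xs [es [G [L [tG [x01 r_le] am [sxs ses WE _] xsE]]]]]]]]]] :=
    ex_design_tour treeT Y2 s r0_gt0 deltaM.
  have aE : \sum_(E <- es) 2 * alpha0 = delta.
    by rewrite big_const_seq iter_addr_0 count_predT ses -am mulr_natr.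
  have LE : L = l.
    by rewrite (tour_length tG) sxs sumrB -WE aE addrA.
  exists (tour_curve G L); split.
  - exact: tour_simple tG.
  - split.
    + by rewrite /eps /c invr_gt0 cY0 divr_ge0 ?ltW// addr_gt0.
    + exact: tour_closed tG.
    + exact: tour_smooth_arcs tG.
    + by rewrite (tour_simple tG).
    move=> f ft; have [F [fF cF tF]] := r0P f r r_le ft.
    rewrite (tour_curve_integral tG cF fF).
    have := tour_integral tG tF; have -> := big_split _ es predT (fun E => 2 * E.2) (fun=> 2 * alpha0).
    rewrite -WE aE xsE// (design_fint usigma design erefl ft fF) => H.
    (* Multiplication by 2 pi |Y| turns the claim into the integral estimate of the tour, in which
       the design property has evaluated the circles. *)
    rewrite /eps /c [leRHS]mulrAC -(ler_pM2r cY0) divfK ?gt_eqF//.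
    rewrite -[X in _ * X <= _](gtr0_norm cY0) -normrM mulrBl mulrAC mulVf ?gt_eqF// mul1r.
    by rewrite [X in `|_ - X|]mulrC.
  - have c1 : continuous (fun _ : 'rV[R]_(n + n.+1).+1 => 1 : R) by exact: cst_continuous.
    rewrite /curve_length (tour_curve_integral tG c1)//.
    by rewrite (_ : _ \o _ = fun=> 1)// oint_cst subr0 mulr1.
  - case: s tG => tG.
      exact: (tour_smooth_closed (@hopfJJ R n) (@dot_hopfJ R n) x01 tG).
    exact: tour_geodesic tG _.
by split; [exact: (curve false)|exact: (curve true)].
Qed.
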